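(* Let $\beta,\lambda>0$, $T>0$, and suppose $G:\mathbb{R}^d\to\mathbb{R}$ satisfies: (i) $G$ is bounded below; (ii) $G$ is continuously differentiable; (iii) $x^\top\nabla G(x)\ge -K$ for all $x$, for some constant $K$; (iv) $\sup_x\|\nabla G(x)\|_\infty<\infty$; (v) $\nabla G$ is Lipschitz. Let $(u_t,v_t)$ solve on $\mathcal X=(0,\infty)^d\times\mathbb{R}^d$ $$du_t=-\lambda u_t\,dt-v_t\odot\nabla G(u_t\odot v_t)\,dt+\frac1{\beta u_t}\,dt+\sqrt{2/\beta}\,dW^1_t,\qquad dv_t=-\lambda v_t\,dt-u_t\odot\nabla G(u_t\odot v_t)\,dt+\sqrt{2/\beta}\,dW^2_t,$$ and let $(u^k,v^k)$ be given, for time step $\Delta t>0$, by $$u^{k+1}-u^k=-\lambda u^{k+1}\Delta t-v^k\odot\nabla G(u^k\odot v^k)\Delta t+\frac{1}{\beta u^{k+1}}\Delta t+\sqrt{2/\beta}\,\Delta W^1_k,\qquad u^{k+1}>0,$$ $$v^{k+1}-v^k=-\lambda v^{k+1}\Delta t-u^k\odot\nabla G(u^k\odot v^k)\Delta t+\sqrt{2/\beta}\,\Delta W^2_k.$$ Suppose that $(u^0,v^0)$ and $(u_0,v_0)$ (the initial values of the scheme and of the SDE) follow an initial distribution $\rho_0\ll\pi$ such that $\rho_0/\pi$ is uniformly bounded. Let $t_k=k\Delta t$ and $e(t_k)=(u_{t_k}-u^k,\,v_{t_k}-v^k)$. Then, for any $\epsilon>0$ and any $R>0$, $$\mathbb{E}\Bigl[\sup_{0\le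 t_k\le T}\|e(t_k)\|\Bigr]\le c_R\,d\,\exp(2TC_R)\,\Delta t^{\frac12-\epsilon}+C\sqrt T\,e^{-C(R^2/T)},$$ where $c_R$ and $C_R$ depend on $R$, and $C>0$ is a constant. One can choose $R$ and $\Delta t$ to make the right-hand side arbitrarily small, and hence $\mathbb{E}\bigl[\sup_{0\le t_k\le T}\|e(t_k)\|\bigr]\to0$ as $\Delta t\to0$.
   Context: $\odot$ is the entrywise product, $1/u$ is entrywise, $\|\cdot\|$ is the Euclidean norm, $\|\cdot\|_\infty$ the max norm. $W^1,W^2$ are independent standard $\mathbb{R}^d$-valued Brownian motions, the same ones driving the SDE and the scheme, with $\Delta W^i_k=W^i_{t_{k+1}}-W^i_{t_k}$. The implicit equation for $u^{k+1}$ has a unique positive solution. $\pi$ is the probability measure on $\mathcal X$ with density proportional to $\prod_{i=1}^d u_i\exp\bigl(-\beta(\tfrac12\lambda\|(u,v)\|^2+G(u\odot v))\bigr)$, and $\rho_0/\pi$ denotes the Radon–Nikodym density. *)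

(* Defs.v *)
From HB Require Import structures.
From mathcomp Require Import all_boot all_order all_algebra.
From mathcomp Require Import all_classical all_reals all_analysis.

Set Implicit Arguments.
Unset Strict Implicit.
Unset Printing Implicit Defensive.

Import Order.TTheory GRing.Theory Num.Theory.
Import numFieldNormedType.Exports.

Local Open Scope classical_set_scope.
Local Open Scope ring_scope.

Section euclidean.
Context {R : realType}.

(* The library norm [`|x|] on ['rV[R]_n] is the max norm. *)
Definition enorm n (x : 'rV[R]_n) : R := Num.sqrt (\sum_(i < n) x 0 i ^+ 2).

Definition dotv n (x y : 'rV[R]_n) : R := \sum_(i < n) x 0 i * y 0 i.

Definition odot n (x y : 'rV[R]_n) : 'rV[R]_n := \row_i (x 0 i * y 0 i).

Definition einv n (x : 'rV[R]_n) : 'rV[R]_n := \row_i (x 0 i)^-1.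

Definition grad n (G : 'rV[R]_n -> R) (x : 'rV[R]_n) : 'rV[R]_n :=
  \row_i 'D_(delta_mx 0 i) G x.

Definition positive_vec n (x : 'rV[R]_n) : Prop := forall i, 0 < x 0 i.

End euclidean.

Record potential_assumptions (R : realType) (d : nat) (G : 'rV[R]_d -> R)
  : Prop := {
  pot_bounded_below : exists m : R, forall x, m <= G x ;
  pot_differentiable : forall x, differentiable G x ;
  pot_grad_continuous : continuous (grad G) ;
  pot_dissipative : exists K : R, forall x, - K <= dotv x (grad G x) ;
  pot_grad_bounded : exists B : R, forall x, `|grad G x| <= B ;
  pot_grad_lipschitz : exists L : R, forall x y,
    enorm (grad G x - grad G y) <= L * enorm (x - y) }.

Section lebesgue_tuple.
Context {R : realType}.
Local Open Scope ereal_scope.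

Local Notation T := (measurableTypeR R).

Definition tcons n (z : T * n.-tuple T) : n.+1.-tuple T :=
  [tuple of z.1 :: z.2].

Definition utcons n (t : n.+1.-tuple T) : T * n.-tuple T :=
  (thead t, [tuple of behead t]).

Lemma tconsK n : cancel (@tcons n) (@utcons n).
Proof. by case=> x t; congr pair; apply/val_inj. Qed.

Lemma measurable_tcons n : measurable_fun [set: T * n.-tuple T] (@tcons n).
Proof. by apply: measurable_cons. Qed.

Lemma measurable_utcons n : measurable_fun [set: n.+1.-tuple T] (@utcons n).
Proof.
apply/measurable_fun_pairP; split.
  exact: measurable_tnth.
exact: measurable_behead.
Qed.

Section step.
Context n (m : {sigma_finite_measure set (n.-tuple T) -> \bar R}).

Definition leb_step : set (n.+1.-tuple T) -> \bar R :=
  pushforward (@lebesgue_measure R \x m) (@tcons n).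

Let leb_step0 : leb_step set0 = 0.
Proof. by rewrite /leb_step /pushforward preimage_set0 measure0. Qed.

Let leb_step_ge0 A : 0 <= leb_step A.
Proof. by rewrite /leb_step /pushforward; exact: measure_ge0. Qed.

Let mpre A : measurable A -> measurable (@tcons n @^-1` A).
Proof.
by move=> mA; rewrite -[X in measurable X]setTI; exact: measurable_tcons.
Qed.

Let leb_step_sigma_additive : semi_sigma_additive leb_step.
Proof.
move=> F mF tF mUF; rewrite /leb_step /pushforward preimage_bigcup.
apply: measure_semi_sigma_additive.
- by move=> k; exact: mpre.
- apply/trivIsetP => /= i j _ _ ij; rewrite -preimage_setI.
  by move/trivIsetP : tF => /(_ _ _ _ _ ij) ->//; rewrite preimage_set0.
- by rewrite -preimage_bigcup; exact: mpre.
Qed.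

HB.instance Definition _ := isMeasure.Build _ _ _ leb_step
  leb_step0 leb_step_ge0 leb_step_sigma_additive.

Let leb_step_sigma_finite : sigma_finite setT leb_step.
Proof.
have /sigma_finiteP[F [TF ndF Foo]] := sigma_finiteT (@lebesgue_measure R).
have /sigma_finiteP[G [TG ndG Goo]] := sigma_finiteT m.
exists (fun k => @utcons n @^-1` (F k `*` G k)).
  rewrite -preimage_bigcup (_ : \bigcup_k (F k `*` G k) = setT) ?preimage_setT//.
  rewrite -setXTT TF TG; apply/seteqP; split => [[x y] [k _ [/= Fx Gy]]|].
    by split; exists k.
  move=> [x y] [/= [i _ Fx] [j _ Gy]]; exists (maxn i j) => //; split.
    by move: x Fx; exact/subsetPset/ndF/leq_maxl.
  by move: y Gy; exact/subsetPset/ndG/leq_maxr.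
move=> k; have [mF Fk] := Foo k; have [mG Gk] := Goo k; split.
  rewrite -[X in measurable X]setTI; apply: measurable_utcons => //.
  exact: measurableX.
rewrite /leb_step /pushforward -comp_preimage.
rewrite (_ : _ \o _ = id) ?preimage_id; last exact/funext/tconsK.
by rewrite product_measure1E// lte_mul_pinfty// ge0_fin_numE.
Qed.

HB.instance Definition _ := Measure_isSigmaFinite.Build _ _ _ leb_step
  leb_step_sigma_finite.

End step.

(* Lebesgue measure on R^n, as the n-fold product measure. *)
Fixpoint leb_tuple n : {sigma_finite_measure set (n.-tuple T) -> \bar R} :=
  match n with
  | 0%N => @dirac _ _ [tuple] R
  | n'.+1 => leb_step (leb_tuple n')
  end.

End lebesgue_tuple.

Section target.
Context {R : realType} (d : nat).

Definition phase_point := (d.-tuple (measurableTypeR R) *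
                           d.-tuple (measurableTypeR R))%type.

Definition vec_of_tuple n (t : n.-tuple R) : 'rV[R]_n := \row_i tnth t i.

Definition tuple_of_vec n (x : 'rV[R]_n) : n.-tuple R := [tuple x 0 i | i < n].

Definition phase_space : set phase_point :=
  [set z | positive_vec (vec_of_tuple z.1)].

Definition target_weight (beta lambda : R) (G : 'rV[R]_d -> R)
    (z : phase_point) : R :=
  let u := vec_of_tuple z.1 in
  let v := vec_of_tuple z.2 in
  (\prod_(i < d) u 0 i) *
  expR (- beta * (2^-1 * lambda * enorm (row_mx u v) ^+ 2 + G (odot u v))).

(* [mu] is the probability measure on [phase_space] whose Lebesgue density is
   proportional to [target_weight]. *)
Definition is_target (beta lambda : R) (G : 'rV[R]_d -> R)
    (mu : set phase_point -> \bar R) : Prop :=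
  exists Z : R, 0 < Z /\
    forall A : set phase_point, measurable A ->
      mu A = (Z^-1%:E * \int[leb_tuple d \x leb_tuple d]_(z in A `&` phase_space)
                          (target_weight beta lambda G z)%:E)%E.

End target.
Arguments phase_point : clear implicits.

Section processes.
Context {R : realType} {disp : measure_display} {Omega : measurableType disp}.
Variable P : probability Omega R.

Definition measurable_vec n (X : Omega -> 'rV[R]_n) : Prop :=
  forall i, measurable_fun [set: Omega] (fun w => X w 0 i).

Definition mutually_independent (I : finType) (F : I -> set (set Omega))
  : Prop :=
  forall (J : {set I}) (A : I -> set Omega), (forall i, i \in J -> F i (A i)) ->
    P (\big[setI/setT]_(i in J) A i) = (\prod_(i in J) P (A i))%E.

Definition independent_pair (F1 F2 : set (set Omega)) : Prop :=
  forall A B, F1 A -> F2 B -> P (A `&` B) = (P A * P B)%E.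

(* sigma-algebra generated by the real random variables [X j], [j] in [D] *)
Definition sigma_generated (J : Type) (D : set J) (X : J -> Omega -> R)
  : set (set Omega) :=
  <<s [set A | exists j, D j /\ exists B : set (measurableTypeR R),
                 measurable B /\ A = X j @^-1` B] >>.

Definition sigma_vec n (X : Omega -> 'rV[R]_n) : set (set Omega) :=
  sigma_generated setT (fun i w => X w 0 i).

Definition sigma_process n (X : R -> Omega -> 'rV[R]_n) : set (set Omega) :=
  sigma_generated [set p : R * 'I_n | 0 <= p.1] (fun p w => X p.1 w 0 p.2).

Record standard_brownian (B : R -> Omega -> R) : Prop := {
  bm_measurable : forall t, 0 <= t -> measurable_fun [set: Omega] (B t) ;
  bm_start : {ae P, forall w, B 0 w = 0} ;
  bm_gaussian : forall s t, 0 <= s -> s < t ->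
    forall A : set (measurableTypeR R), measurable A ->
      P [set w | A (B t w - B s w)] = normal_prob 0 (Num.sqrt (t - s)) A ;
  bm_independent : forall s t, 0 <= s -> s < t ->
    independent_pair (sigma_generated [set r | 0 <= r <= s] B)
      (sigma_generated [set: unit] (fun _ w => B t w - B s w)) ;
  bm_continuous : {ae P, forall w,
    {within `[0, +oo[%classic, continuous (fun t : R => B t w)}} }.

Definition standard_brownian_vec n (W : R -> Omega -> 'rV[R]_n) : Prop :=
  (forall i, standard_brownian (fun t w => W t w 0 i)) /\
  mutually_independent (fun i : 'I_n =>
    sigma_generated [set t : R | 0 <= t] (fun t w => W t w 0 i)).

Section dynamics.
Context (d : nat).
Variables (beta lambda : R) (G : 'rV[R]_d -> R).
Variables (W1 W2 : R -> Omega -> 'rV[R]_d).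

(* The noise is additive, so the SDE is the pathwise integral equation. *)
Record sde_solution (u v : R -> Omega -> 'rV[R]_d) : Prop := {
  sde_measurable : forall t, 0 <= t ->
    measurable_vec (u t) /\ measurable_vec (v t) ;
  sde_continuous : {ae P, forall w,
    {within `[0, +oo[%classic, continuous (fun t : R => u t w)} /\
    {within `[0, +oo[%classic, continuous (fun t : R => v t w)}} ;
  sde_positive : {ae P, forall w, forall t, 0 <= t -> positive_vec (u t w)} ;
  sde_u : {ae P, forall w, forall t, 0 <= t -> forall i,
    u t w 0 i = u 0 w 0 i
      + \int[lebesgue_measure]_(s in `[0, t])
          ((- lambda *: u s w
            - odot (v s w) (grad G (odot (u s w) (v s w)))
            + beta^-1 *: einv (u s w)) 0 i)
      + Num.sqrt (2 / beta) * W1 t w 0 i} ;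
  sde_v : {ae P, forall w, forall t, 0 <= t -> forall i,
    v t w 0 i = v 0 w 0 i
      + \int[lebesgue_measure]_(s in `[0, t])
          ((- lambda *: v s w
            - odot (u s w) (grad G (odot (u s w) (v s w)))) 0 i)
      + Num.sqrt (2 / beta) * W2 t w 0 i} }.

(* [dt] is the time step; [U k], [V k] live at time [k * dt] and [U 0], [V 0]
   are left free. *)
Record scheme_solution (dt : R) (U V : nat -> Omega -> 'rV[R]_d) : Prop := {
  scheme_measurable : forall k, measurable_vec (U k) /\ measurable_vec (V k) ;
  scheme_positive : {ae P, forall w, forall k, positive_vec (U k.+1 w)} ;
  scheme_u : {ae P, forall w, forall k,
    U k.+1 w - U k w =
      - (lambda * dt) *: U k.+1 w
      - dt *: odot (V k w) (grad G (odot (U k w) (V k w)))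
      + (dt / beta) *: einv (U k.+1 w)
      + Num.sqrt (2 / beta) *: (W1 (k.+1%:R * dt) w - W1 (k%:R * dt) w)} ;
  scheme_v : {ae P, forall w, forall k,
    V k.+1 w - V k w =
      - (lambda * dt) *: V k.+1 w
      - dt *: odot (U k w) (grad G (odot (U k w) (V k w)))
      + Num.sqrt (2 / beta) *: (W2 (k.+1%:R * dt) w - W2 (k%:R * dt) w)} }.

End dynamics.

Section error.
Context (d : nat).
Variables (u v : R -> Omega -> 'rV[R]_d) (dt : R).
Variables (U V : nat -> Omega -> 'rV[R]_d).

Definition scheme_error (k : nat) (w : Omega) : 'rV[R]_(d + d) :=
  row_mx (u (k%:R * dt) w - U k w) (v (k%:R * dt) w - V k w).

Definition sup_error (T : R) (w : Omega) : \bar R :=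
  ereal_sup [set (enorm (scheme_error k w))%:E
            | k in [set k : nat | k%:R * dt <= T]].

Definition expected_sup_error (T : R) : \bar R :=
  (\int[P]_w sup_error T w)%E.

End error.

End processes.

Definition error_bound (R : realType) (d : nat) (T c_R C_R C dt eps r : R) : R :=
  c_R * d%:R * expR (2 * T * C_R) * dt `^ (2^-1 - eps)
  + C * Num.sqrt T * expR (- (C * (r ^+ 2 / T))).

(* Main.v *)
(** The noise is additive, so everything is pathwise apart from Gaussian tails.
    In each coordinate the drift is the sum of a decreasing function of the
    coordinate (the implicit part, including the singular term) and of the
    field [b].  Hence, over one step, either the exact path meets the new value
    of the scheme and the error is at most the oscillation of the path, or
    monotonicity bounds the new error by the old one plus [dt * sup |b - b_k|].
    As [b] is Lipschitz with constant [O(|z|^2)] along the exact path [z],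
    iterating bounds the error by [exp (C T sup |z|^2)] times the oscillation of
    [z] over a step, which is [O(sqrt dt + osc W + dt sup |z|)]: when [u] is below
    [sqrt dt] nothing is to be shown, above it the singular drift is at most
    [1 / (beta sqrt dt)].  No moment of [1 / u] is needed.

    By dissipativity the energy of [Z - (W + M)], with [M >= sup |W|] so that the
    shift is nonnegative and does not see the singularity, stays bounded along
    the scheme, hence along [z] by letting [dt] tend to [0]:
    [sup |z|^2 = O(1 + |z_0|^2 + sup |W|^2)].  Ottaviani's inequality and
    [rho_0 <= M pi] give Gaussian tails for the right-hand side.  For small [T]
    these absorb the factor [exp (C T sup |z|^2)]; for other [T] one truncates at
    [sup |z|^2 <= rho], at the cost of the term in [exp (- theta rho / T)].  As
    [exp (a + b) <= exp (2 a) + exp (2 b)], the exponential moments involved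
    reduce to those of [|z_0|^2] and of each component of [sup |W|^2]. *)

Require Import Defs.
From HB Require Import structures.
From mathcomp Require Import all_boot all_order all_algebra.
From mathcomp Require Import all_classical all_reals all_analysis.
From mathcomp Require Import measurable_realfun.
From mathcomp Require Import ring lra.

Set Implicit Arguments.
Unset Strict Implicit.
Unset Printing Implicit Defensive.

Import Order.TTheory GRing.Theory Num.Theory.
Import numFieldNormedType.Exports.

Local Open Scope classical_set_scope.
Local Open Scope charge_scope.
Local Open Scope ring_scope.

(** * Continuous real paths *)

(** The loss [epsilon] comes from the maximum of the noise oscillation over about [T / dt] cells: it
    is dominated by a sum of [n]-th powers of normalised squared oscillations, whose mean is [O(T)]
    uniformly in [dt], at the cost of a factor [dt^(-1/(2n))]. The constant [C] of the claim
    precedes [epsilon] and [R], so only the prefactor may depend on [n]. Two obstacles force case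
    distinctions. First, [|z_0|^2] has exponential moments only up to a fixed order. With [s] the
    squared size of the path, the mean of [exp (C T s)] is therefore controlled for small [T] only,
    while truncation, which needs that of [exp (2 theta s / T)], breaks down as [T] tends to [0];
    the two ranges meet at a threshold. Second, the energy of the scheme is controlled for small
    [dt] only; for larger [dt] a rate is no more than a constant, and the linear growth of the field
    gives an error with a deterministic exponential factor. No chain rule is applied to the exact
    path: its a priori bound is read off from the scheme run with steps [T / n.+1], which is why the
    pathwise lemmas carry a family of schemes. *)

Lemma last_exit (R : realType) (f : R -> R) (s t c : R) :
  continuous f -> s <= t -> f s <= c -> c < f t ->
  exists x, [/\ s <= x <= t, f x = c & forall y, x <= y <= t -> c <= f y].
Proof.
move=> cf st fs ft.
pose E := `[s, t]%classic `&` (f @^-1` [set y | y <= c]).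
have Es : E s by split => //=; rewrite in_itv /= lexx.
have ubE : ubound E t by move=> x [/=]; rewrite in_itv /= => /andP[].
have supE : has_sup E by split; [exists s|exists t].
have clE : closed E.
  apply: closedI; first exact: itv_closed.
  by apply: preimage_closed => //; exact: closed_le.
have Ex : E (sup E).
  by rewrite {1}((closure_id _).1 clE); apply: closure_sup; case: supE.
set x := sup E in Ex *.
have [] := Ex; rewrite /= in_itv /= => /andP[sx xt] fx.
have gtx y : x < y -> y <= t -> c < f y.
  move=> xy yt; rewrite ltNge; apply/negP => fy.
  have : E y by split => //=; rewrite in_itv /= yt (ltW (le_lt_trans sx xy)).
  by move=> /(ub_le_sup supE.2); rewrite leNgt xy.
have fxc : f x = c.
  have [||y] := @IVT R f x t c xt.
  - exact: continuous_subspaceT.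
  - by rewrite ge_min fx le_max (ltW ft) orbT.
  rewrite in_itv /= => /andP[xy yt] fy.
  move: xy; rewrite le_eqVlt => /orP[/eqP ->//|xy].
  by have := gtx _ xy yt; rewrite fy ltxx.
exists x; split => //; first by rewrite sx.
move=> y /andP[]; rewrite le_eqVlt => /orP[/eqP <-|xy yt]; first by rewrite fxc.
exact/ltW/gtx.
Qed.

(** Compactness is used through neighbourhoods in the whole line, so only [s] has to lie in the
    segment, and one mesh serves the finitely many coordinates. *)
Lemma uniform_continuity_segment (R : realType) (I : finType) (f : I -> R -> R)
    (T e : R) : 0 < T -> 0 < e -> (forall i, continuous (f i)) ->
  exists n : nat, forall s t i, 0 <= s <= T ->
    `|s - t| <= T / n.+1%:R -> `|f i s - f i t| <= e.
Proof.
move=> T0 e0 cf.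
have /compact_near_coveringP K : compact `[0, T]%classic by exact: segment_compact.
pose P (n : nat) s := forall t i, `|s - t| <= T / n.+1%:R -> `|f i s - f i t| <= e.
have : \forall n \near \oo, `[0, T]%classic `<=` P n.
  apply: K => x _.
  have : \forall y \near x, forall i, `|f i x - f i y| < e / 2.
    apply: (@filter_forall R I (fun i y => `|f i x - f i y| < e / 2) (nbhs x)) => i.
    by have /cvgrPdist_lt /(_ (e / 2)) := cf i x; apply; rewrite divr_gt0.
  move=> /nbhs_ballP[d /= d0 dP].
  exists (ball x (d / 2), [set n | T / n.+1%:R < d / 2]) => /=.
    split; first by apply: nbhsx_ballx; rewrite divr_gt0.
    have := near_infty_natSinv_lt (PosNum (divr_gt0 (divr_gt0 d0 (ltr0n _ 2)) T0)).
    apply: filterS => n /=; rewrite ltr_pdivlMr// mulrC; exact.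
  move=> [y n] /= [yx nd] t i yt.
  have xy : ball x d y by apply: le_ball yx; rewrite ler_pdivrMr// ler_peMr ?ler1n// ltW.
  have xt : ball x d t.
    rewrite /ball /= in yx *; have := ler_distD y x t.
    by move=> /le_lt_trans; apply; rewrite (splitr d) ltrD// (le_lt_trans yt).
  have := ler_distD (f i x) (f i y) (f i t).
  move=> /le_trans; apply; rewrite (splitr e) distrC lerD//; apply: ltW; exact: dP.
move=> [n _ nP]; exists n => s t i sT st.
by apply: (nP n) => //=; rewrite in_itv.
Qed.

(** * One-step and global error of the scheme along a path *)

Section pathwise.
Context {R : realType} {I : finType}.
Variables (lam : R) (a : I -> R) (b : I -> (I -> R) -> R).
Hypotheses (lam_gt0 : 0 < lam) (a_ge0 : forall p, 0 <= a p).

(** The part of the drift that the scheme treats implicitly. A coordinate with [a p = 0] has no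
    singular term and no sign constraint, so [u] and [v] are handled by the same lemmas. *)
Definition relax p (x : R) : R := a p / x - lam * x.

Lemma relax_anti p x y : (0 < a p -> 0 < x) -> x <= y -> relax p y <= relax p x.
Proof.
move=> x0 xy; rewrite /relax lerB//; last by rewrite ler_wpM2l// ltW.
have := a_ge0 p; rewrite le_eqVlt => /orP[/eqP <-|a0]; first by rewrite !mul0r.
by rewrite ler_pM2l// lef_pV2// posrE ?x0// (lt_le_trans (x0 a0)).
Qed.

(* The increments of [z - w] are controlled by one-sided bounds on the drift
   [relax - b]: all that is used of the integral equation. *)
Record driven (T : R) (w z : R -> I -> R) : Prop := {
  driven_pos : forall p t, 0 < a p -> 0 <= t <= T -> 0 < z t p ;
  driven_ub : forall p s t c, 0 <= s -> s <= t -> t <= T ->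
    (forall r, s <= r <= t -> relax p (z r p) - b p (z r) <= c) ->
    z t p - z s p <= c * (t - s) + (w t p - w s p) ;
  driven_lb : forall p s t c, 0 <= s -> s <= t -> t <= T ->
    (forall r, s <= r <= t -> c <= relax p (z r p) - b p (z r)) ->
    c * (t - s) + (w t p - w s p) <= z t p - z s p }.

Record scheme_path (dt : R) (w : R -> I -> R) (Z : nat -> I -> R) : Prop := {
  scheme_path_pos : forall p k, 0 < a p -> 0 < Z k p ;
  scheme_path_eq : forall p k, Z k.+1 p - Z k p =
    dt * (relax p (Z k.+1 p) - b p (Z k)) + (w (k.+1%:R * dt) p - w (k%:R * dt) p) }.

(* If the path meets [Z1] during the step, the error is at most its
   oscillation; otherwise monotonicity of [relax] contracts the error. *)
Lemma step_error T w z p s t Z0 Z1 b0 c e m : driven T w z ->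
  0 <= s -> s <= t -> t <= T -> (0 < a p -> 0 < Z1) ->
  Z1 - Z0 = (t - s) * (relax p Z1 - b0) + (w t p - w s p) ->
  (forall r, s <= r <= t -> `|z t p - z r p| <= e) ->
  (forall r, s <= r <= t -> `|b p (z r) - b0| <= c) ->
  e <= m -> `|z s p - Z0| + (t - s) * c <= m -> `|z t p - Z1| <= m.
Proof.
move=> [zpos zub zlb] s0 st tT Z1pos Z1E osc bb em m0.
have zp r : s <= r <= t -> 0 < a p -> 0 < z r p.
  by move=> /andP[sr rt] a0; apply: zpos => //; apply/andP; split; lra.
have := ler_norm (z s p - Z0); have := ler_norm (- (z s p - Z0)); rewrite normrN.
move=> n1 n2; rewrite ler_norml; apply/andP; split.
- have [[r rst Zr]|/forall2NP nZ] := pselect (exists2 r, s <= r <= t & Z1 <= z r p).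
    by have := osc _ rst; rewrite ler_norml => /andP[]; lra.
  have := zlb p s t (relax p Z1 - b0 - c) s0 st tT; rewrite mulrC => h.
  suff : (t - s) * (relax p Z1 - b0 - c) + (w t p - w s p) <= z t p - z s p by nra.
  apply: h => r rst; have := bb _ rst; rewrite ler_norml => /andP[b1 b2].
  have : relax p Z1 <= relax p (z r p).
    apply: relax_anti; first exact: zp.
    by have [//|/negP] := nZ r; rewrite -ltNge => /ltW.
  lra.
- have [[r rst Zr]|/forall2NP nZ] := pselect (exists2 r, s <= r <= t & z r p <= Z1).
    by have := osc _ rst; rewrite ler_norml => /andP[]; lra.
  have := zub p s t (relax p Z1 - b0 + c) s0 st tT; rewrite mulrC => h.
  suff : z t p - z s p <= (t - s) * (relax p Z1 - b0 + c) + (w t p - w s p) by nra.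
  apply: h => r rst; have := bb _ rst; rewrite ler_norml => /andP[b1 b2].
  have : relax p (z r p) <= relax p Z1.
    apply: relax_anti; first exact: Z1pos.
    by have [//|/negP] := nZ r; rewrite -ltNge => /ltW.
  lra.
Qed.

(** Discrete Gronwall: the right-hand side [c] obeys [c' = c + A * dt * (c + D)], where [D] accounts
    for the field being frozen during a step. It starts at [e] rather than [0], because a step in
    which the path meets the scheme resets the error to an oscillation, which [c] must always
    dominate. *)
Lemma error_propagation T dt w z Z (N : nat) A D e : driven T w z ->
  scheme_path dt w Z -> 0 < dt -> N%:R * dt <= T -> z 0 =1 Z 0%N ->
  0 <= A -> 0 <= D -> 0 <= e ->
  (forall k r p, (k < N)%N -> k%:R * dt <= r <= k.+1%:R * dt ->
    `|z (k.+1%:R * dt) p - z r p| <= e) ->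
  (forall k c r p, (k < N)%N -> 0 <= c ->
    (forall q, `|z (k%:R * dt) q - Z k q| <= c) ->
    k%:R * dt <= r <= k.+1%:R * dt ->
    `|b p (z r) - b p (Z k)| <= A * (c + D)) ->
  forall k p, (k <= N)%N ->
    `|z (k%:R * dt) p - Z k p| <= (1 + A * dt) ^+ k * (e + D) - D.
Proof.
move=> dz sZ dt0 NT zZ A0 D0 e0 osc bb; elim=> [p _|k IH p kN].
  by rewrite mul0r zZ subrr normr0 expr0 mul1r addrK.
have kN' := ltnW kN.
set c := (1 + A * dt) ^+ k * (e + D) - D.
have Adt : 0 <= A * dt by rewrite mulr_ge0// ltW.
have c_ge : e <= c.
  have : 1 <= (1 + A * dt) ^+ k by apply: exprn_ege1; lra.
  by rewrite /c; nra.
have dtE : k.+1%:R * dt - k%:R * dt = dt by rewrite -natr1; ring.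
apply: (@step_error T w z p (k%:R * dt) (k.+1%:R * dt) (Z k p) _ (b p (Z k))
          (A * (c + D)) e) => //.
- by rewrite mulr_ge0// ltW.
- by rewrite ler_wpM2r ?ler_nat// ltW.
- by apply: le_trans NT; rewrite ler_wpM2r ?ler_nat// ltW.
- exact: scheme_path_pos sZ _ _.
- by rewrite dtE; exact: scheme_path_eq sZ _ _.
- by move=> r; exact: osc.
- by move=> r; apply: bb => //; [exact: le_trans c_ge|move=> q; exact: IH].
- have -> : (1 + A * dt) ^+ k.+1 * (e + D) - D = c + A * dt * (c + D).
    by rewrite /c exprS; ring.
  have : 0 <= A * dt * (c + D) by rewrite mulr_ge0//; lra.
  lra.
- rewrite dtE exprS; have := IH p kN'; rewrite -/c.
  have -> : (1 + A * dt) * (1 + A * dt) ^+ k * (e + D) - D = c + dt * (A * (c + D)).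
    by rewrite /c; ring.
  lra.
Qed.

(** From below the singular term only helps, being nonnegative. From above, if the path ends over
    the level [Num.sqrt h], the estimate is restarted at its last passage through that level; since
    the path is positive where [a p > 0], forgetting what precedes costs at most [Num.sqrt h]. *)
Lemma path_oscillation T w z p s t h c o : driven T w z ->
  (forall q, continuous (z ^~ q)) ->
  0 <= s -> s <= t -> t <= T -> 0 < h -> t - s <= h ->
  (forall r, s <= r <= t -> `|lam * z r p + b p (z r)| <= c) ->
  (forall r, s <= r <= t -> `|w r p - w s p| <= o) ->
  forall r, s <= r <= t ->
    `|z t p - z r p| <= Num.sqrt h * (1 + a p) + c * h + 2 * o.
Proof.
move=> [zpos zub zlb] cz s0 st tT h0 tsh lin wo r /andP[sr rt].
have rT : 0 <= r by lra.
have c0 : 0 <= c by apply: le_trans (lin s _); rewrite ?normr_ge0// lexx.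
have sq0 : 0 < Num.sqrt h by rewrite sqrtr_gt0.
have asq : 0 <= Num.sqrt h * a p by rewrite mulr_ge0// ltW.
have wtr x : s <= x <= t -> `|w t p - w x p| <= 2 * o.
  move=> sxt; have := wo t; have := wo x sxt; rewrite lexx st => h1 /(_ isT) h2.
  by have := ler_distD (w s p) (w t p) (w x p); rewrite (distrC (w s p)); lra.
have wr : `|w t p - w r p| <= 2 * o by apply: wtr; rewrite sr.
have cht x : s <= x <= t -> c * (t - x) <= c * h.
  by move=> /andP[sx _]; rewrite ler_wpM2l//; lra.
rewrite ler_norml; apply/andP; split.
  have := zlb p r t (- c) rT rt tT => hl.
  have : - c * (t - r) + (w t p - w r p) <= z t p - z r p.
    apply: hl => x /andP[rx xt]; have xst : s <= x <= t by rewrite xt (le_trans sr rx).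
    have : 0 <= a p / z x p.
      have := a_ge0 p; rewrite le_eqVlt => /orP[/eqP <-|a0]; first by rewrite mul0r.
      by rewrite divr_ge0// ltW// zpos//; apply/andP; split; lra.
    by have := lin _ xst; rewrite ler_norml /relax => /andP[]; lra.
  have := cht r; rewrite sr rt => /(_ isT).
  move: wr; rewrite ler_norml => /andP[]; lra.
have drift x y : s <= x -> x <= t -> (0 < a p -> forall y, x <= y <= t -> Num.sqrt h <= z y p) ->
    y = x -> z t p - z y p <= Num.sqrt h * a p + c * h + 2 * o.
  move=> sx xt big ->; have := zub p x t (a p / Num.sqrt h + c) (le_trans s0 sx) xt tT => hu.
  have : z t p - z x p <= (a p / Num.sqrt h + c) * (t - x) + (w t p - w x p).
    apply: hu => u /andP[xu ut]; have ust : s <= u <= t by rewrite ut (le_trans sx xu).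
    have : a p / z u p <= a p / Num.sqrt h.
      have := a_ge0 p; rewrite le_eqVlt => /orP[/eqP <-|a0]; first by rewrite !mul0r.
      have zu : Num.sqrt h <= z u p by apply: big => //; rewrite xu.
      by rewrite ler_pM2l// lef_pV2// posrE// (lt_le_trans sq0).
    by have := lin _ ust; rewrite ler_norml /relax => /andP[]; lra.
  have xst : s <= x <= t by rewrite sx.
  have := wtr x xst; rewrite ler_norml => /andP[_ w2].
  have := cht x xst.
  (* The level [Num.sqrt h] balances the two costs: a drift [a p / Num.sqrt h] during a time [h]
     again contributes a multiple of [Num.sqrt h]. *)
  have : a p / Num.sqrt h * (t - x) <= Num.sqrt h * a p.
    have -> : Num.sqrt h * a p = a p / Num.sqrt h * h.
      by rewrite -{3}(sqr_sqrtr (ltW h0)) expr2 mulrA divfK ?gt_eqF// mulrC.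
    by apply: ler_wpM2l; [rewrite divr_ge0// ltW|lra].
  nra.
have [ap|ap] := eqVneq (a p) 0.
  have := drift r r sr rt _ erefl; rewrite ap ltxx => /(_ (fun f => False_ind _ (notF f))).
  lra.
have a0 : 0 < a p by rewrite lt_neqAle eq_sym ap a_ge0.
have zr0 : 0 < z r p by apply: zpos => //; apply/andP; split; lra.
have [zt|zt] := leP (z t p) (Num.sqrt h).
  have : 0 <= c * h by rewrite mulr_ge0// ltW.
  have : 0 <= 2 * o by apply: le_trans wr; rewrite normr_ge0.
  lra.
have [[x rxt zx]|/forall2NP nZ] := pselect (exists2 x, r <= x <= t & z x p <= Num.sqrt h).
  case/andP: rxt => rx xt.
  have [y [/andP[xy yt] zy ybig]] := last_exit (cz p) xt zx zt.
  have := drift y y _ yt (fun _ => ybig) erefl.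
  have -> : s <= y by lra.
  by move=> /(_ isT); rewrite zy; lra.
have := drift r r sr rt _ erefl.
suff H : 0 < a p -> forall y, r <= y <= t -> Num.sqrt h <= z y p by move=> /(_ H); lra.
by move=> _ y ryt; have [//|/negP] := nZ y; rewrite -ltNge => /ltW.
Qed.

End pathwise.

(** * A priori bounds *)

Section energy.
Context {R : realType} {I : finType}.
Variables (lam : R) (a : I -> R) (b : I -> (I -> R) -> R) (B K : R).
Hypotheses (lam_gt0 : 0 < lam) (a_ge0 : forall p, 0 <= a p) (B_gt0 : 0 < B)
  (b_dissipative : forall x, - K <= \sum_p x p * b p x)
  (b_growth : forall x, \sum_p b p x ^+ 2 <= B * \sum_p x p ^+ 2).

(* One-coordinate energy balance for [Y = Z - S], where [S = w + M >= 0] has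
   the same increments as the noise: the implicit terms are dissipative. *)
Lemma step_energy p dt eta M Z0 Z1 S0 S1 b0 :
  0 < dt -> 0 < eta -> dt <= eta -> (0 < a p -> 0 < Z1) ->
  0 <= S0 <= 2 * M -> 0 <= S1 <= 2 * M ->
  (Z1 - S1) - (Z0 - S0) = dt * (relax lam a p Z1 - b0) ->
  (1 + lam * dt) * (Z1 - S1) ^+ 2 <= (Z0 - S0) ^+ 2 - 2 * dt * (Z0 * b0)
    + 2 * dt * eta * b0 ^+ 2 + dt * (2 * a p + 4 * lam * M ^+ 2 + 4 * M ^+ 2 / eta).
Proof.
move=> dt0 eta0 dte Z1pos /andP[S00 S0M] /andP[S10 S1M] YE.
set Y1 := Z1 - S1 in YE *; set Y0 := Z0 - S0 in YE *.
have M0 : 0 <= M by lra.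
have SM S : 0 <= S -> S <= 2 * M -> S ^+ 2 <= 4 * M ^+ 2 by move=> *; nra.
have i1 : Y1 * relax lam a p Z1 <= a p - lam / 2 * Y1 ^+ 2 + 2 * lam * M ^+ 2.
  (* As [S1 >= 0], the singular term tested against [Z1 - S1] is [a p - S1 * (a p / Z1)], and the
     second part has a good sign. *)
  have : a p / Z1 * Y1 <= a p.
    have := a_ge0 p; rewrite le_eqVlt => /orP[/eqP <-|a0]; first by rewrite !mul0r.
    have Zp := Z1pos a0; rewrite /Y1 mulrBr divfK ?gt_eqF// gerBl.
    by rewrite mulr_ge0// divr_ge0// ltW.
  have := SM _ S10 S1M.
  have -> : relax lam a p Z1 = a p / Z1 - lam * (Y1 + S1) by rewrite /relax /Y1 subrK.
  move=> s1 s2.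
  have s3 : lam * S1 ^+ 2 <= lam * (4 * M ^+ 2) by apply: ler_wpM2l => //; exact: ltW.
  have s4 : 0 <= lam * (Y1 + S1) ^+ 2 by rewrite mulr_ge0 ?sqr_ge0// ltW.
  lra.
(* Young's inequality with weight [eta], left free here so that the square of the field can later be
   absorbed by the damping. *)
have i2 : 2 * (S0 * b0) <= 4 * M ^+ 2 / eta + eta * b0 ^+ 2.
  have := SM _ S00 S0M => s1.
  have : S0 ^+ 2 / eta <= 4 * M ^+ 2 / eta by rewrite ler_pM2r ?invr_gt0.
  suff : 2 * (S0 * b0) <= S0 ^+ 2 / eta + eta * b0 ^+ 2 by lra.
  have : 0 <= (S0 - eta * b0) ^+ 2 / eta by rewrite divr_ge0 ?sqr_ge0// ltW.
  have -> : (S0 - eta * b0) ^+ 2 / eta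
    = S0 ^+ 2 / eta + eta * b0 ^+ 2 - 2 * (S0 * b0) by field; rewrite gt_eqF.
  lra.
have Y1E : Y1 = (Y0 - dt * b0) + dt * relax lam a p Z1 by lra.
(* Implicit Euler dissipates: [Y1^2 - A^2 <= 2 Y1 (Y1 - A)] by convexity, and [Y1 - A] is the
   implicit increment. *)
have : Y1 ^+ 2 <= (Y0 - dt * b0) ^+ 2 + 2 * dt * (Y1 * relax lam a p Z1).
  set A := Y0 - dt * b0 in Y1E *.
  have -> : 2 * dt * (Y1 * relax lam a p Z1) = 2 * Y1 * (Y1 - A) by rewrite Y1E; ring.
  by have := sqr_ge0 (Y1 - A); rewrite sqrrB; lra.
have i3 : dt * (dt * b0 ^+ 2) <= dt * (eta * b0 ^+ 2).
  by apply: ler_wpM2l; [exact: ltW|apply: ler_wpM2r => //; exact: sqr_ge0].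
have i1' := ler_wpM2l (ltW dt0) i1.
have i2' := ler_wpM2l (ltW dt0) i2.
have -> : (Y0 - dt * b0) ^+ 2 = Y0 ^+ 2 - 2 * dt * (Z0 * b0)
  + dt * (2 * (S0 * b0)) + dt * (dt * b0 ^+ 2) by rewrite /Y0; ring.
lra.
Qed.

(** With [eta = lam / (8 B)] the explicit field costs at most half of the implicit damping: one step
    gives [(1 + lam dt) Y1 <= (1 + lam dt / 2) Y0 + dt E]. Any level above [2 E / lam] is then
    preserved, so the bound does not deteriorate with the number of steps. *)
Lemma scheme_bound : exists C, 1 <= C /\ forall dt w Z M N,
  0 < dt -> dt <= lam / (8 * B) -> scheme_path lam a b dt w Z ->
  (forall k p, (k <= N)%N -> `|w (k%:R * dt) p| <= M) ->
  forall k, (k <= N)%N -> \sum_p Z k p ^+ 2 <= C * (1 + \sum_p Z 0%N p ^+ 2 + M ^+ 2).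
Proof.
have n0 : 0 <= #|I|%:R :> R by [].
have A0 : 0 <= \sum_p a p by apply: sumr_ge0.
set n := #|I|%:R in n0; set A := \sum_p a p in A0.
set eta := lam / (8 * B).
have eta0 : 0 < eta by rewrite divr_gt0// mulr_gt0.
have K0 : 0 <= K.
  have := b_dissipative (fun=> 0); rewrite big1; last by move=> *; rewrite mul0r.
  by rewrite oppr_le0.
set c0 := 2 * K + 2 * A; set c1 := n * (6 * lam + 4 / eta).
have c00 : 0 <= c0 by rewrite /c0; lra.
have c10 : 0 <= c1.
  have l0 : 0 <= 6 * lam by rewrite mulr_ge0// ltW.
  have e0 : 0 <= 4 / eta by rewrite divr_ge0// ltW.
  by rewrite /c1 mulr_ge0// addr_ge0.
pose C := 1 + 4 + 4 * (2 / lam) * (c0 + c1) + 24 * n.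
have lc : 0 <= 2 / lam by rewrite divr_ge0// ltW.
exists C; split.
  by have := mulr_ge0 lc (addr_ge0 c00 c10); rewrite /C; lra.
move=> dt w Z M N dt0 dte sZ wM k kN.
pose S k p := w (k%:R * dt) p + M.
pose E := c0 + c1 * M ^+ 2.
have SM j p : (j <= N)%N -> 0 <= S j p <= 2 * M.
  by move=> jN; have := wM _ p jN; rewrite ler_norml /S => /andP[]; lra.
have sumS j : (j <= N)%N -> \sum_p S j p ^+ 2 <= n * (4 * M ^+ 2).
  move=> jN; rewrite /n -sumr_const mulr_suml.
  rewrite (eq_bigl predT)//; apply: ler_sum => p _; rewrite mul1r.
  by have /andP[] := SM _ p jN; nra.
have E0 : 0 <= E by rewrite /E addr_ge0// mulr_ge0// sqr_ge0.
(* The initial energy is added to the equilibrium level [2 E / lam] of the recursion, so [Q] is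
   above both. *)
pose Q := \sum_p (Z 0%N p - S 0%N p) ^+ 2 + 2 / lam * E.
have YQ : forall j, (j <= N)%N -> \sum_p (Z j p - S j p) ^+ 2 <= Q.
  elim=> [_|j IH jN]; first by rewrite /Q lerDl mulr_ge0.
  have {}IH := IH (ltnW jN).
  set Y0 := \sum_p (Z j p - S j p) ^+ 2 in IH.
  set Y1 := \sum_p _.
  have Y00 : 0 <= Y0 by apply: sumr_ge0 => *; exact: sqr_ge0.
  have sumZ : \sum_p Z j p ^+ 2 <= 2 * Y0 + 2 * (n * (4 * M ^+ 2)).
    apply: le_trans (lerD (lexx _) (ler_wpM2l _ (sumS j (ltnW jN))))=> //.
    rewrite !mulr_sumr -big_split /=; apply: ler_sum => p _.
    by have := sqr_ge0 (Z j p - 2 * S j p); nra.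
  have step : (1 + lam * dt) * Y1 <= Y0 - 2 * dt * (\sum_p Z j p * b p (Z j))
      + 2 * dt * eta * \sum_p b p (Z j) ^+ 2
      + dt * (2 * A + n * (4 * lam * M ^+ 2 + 4 * M ^+ 2 / eta)).
    have -> : 2 * A + n * (4 * lam * M ^+ 2 + 4 * M ^+ 2 / eta) =
        \sum_p (2 * a p + 4 * lam * M ^+ 2 + 4 * M ^+ 2 / eta).
      rewrite (eq_bigr (fun p => 2 * a p + 1 * (4 * lam * M ^+ 2 + 4 * M ^+ 2 / eta))).
        by rewrite big_split /= -mulr_sumr -mulr_suml sumr_const.
      by move=> p _; rewrite mul1r addrA.
    rewrite /Y1 /Y0 !mulr_sumr -sumrB -!big_split /=; apply: ler_sum => p _.
    apply: (@step_energy p dt eta M (Z j p) (Z j.+1 p) (S j p) (S j.+1 p) (b p (Z j))) => //.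
    - exact: scheme_path_pos sZ _ _.
    - exact/SM/ltnW.
    - exact: SM.
    - have := scheme_path_eq sZ p j; rewrite /S; lra.
  have diss := b_dissipative (Z j).
  have grow := le_trans (b_growth (Z j)) (ler_wpM2l (ltW B_gt0) sumZ).
  have etaB : eta * B = lam / 8 by rewrite /eta; field; rewrite gt_eqF.
  have g1 : 2 * dt * eta * (\sum_p b p (Z j) ^+ 2)
      <= dt * (lam / 2 * Y0 + 2 * lam * n * M ^+ 2).
    have : 2 * dt * eta * (\sum_p b p (Z j) ^+ 2)
        <= 2 * dt * eta * (B * (2 * Y0 + 2 * (n * (4 * M ^+ 2)))).
      by apply: ler_wpM2l => //; rewrite mulr_ge0 ?(ltW eta0)// mulr_ge0// ltW.
    have -> : 2 * dt * eta * (B * (2 * Y0 + 2 * (n * (4 * M ^+ 2)))) =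
      2 * dt * (eta * B) * (2 * Y0 + 2 * (n * (4 * M ^+ 2))) by ring.
    by rewrite etaB; lra.
  have g2 : - (2 * dt * (\sum_p Z j p * b p (Z j))) <= dt * (2 * K).
    have := ler_wpM2l (ltW dt0) diss; lra.
  have g3 : (1 + lam * dt) * Y1 <= (1 + lam * dt / 2) * Y0 + dt * E.
    have -> : dt * E = dt * (2 * K) + dt * (2 * lam * n * M ^+ 2)
       + dt * (2 * A + n * (4 * lam * M ^+ 2 + 4 * M ^+ 2 / eta)).
      by rewrite /E /c0 /c1; ring.
    lra.
  have g4 : E <= lam / 2 * Q.
    rewrite /Q mulrDr; have -> : lam / 2 * (2 / lam * E) = E by field; rewrite gt_eqF.
    by rewrite lerDr mulr_ge0 ?divr_ge0 ?(ltW lam_gt0)// sumr_ge0// => *; exact: sqr_ge0.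
  have dl : 0 < lam * dt by rewrite mulr_gt0.
  have g5 : (1 + lam * dt) * Y1 <= (1 + lam * dt) * Q.
    apply: le_trans g3 _.
    have : (1 + lam * dt / 2) * Y0 <= (1 + lam * dt / 2) * Q by apply: ler_wpM2l => //; lra.
    have := ler_wpM2l (ltW dt0) g4; lra.
  by move: g5; rewrite ler_pM2l//; lra.
have M2 : 0 <= M ^+ 2 by exact: sqr_ge0.
have Z00 : 0 <= \sum_p Z 0%N p ^+ 2 by apply: sumr_ge0 => *; exact: sqr_ge0.
have Q1 : Q <= 2 * \sum_p Z 0%N p ^+ 2 + 8 * n * M ^+ 2 + 2 / lam * E.
  rewrite /Q lerD2r; have -> : 8 * n * M ^+ 2 = 2 * (n * (4 * M ^+ 2)) by ring.
  apply: le_trans (lerD (lexx _) (ler_wpM2l _ (sumS 0%N _))) => //.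
  rewrite !mulr_sumr -big_split /=; apply: ler_sum => p _.
  by have := sqr_ge0 (Z 0%N p + S 0%N p); rewrite sqrrD sqrrB; lra.
have Q2 : \sum_p Z k p ^+ 2 <= 2 * Q + 2 * (n * (4 * M ^+ 2)).
  have := YQ k kN; have := sumS k kN.
  have : \sum_p Z k p ^+ 2 <= 2 * (\sum_p (Z k p - S k p) ^+ 2) + 2 * \sum_p S k p ^+ 2.
    rewrite !mulr_sumr -big_split /=; apply: ler_sum => p _.
    by have := sqr_ge0 (Z k p - 2 * S k p); nra.
  lra.
apply: le_trans Q2 _.
set q := 2 / lam in lc Q1; set z0 := \sum_p Z 0%N p ^+ 2 in Z00 Q1 *.
have h1 : 0 <= q * (c0 * z0 + c1 * z0 + c0 * M ^+ 2 + c1) by rewrite mulr_ge0// !addr_ge0// mulr_ge0.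
have h2 : 0 <= n * z0 by rewrite mulr_ge0.
have h3 : 0 <= n * M ^+ 2 by rewrite mulr_ge0.
have h4 : 0 <= q * c0 by rewrite mulr_ge0.
have h5 : 0 <= q * (c1 * M ^+ 2) by rewrite mulr_ge0// mulr_ge0.
by move: Q1; rewrite /C /E -/q; nra.
Qed.

End energy.

(** * Error along one realisation of the noise *)

Section path_error.
Context {R : realType} {I : finType}.
Variables (lam : R) (a : I -> R) (b : I -> (I -> R) -> R) (B K L : R).
Hypotheses (lam_gt0 : 0 < lam) (a_ge0 : forall p, 0 <= a p) (B_gt0 : 0 < B)
  (L_gt0 : 0 < L)
  (b_dissipative : forall x, - K <= \sum_p x p * b p x)
  (b_growth : forall x, \sum_p b p x ^+ 2 <= B * \sum_p x p ^+ 2)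
  (b_linear : forall p x c, (forall q, `|x q| <= c) -> `|b p x| <= B * c)
  (b_locally_lipschitz : forall p x y c e, 1 <= c -> 0 <= e ->
    (forall q, `|x q| <= c) -> (forall q, `|x q - y q| <= e) ->
    `|b p x - b p y| <= L * c ^+ 2 * e).

Lemma exp_geometric (A dt T : R) k : 0 <= A -> 0 <= dt -> k%:R * dt <= T ->
  (1 + A * dt) ^+ k <= expR (A * T).
Proof.
move=> A0 dt0 kT; apply: (@le_trans _ _ (expR (A * dt) ^+ k)).
  by apply: lerXn2r; rewrite ?nnegrE ?expR_ge0 ?expR_ge1Dx// addr_ge0// mulr_ge0.
rewrite -expRM_natl ler_expR; have := ler_wpM2l A0 kT; lra.
Qed.

Lemma local_error_propagation T dt w z Z c e : driven lam a b T w z ->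
  scheme_path lam a b dt w Z -> 0 < dt -> z 0 =1 Z 0%N -> 1 <= c -> 0 <= e ->
  (forall t p, 0 <= t <= T -> `|z t p| <= c) ->
  (forall k r p, k.+1%:R * dt <= T -> k%:R * dt <= r <= k.+1%:R * dt ->
    `|z (k.+1%:R * dt) p - z r p| <= e) ->
  forall k p, k%:R * dt <= T ->
    `|z (k%:R * dt) p - Z k p| <= 3 * e * expR (L * c ^+ 2 * T) /\
    `|z (k%:R * dt) p - Z k p| <= (2 * c + e) * expR (B * T).
Proof.
move=> dz sZ dt0 zZ c1 e0 zc osc k p kT.
have jT j : (j < k)%N -> j.+1%:R * dt <= T.
  by move=> jk; apply: le_trans kT; rewrite ler_wpM2r ?ler_nat// ltW.
have rT j r : (j < k)%N -> j%:R * dt <= r <= j.+1%:R * dt -> 0 <= r <= T.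
  move=> jk /andP[jr rj]; rewrite (le_trans rj (jT _ jk)) andbT.
  by apply: le_trans jr; rewrite mulr_ge0// ltW.
have ends j : j%:R * dt <= j%:R * dt <= j.+1%:R * dt.
  by rewrite lexx ler_wpM2r ?ler_nat// ltW.
have c0 : 0 <= c by lra.
have Lc : 0 <= L * c ^+ 2 by rewrite mulr_ge0 ?sqr_ge0// ltW.
split.
  have := @error_propagation _ _ lam a b lam_gt0 a_ge0 T dt w z Z k (L * c ^+ 2) (2 * e) e dz sZ
    dt0 kT zZ Lc (mulr_ge0 (ler0n _ 2) e0) e0.
  move=> /(_ (fun j r q jk => osc j r q (jT _ jk))) H.
  have {}H := H _ k p (leqnn k).
  have := @exp_geometric (L * c ^+ 2) dt T k Lc (ltW dt0) kT.
  move=> /(ler_wpM2r (mulr_ge0 (ler0n _ 3) e0)) G.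
  suff H1 : `|z (k%:R * dt) p - Z k p|
      <= (1 + L * c ^+ 2 * dt) ^+ k * (e + 2 * e) - 2 * e by lra.
  apply: H => j c' r q jk c'0 hz rj.
  apply: b_locally_lipschitz => //; first by lra.
    by move=> q'; apply: zc; exact: rT rj.
  move=> q'; have := ler_distD (z (j%:R * dt) q') (z r q') (Z j q').
  have := ler_distD (z (j.+1%:R * dt) q') (z r q') (z (j%:R * dt) q').
  have := osc j _ q' (jT _ jk) rj; have := osc j _ q' (jT _ jk) (ends j).
  by rewrite (distrC _ (z r q')) ; have := hz q'; lra.
have c20 : 0 <= 2 * c by lra.
have := @error_propagation _ _ lam a b lam_gt0 a_ge0 T dt w z Z k B (2 * c) e dz sZ
  dt0 kT zZ (ltW B_gt0) c20 e0.
move=> /(_ (fun j r q jk => osc j r q (jT _ jk))) H.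
have {}H := H _ k p (leqnn k).
have := @exp_geometric B dt T k (ltW B_gt0) (ltW dt0) kT.
move=> /(ler_wpM2r (addr_ge0 c20 e0)) G.
suff H1 : `|z (k%:R * dt) p - Z k p| <= (1 + B * dt) ^+ k * (e + 2 * c) - 2 * c by lra.
apply: H => j c' r q jk c'0 hz rj.
have b1 : `|b q (z r)| <= B * c by apply: b_linear => q'; apply: zc; exact: rT rj.
have b2 : `|b q (Z j)| <= B * (c + c').
  apply: b_linear => q'.
  have := zc _ q' (rT j _ jk (ends j)); have := hz q'; have := ler_distD (z (j%:R * dt) q') (Z j q') 0.
  by rewrite !subr0 distrC; lra.
by apply: le_trans (ler_normB _ _) _; lra.
Qed.

(** A single step, fine enough for the given path, suffices: once the scheme is within distance [1]
    of the path, its energy bound carries over up to a factor. The crude bound [c] and the modulus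
    of continuity only select this step and do not enter [C]. *)
Lemma driven_bound : exists C, 1 <= C /\ forall T w z M Z, 0 < T -> driven lam a b T w z ->
  (forall q, continuous (z ^~ q)) ->
  (forall t p, 0 <= t <= T -> `|w t p| <= M) ->
  (forall n : nat, scheme_path lam a b (T / n.+1%:R) w (Z n)) ->
  (forall n, z 0 =1 Z n 0%N) ->
  forall t p, 0 <= t <= T -> z t p ^+ 2 <= C * (1 + \sum_p z 0 p ^+ 2 + M ^+ 2).
Proof.
have [C [C1 HC]] := scheme_bound lam_gt0 a_ge0 B_gt0 b_dissipative b_growth.
exists (2 + 2 * C); split; first lra.
move=> T w z M Z T0 dz cz wM sZ zZ.
have [c [c1 zc]] : exists c, 1 <= c /\ forall t p, 0 <= t <= T -> `|z t p| <= c.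
  have H p : exists c, 0 <= c /\ forall t, 0 <= t <= T -> `|z t p| <= c.
    have cn : {within `[0, T]%classic, continuous (fun t => `|z t p|)}.
      apply: continuous_subspaceT => t; apply: cvg_norm; exact: cz.
    have [t _ Ht] := EVT_max (ltW T0) cn.
    by exists `|z t p|; split => // s sT; apply: Ht; rewrite in_itv.
  have [c Hc] := choice H.
  exists (1 + \sum_p c p); split.
    by rewrite lerDl sumr_ge0// => p _; case: (Hc p).
  move=> t p tT; rewrite (bigD1 p)//=; have [_ /(_ _ tT)] := Hc p.
  have : 0 <= \sum_(i | i != p) c i by apply: sumr_ge0 => q _; case: (Hc q).
  lra.
pose A := L * c ^+ 2.
(* Then the error at grid times is at most [3 * e * expR (A * T) = 3 / 4], and the motion inside a
   cell adds at most [e <= 1 / 4]. *)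
pose e := expR (- (A * T)) / 4.
have e0 : 0 < e by rewrite divr_gt0// expR_gt0.
have A0 : 0 <= A by rewrite mulr_ge0 ?sqr_ge0// ltW.
have [n1 Hn1] := uniform_continuity_segment T0 e0 cz.
pose eta := lam / (8 * B).
have eta0 : 0 < eta by rewrite divr_gt0// mulr_gt0.
pose n := maxn n1 (Num.truncn (T / eta)).
pose dt := T / n.+1%:R.
have dt0 : 0 < dt by rewrite divr_gt0.
have dte : dt <= eta.
  rewrite ler_pdivrMr// mulrC -ler_pdivrMr//.
  have := truncnS_gt (T / eta) => /ltW /le_trans; apply.
  by rewrite ler_nat ltnS leq_maxr.
have dtn1 : dt <= T / n1.+1%:R by rewrite ler_pM2l// lef_pV2 ?posrE// ler_nat ltnS leq_maxl.
have NT : n.+1%:R * dt = T by rewrite /dt mulrC divfK// pnatr_eq0.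
have osc s t p : 0 <= s <= T -> `|s - t| <= dt -> `|z s p - z t p| <= e.
  by move=> sT st; apply: (Hn1 s t p) => //; exact: le_trans st dtn1.
move=> t p tT; pose k := Num.truncn (t / dt).
have td0 : 0 <= t / dt by case/andP: tT => t0 _; rewrite divr_ge0// ltW.
have kt : k%:R * dt <= t by rewrite -ler_pdivlMr// truncn_le.
have tk : t < k.+1%:R * dt by rewrite -ltr_pdivrMr// truncnS_gt.
have kT : k%:R * dt <= T by case/andP: tT => _; exact: le_trans.
have kN : (k <= n.+1)%N.
  by rewrite -(ler_nat R) -(ler_pM2r dt0) NT.
have [err _] := @local_error_propagation T dt w z (Z n) c e dz (sZ n) dt0 (zZ n) c1 (ltW e0) zc
  (fun j r q jT rj => ltac:(
    case/andP: rj => r1 r2; apply: osc;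
    [by rewrite jT andbT mulr_ge0// ltW
    |rewrite ger0_norm ?subr_ge0// ; move: r1 r2; rewrite -natr1; lra])) k p kT.
have : 3 * e * expR (L * c ^+ 2 * T) <= 3 / 4.
  have : expR (- (A * T)) * expR (A * T) = 1 by rewrite -expRD addNr expR0.
  rewrite /e -/A; lra.
have bnd : \sum_p Z n k p ^+ 2 <= C * (1 + \sum_p z 0 p ^+ 2 + M ^+ 2).
  have -> : \sum_p z 0 p ^+ 2 = \sum_p Z n 0%N p ^+ 2.
    by apply: eq_bigr => q _; rewrite (zZ n).
  apply: (HC dt w (Z n) M n.+1) => //; first exact: sZ.
  move=> j q jN; apply: wM; by rewrite mulr_ge0 ?(ltW dt0)//= -NT ler_wpM2r ?ler_nat// ltW.
have Zp : Z n k p ^+ 2 <= \sum_p Z n k p ^+ 2.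
  by rewrite (bigD1 p)//= lerDl sumr_ge0// => *; exact: sqr_ge0.
have : `|z t p - z (k%:R * dt) p| <= e.
  apply: osc => //; rewrite ger0_norm ?subr_ge0//; move: tk; rewrite -natr1; lra.
have : e <= 1 / 4.
  by rewrite /e ler_pM2r ?invr_gt0// -expR0 ler_expR oppr_le0 mulr_ge0// ltW.
move=> e4 h1 h2; have h3 : `|z t p - Z n k p| <= 1.
  by have := ler_distD (z (k%:R * dt) p) (z t p) (Z n k p); lra.
have : z t p ^+ 2 <= 2 + 2 * Z n k p ^+ 2.
  have : (z t p - Z n k p) ^+ 2 <= 1 by rewrite -real_normK ?num_real// exprn_ile1.
  by have := sqr_ge0 (z t p - 2 * Z n k p); nra.
have : 0 <= \sum_p z 0 p ^+ 2 + M ^+ 2.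
  by rewrite addr_ge0 ?sqr_ge0// sumr_ge0// => *; exact: sqr_ge0.
nra.
Qed.

Lemma pathwise_error : exists C, 1 <= C /\ forall T dt w z Z c o,
  driven lam a b T w z -> (forall q, continuous (z ^~ q)) ->
  scheme_path lam a b dt w Z -> 0 < dt -> z 0 =1 Z 0%N -> 1 <= c -> 0 <= o ->
  (forall t p, 0 <= t <= T -> `|z t p| <= c) ->
  (forall k r p, k.+1%:R * dt <= T -> k%:R * dt <= r <= k.+1%:R * dt ->
    `|w r p - w (k%:R * dt) p| <= o) ->
  forall k p, k%:R * dt <= T ->
    `|z (k%:R * dt) p - Z k p|
      <= C * (Num.sqrt dt + o + dt * c) * expR (C * c ^+ 2 * T) /\
    `|z (k%:R * dt) p - Z k p|
      <= C * (c + (Num.sqrt dt + o + dt * c)) * expR (C * T).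
Proof.
pose abar := \sum_p a p.
have a0 : 0 <= abar by apply: sumr_ge0.
have aa p : a p <= abar by rewrite /abar (bigD1 p)//= lerDl sumr_ge0.
pose C0 := 1 + abar + (lam + B) + 2.
pose C := 3 * C0 + L + B.
have C01 : 3 <= C0 by rewrite /C0; have := lam_gt0; have := B_gt0; lra.
exists C; split; first by rewrite /C; have := L_gt0; have := B_gt0; lra.
move=> T dt w z Z c o dz cz sZ dt0 zZ c1 o0 zc wo k p kT.
set E := Num.sqrt dt + o + dt * c.
have sq0 : 0 <= Num.sqrt dt by exact: sqrtr_ge0.
have dc0 : 0 <= dt * c by rewrite mulr_ge0 ?(ltW dt0)//; lra.
have E0 : 0 <= E by rewrite /E !addr_ge0.
pose e := C0 * E.
have e0 : 0 <= e by rewrite mulr_ge0//; lra.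
have osc j r q : j.+1%:R * dt <= T -> j%:R * dt <= r <= j.+1%:R * dt ->
    `|z (j.+1%:R * dt) q - z r q| <= e.
  move=> jT rj.
  have jj : j.+1%:R * dt - j%:R * dt <= dt by rewrite -natr1; lra.
  have j0 : 0 <= j%:R * dt by rewrite mulr_ge0// ltW.
  have js : j%:R * dt <= j.+1%:R * dt by rewrite ler_wpM2r ?ler_nat// ltW.
  have := @path_oscillation _ _ lam a b a_ge0 T w z q (j%:R * dt) (j.+1%:R * dt) dt
    ((lam + B) * c) o dz cz j0 js jT dt0 jj _ (fun r => wo j r q jT) r rj.
  have lin : forall r, j%:R * dt <= r <= j.+1%:R * dt -> `|lam * z r q + b q (z r)| <= (lam + B) * c.
    move=> x /andP[x1 x2]; have xT : 0 <= x <= T by rewrite (le_trans j0 x1) (le_trans x2 jT).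
    apply: le_trans (ler_normD _ _) _; rewrite normrM gtr0_norm// mulrDl lerD//.
      by rewrite ler_pM2l//; exact: zc.
    by apply: b_linear => q'; exact: zc.
  move=> /(_ lin) /le_trans; apply.
  have h1 : Num.sqrt dt * a q <= Num.sqrt dt * abar by apply: ler_wpM2l.
  have h2 : 0 <= abar * o by rewrite mulr_ge0.
  have h3 : 0 <= abar * (dt * c) by rewrite mulr_ge0.
  have h4 : 0 <= (lam + B) * Num.sqrt dt by rewrite mulr_ge0// ltW// addr_gt0.
  have h5 : 0 <= (lam + B) * o by rewrite mulr_ge0// ltW// addr_gt0.
  rewrite /e /C0 /E; nra.
have T0 : 0 <= T by apply: le_trans kT; rewrite mulr_ge0// ltW.
have [e1 e2] := local_error_propagation dz sZ dt0 zZ c1 e0 zc osc p kT.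
have LC : L <= C by rewrite /C; have := B_gt0; lra.
have BC : B <= C by rewrite /C; have := L_gt0; lra.
have CC : 3 * C0 <= C by rewrite /C; have := L_gt0; have := B_gt0; lra.
split.
  apply: le_trans e1 _; apply: ler_pM.
  - by rewrite mulr_ge0.
  - exact: expR_ge0.
  - by rewrite /e mulrA ler_wpM2r.
  - by rewrite ler_expR ler_wpM2r// ler_wpM2r// sqr_ge0.
apply: le_trans e2 _; apply: ler_pM; rewrite ?expR_ge0//.
- by rewrite addr_ge0//; lra.
- by rewrite /e; nra.
- by rewrite ler_expR ler_wpM2r.
Qed.

Lemma sqrt_mul_le (c x : R) : 1 <= c -> 0 <= x -> Num.sqrt (c * x) <= c * Num.sqrt x.
Proof.
move=> c1 x0; have c0 : 0 <= c by apply: le_trans c1.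
rewrite sqrtrM// ler_wpM2r ?sqrtr_ge0//.
by rewrite -[leRHS]ger0_norm// -sqrtr_sqr ler_wsqrtr// expr2 ler_peMr.
Qed.

(** One estimate for each regime of the final argument: an a priori bound without exponential
    factor, for atypically large paths; a small one whose factor is exponential in [s], for the
    others; and one with a deterministic factor, for steps larger than [dt0]. *)
Lemma path_error : exists C dt0, [/\ 1 <= C, 0 < dt0, dt0 <= 1 &
  forall T dt w z Z Zn M s,
  0 < T -> 0 < dt -> driven lam a b T w z -> (forall q, continuous (z ^~ q)) ->
  (forall t p, 0 <= t <= T -> `|w t p| <= M) ->
  scheme_path lam a b dt w Z -> z 0 =1 Z 0%N ->
  (forall n : nat, scheme_path lam a b (T / n.+1%:R) w (Zn n)) ->
  (forall n, z 0 =1 Zn n 0%N) ->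
  1 + \sum_p z 0 p ^+ 2 + M ^+ 2 <= s ->
  (dt <= dt0 -> forall k p, k%:R * dt <= T ->
    `|z (k%:R * dt) p - Z k p| <= C * Num.sqrt s) /\
  (forall o, 0 <= o ->
    (forall k r p, k.+1%:R * dt <= T -> k%:R * dt <= r <= k.+1%:R * dt ->
      `|w r p - w (k%:R * dt) p| <= o) ->
    forall k p, k%:R * dt <= T ->
      `|z (k%:R * dt) p - Z k p|
        <= C * (Num.sqrt dt + o + dt * Num.sqrt s) * expR (C * s * T) /\
      `|z (k%:R * dt) p - Z k p|
        <= C * (Num.sqrt s + (Num.sqrt dt + o + dt * Num.sqrt s)) * expR (C * T))].
Proof.
have [C1 [C11 scheme_le]] := scheme_bound lam_gt0 a_ge0 B_gt0 b_dissipative b_growth.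
have [C2 [C21 exact_le]] := driven_bound.
have [C3 [C31 err_le]] := pathwise_error.
pose D := C1 + C2; have D1 : 1 <= D by rewrite /D; lra.
have CD : 1 <= C3 * D by nra.
(* The second entry of the minimum is the stability threshold of the energy estimate; the cap [1]
   allows comparing [dt] and [Num.sqrt dt] with powers of [dt] of exponent below [1 / 2]. *)
exists (2 * D + C3 * D), (Num.min 1 (lam / (8 * B))); split.
- by lra.
- by rewrite lt_min ltr01 divr_gt0// mulr_gt0.
- by rewrite ge_min lexx.
move=> T dt w z Z Zn M s T0 dt0 dz cz wM sZ zZ sZn zZn Hs.
have zs0 : 0 <= \sum_p z 0 p ^+ 2 by apply: sumr_ge0 => p _; exact: sqr_ge0.
have s1 : 1 <= s by apply: le_trans Hs; rewrite -addrA lerDl addr_ge0 ?sqr_ge0.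
have s0 : 0 <= s := le_trans ler01 s1.
have D0 : 0 <= D := le_trans ler01 D1.
have C30 : 0 <= C3 := le_trans ler01 C31.
pose c := Num.sqrt (D * s).
have c2 : c ^+ 2 = D * s by rewrite sqr_sqrtr// mulr_ge0.
have c0 : 0 <= c by exact: sqrtr_ge0.
have c1 : 1 <= c by rewrite -sqrtr1 ler_wsqrtr// -[leLHS]mulr1 ler_pM.
have cs : c <= D * Num.sqrt s by exact: sqrt_mul_le.
have size Ci : 0 <= Ci -> Ci <= D -> Ci * (1 + \sum_p z 0 p ^+ 2 + M ^+ 2) <= c ^+ 2.
  move=> Ci0 CiD; rewrite c2; apply: ler_pM => //.
  by rewrite !addr_ge0 ?sqr_ge0.
have abs_le x : x ^+ 2 <= c ^+ 2 -> `|x| <= c.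
  by move=> xc; rewrite -[leRHS](ger0_norm c0) -!sqrtr_sqr ler_wsqrtr.
have C1D : C1 <= D by rewrite lerDl (le_trans ler01).
have C2D : C2 <= D by rewrite lerDr (le_trans ler01).
have zc t p : 0 <= t <= T -> `|z t p| <= c.
  move=> tT; apply: abs_le; apply: le_trans (exact_le T w z M Zn T0 dz cz wM sZn zZn t p tT) _.
  by apply: size; rewrite ?(le_trans ler01).
have kT0 k : k%:R * dt <= T -> 0 <= k%:R * dt <= T.
  by move=> ->; rewrite mulr_ge0// ltW.
split.
  rewrite le_min => /andP[_ dtB] k p kT.
  have Zc : `|Z k p| <= c.
    apply: abs_le; have wk j q : (j <= k)%N -> `|w (j%:R * dt) q| <= M.
      move=> jk; apply: wM; apply: kT0; apply: le_trans kT.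
      by rewrite ler_wpM2r ?ler_nat// ltW.
    apply: (@le_trans _ _ (\sum_q Z k q ^+ 2)).
      by rewrite (bigD1 p)//= lerDl sumr_ge0// => q _; exact: sqr_ge0.
    apply: le_trans (scheme_le dt w Z M k dt0 dtB sZ wk k (leqnn k)) _.
    have <- : \sum_q z 0 q ^+ 2 = \sum_q Z 0%N q ^+ 2 by apply: eq_bigr => q _; rewrite zZ.
    by apply: size; rewrite ?(le_trans ler01).
  apply: le_trans (ler_normB _ _) _; apply: le_trans (lerD (zc _ p (kT0 k kT)) Zc) _.
  have := mulr_ge0 (le_trans ler01 CD) (sqrtr_ge0 s).
  lra.
move=> o o0 wo k p kT.
have [e1 e2] := err_le T dt w z Z c o dz cz sZ dt0 zZ c1 o0 zc wo k p kT.
set q := Num.sqrt dt in e1 e2 *; set y := Num.sqrt s in cs *.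
have q0 : 0 <= q by exact: sqrtr_ge0.
have y0 : 0 <= y by exact: sqrtr_ge0.
have dy0 : 0 <= dt * y by rewrite mulr_ge0// ltW.
have F : q + o + dt * c <= D * (q + o + dt * y).
  have := ler_wpM2l (ltW dt0) cs; have := ler_peMl q0 D1; have := ler_peMl o0 D1.
  lra.
have Cs : C3 * D <= 2 * D + C3 * D by rewrite lerDr mulr_ge0.
have CC : C3 <= 2 * D + C3 * D by apply: le_trans Cs; rewrite ler_peMr.
have G0 : 0 <= q + o + dt * y by rewrite !addr_ge0.
have T0' := ltW T0.
split.
  apply: le_trans e1 _; apply: ler_pM; rewrite ?expR_ge0//.
  - by rewrite mulr_ge0// !addr_ge0// mulr_ge0// ltW.
  - apply: le_trans (ler_wpM2l C30 F) _; rewrite mulrA; exact: ler_wpM2r.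
  - by rewrite ler_expR c2 mulrA ler_wpM2r// ler_wpM2r.
apply: le_trans e2 _; apply: ler_pM; rewrite ?expR_ge0//.
- by rewrite mulr_ge0// !addr_ge0// mulr_ge0// ltW.
- apply: le_trans (ler_wpM2l C30 (lerD cs F)) _.
  by rewrite -mulrDr mulrA ler_wpM2r// addr_ge0.
- by rewrite ler_expR ler_wpM2r.
Qed.

End path_error.

(** * The drift as a field on pairs *)

Section field.
Context {R : realType} {d : nat}.
Variable G : 'rV[R]_d -> R.

(* A phase point [(u, v)] is handled as the function on [bool * 'I_d] whose
   value at [(false, i)] is [u_i] and at [(true, i)] is [v_i]. *)
Definition pairing (x y : 'rV[R]_d) (p : bool * 'I_d) : R :=
  (if p.1 then y else x) 0 p.2.

Definition cross_field (p : bool * 'I_d) (x : bool * 'I_d -> R) : R :=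
  x (~~ p.1, p.2) * grad G (\row_i (x (false, i) * x (true, i))) 0 p.2.

Lemma cross_field_pairing x y p : cross_field p (pairing x y) =
  odot (if p.1 then x else y) (grad G (odot x y)) 0 p.2.
Proof. by rewrite /cross_field /pairing [RHS]mxE; case: p => -[]. Qed.

Lemma sum_pairs (F : bool * 'I_d -> R) :
  \sum_p F p = \sum_i (F (false, i) + F (true, i)).
Proof.
have -> : \sum_p F p = \sum_c \sum_i F (c, i).
  by rewrite pair_bigA; apply: eq_bigr => -[].
by rewrite big_bool /= addrC -big_split.
Qed.

Lemma abs_row_le_norm n (x : 'rV[R]_n) i : `|x 0 i| <= `|x|.
Proof.
rewrite [leRHS]/Num.norm /= mx_normrE.
exact: (@le_bigmax _ _ _ 0 (fun j : 'I_1 * 'I_n => `|x j.1 j.2|) (0, i)).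
Qed.

Lemma abs_row_le_enorm n (x : 'rV[R]_n) i : `|x 0 i| <= enorm x.
Proof.
rewrite -sqrtr_sqr ler_sqrt ?sumr_ge0// => [|j _]; last exact: sqr_ge0.
by rewrite (bigD1 i)//= lerDl sumr_ge0// => j _; exact: sqr_ge0.
Qed.

Lemma enorm_le n (x : 'rV[R]_n) e : (forall i, `|x 0 i| <= e) -> enorm x <= n%:R * e.
Proof.
case: n x => [|n] x xe; first by rewrite /enorm big_ord0 sqrtr0 mul0r.
have e0 : 0 <= e := le_trans (normr_ge0 _) (xe 0).
rewrite -[leRHS]ger0_norm ?mulr_ge0// -sqrtr_sqr ler_wsqrtr//.
apply: (@le_trans _ _ (\sum_(i < n.+1) e ^+ 2)).
  apply: ler_sum => i _; have := xe i; rewrite ler_norml => /andP[]; nra.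
rewrite sumr_const card_ord -[leLHS]mulr_natl exprMn ler_wpM2r ?sqr_ge0//.
by rewrite expr2 ler_peMr// ler1n.
Qed.

(** Each half of [\sum_p x p * b p x] reproduces [dotv x (grad G x)] at the product vector, hence
    [2 * K]. For the Lipschitz bound, the product map has constant [O(c)] and is multiplied by a
    coordinate of size [c], which gives [c ^+ 2]. *)
Lemma cross_field_properties : potential_assumptions G ->
  exists B K L, [/\ 0 < B, 0 < L,
    forall x, - K <= \sum_p x p * cross_field p x,
    forall x, \sum_p cross_field p x ^+ 2 <= B * \sum_p x p ^+ 2 &
    (forall p x c, (forall q, `|x q| <= c) -> `|cross_field p x| <= B * c) /\
    (forall p x y c e, 1 <= c -> 0 <= e ->
      (forall q, `|x q| <= c) -> (forall q, `|x q - y q| <= e) ->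
      `|cross_field p x - cross_field p y| <= L * c ^+ 2 * e)].
Proof.
case=> _ _ _ [K HK] [B0 HB] [L0 HL].
have B00 : 0 <= B0 := le_trans (normr_ge0 _) (HB 0).
(* This choice dominates both [B0] and [B0 ^+ 2], so one constant serves the linear and the
   quadratic growth bounds. *)
pose B := 1 + B0 ^+ 2; have BB : B0 <= B by rewrite /B; nra.
have gB x i : `|grad G x 0 i| <= B0 := le_trans (abs_row_le_norm _ _) (HB x).
pose L1 := `|L0| * d%:R.
have L10 : 0 <= L1 by rewrite mulr_ge0.
have gL (x y : 'rV[R]_d) e i : (forall j, `|x 0 j - y 0 j| <= e) ->
    `|grad G x 0 i - grad G y 0 i| <= L1 * e.
  move=> xe; apply: (@le_trans _ _ (enorm (grad G x - grad G y))).
    by have := abs_row_le_enorm (grad G x - grad G y) i; rewrite !mxE.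
  apply: le_trans (HL x y) _; rewrite /L1 -mulrA.
  apply: (@le_trans _ _ (`|L0| * enorm (x - y))).
    by rewrite ler_wpM2r ?sqrtr_ge0// ler_norm.
  by rewrite ler_wpM2l// enorm_le// => j; have := xe j; rewrite !mxE.
exists B, (2 * K), (3 * B + 3 * L1); split.
- by rewrite /B; have := sqr_ge0 B0; lra.
- by rewrite /B; have := sqr_ge0 B0; lra.
- move=> x; have := HK (\row_i (x (false, i) * x (true, i))).
  rewrite sum_pairs /dotv /cross_field /=.
  set g := grad G _ => h.
  rewrite (eq_bigr (fun i => 2 * ((\row_i0 (x (false, i0) * x (true, i0))) 0 i * g 0 i))).
    by rewrite -mulr_sumr; lra.
  by move=> i _; rewrite !mxE; ring.
- move=> x; rewrite !sum_pairs mulr_sumr; apply: ler_sum => i _.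
  rewrite /cross_field /=; set g := grad G _ 0 i.
  have g2 : g ^+ 2 <= B.
    have := gB (\row_i (x (false, i) * x (true, i))) i; rewrite -/g ler_norml /B.
    by move=> /andP[]; nra.
  rewrite !exprMn.
  have := ler_wpM2l (sqr_ge0 (x (false, i))) g2.
  have := ler_wpM2l (sqr_ge0 (x (true, i))) g2.
  lra.
split.
  move=> p x c xc; rewrite normrM mulrC.
  apply: ler_pM; rewrite ?normr_ge0//; exact: le_trans (gB _ _) BB.
move=> p x y c e c1 e0 xc xye.
pose q : bool * 'I_d := (~~ p.1, p.2).
pose X : 'rV[R]_d := \row_i (x (false, i) * x (true, i)).
pose Y : 'rV[R]_d := \row_i (y (false, i) * y (true, i)).
rewrite /cross_field -/X -/Y -/q.
have XY i : `|X 0 i - Y 0 i| <= (2 * c + e) * e.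
  rewrite !mxE; have yc : `|y (true, i)| <= c + e.
    have := ler_distD (x (true, i)) (y (true, i)) 0; rewrite !subr0 distrC.
    by have := xc (true, i); have := xye (true, i); lra.
  have -> : x (false, i) * x (true, i) - y (false, i) * y (true, i) =
    x (false, i) * (x (true, i) - y (true, i)) + (x (false, i) - y (false, i)) * y (true, i) by ring.
  apply: le_trans (ler_normD _ _) _; rewrite !normrM.
  have := ler_pM (normr_ge0 _) (normr_ge0 _) (xc (false, i)) (xye (true, i)).
  have := ler_pM (normr_ge0 _) (normr_ge0 _) (xye (false, i)) yc.
  lra.
have gd : `|grad G X 0 p.2 - grad G Y 0 p.2| <= (2 * B + 3 * L1) * c * e.
  (* The Lipschitz property produces a term in [e ^+ 2], harmless for [e <= 1]; beyond, boundedness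
     of the gradient is already enough, as [1 <= c * e]. *)
  have [e1|e1] := leP e 1.
    apply: le_trans (gL _ _ _ p.2 XY) _.
    have : L1 * ((2 * c + e) * e) <= L1 * (3 * c * e).
      by apply: ler_wpM2l => //; apply: ler_wpM2r => //; lra.
    have : 0 <= B * c * e by rewrite !mulr_ge0//; lra.
    lra.
  apply: le_trans (ler_normB _ _) _.
  have := gB X p.2; have := gB Y p.2.
  have : B * 1 <= B * (c * e) by apply: ler_wpM2l; [lra|nra].
  have : 0 <= L1 * (c * e) by rewrite !mulr_ge0//; lra.
  lra.
have -> : x q * grad G X 0 p.2 - y q * grad G Y 0 p.2 =
  x q * (grad G X 0 p.2 - grad G Y 0 p.2) + (x q - y q) * grad G Y 0 p.2 by ring.
apply: le_trans (ler_normD _ _) _; rewrite !normrM.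
have := ler_pM (normr_ge0 _) (normr_ge0 _) (xc q) gd.
have := ler_pM (normr_ge0 _) (normr_ge0 _) (xye q) (le_trans (gB Y p.2) BB).
have : B * e <= B * (c ^+ 2 * e).
  apply: ler_wpM2l; first lra.
  by rewrite ler_peMl// exprn_ege1.
lra.
Qed.
End field.

(** * From the integral equation to driven paths *)

Section sde_paths.
Context {R : realType}.

(** Freezing a path at its value at time [0] for negative times makes it continuous on the whole
    line, as the pathwise lemmas require. *)
Lemma continuous_clamp (V : topologicalType) (f : R -> V) :
  {within `[0, +oo[%classic, continuous f} -> continuous (f \o Num.max 0).
Proof.
move=> /subspace_continuousP cf x.
have m0 : `[0, +oo[%classic (Num.max 0 x) by rewrite /= in_itv /= andbT le_max lexx.
have cm : (Num.max 0) @ x --> Num.max 0 x.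
  by apply: (@continuous_max R R (cst 0) id) => //; exact: cst_continuous.
move=> A /= fA.
have := cf _ m0 _ fA; rewrite /within /= nbhs_simpl => h.
have hmax : nbhs x [set y | Num.max 0 y \in `[0, +oo[ -> A (f (Num.max 0 y))] by exact: (cm _ h).
change (nbhs x [set y | A (f (Num.max 0 y))]).
apply: filterS hmax => y /=; apply.
by rewrite in_itv /= andbT le_max lexx.
Qed.

Lemma continuous_rV n (f : R -> 'rV[R]_n) :
  (forall i, continuous (fun t => f t 0 i)) -> continuous f.
Proof.
move=> cf x; apply/cvgrPdist_lt => e e0.
have : \forall t \near x, forall i, `|f x 0 i - f t 0 i| < e.
  apply: (@filter_forall R _ (fun i t => `|f x 0 i - f t 0 i| < e) (nbhs x)) => i.
  by have /cvgrPdist_lt /(_ e e0) := cf i x.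
apply: filterS => t ft; rewrite /Num.norm /= mx_normrE.
by apply/bigmax_ltP; split => // -[j i] _ /=; rewrite ord1 !mxE; exact: ft.
Qed.

Variables (d : nat) (beta lambda : R) (G : 'rV[R]_d -> R).
Hypothesis HG : potential_assumptions G.

Definition singular (p : bool * 'I_d) : R := if p.1 then 0 else beta^-1.

Lemma continuous_cross_field (z : R -> bool * 'I_d -> R) p :
  (forall q, continuous (z ^~ q)) -> continuous (fun t => cross_field G p (z t)).
Proof.
move=> cz t; apply: cvgM; first exact: cz.
have cX : continuous (fun s => \row_i (z s (false, i) * z s (true, i))).
  apply: continuous_rV => i.
  rewrite (_ : (fun _ => _) = fun s => z s (false, i) * z s (true, i)).
    by move=> s; apply: cvgM; exact: cz.
  by apply/funext => s; rewrite mxE.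
apply: (@continuous_comp _ _ _ (fun s => \row_i (z s (false, i) * z s (true, i)))
  (fun x => grad G x 0 p.2)); first exact: cX.
apply: (@continuous_comp _ _ _ (grad G) (fun y : 'rV[R]_d => y 0 p.2)).
  exact: pot_grad_continuous HG _.
exact: coord_continuous.
Qed.

(** Positivity of [u] makes the drift continuous along the path, [1 / u] included, hence integrable
    on segments; increments are then integrals over []s, t]], and one-sided bounds follow by
    monotonicity of the integral. *)
Lemma driven_of_sde (u v w1 w2 : R -> 'rV[R]_d) T :
  {within `[0, +oo[%classic, continuous u} ->
  {within `[0, +oo[%classic, continuous v} ->
  (forall t, 0 <= t -> positive_vec (u t)) ->
  (forall t, 0 <= t -> forall i, u t 0 i = u 0 0 i
      + \int[lebesgue_measure]_(s in `[0, t])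
          ((- lambda *: u s - odot (v s) (grad G (odot (u s) (v s)))
            + beta^-1 *: einv (u s)) 0 i)
      + Num.sqrt (2 / beta) * w1 t 0 i) ->
  (forall t, 0 <= t -> forall i, v t 0 i = v 0 0 i
      + \int[lebesgue_measure]_(s in `[0, t])
          ((- lambda *: v s - odot (u s) (grad G (odot (u s) (v s)))) 0 i)
      + Num.sqrt (2 / beta) * w2 t 0 i) ->
  let z t := pairing (u (Num.max 0 t)) (v (Num.max 0 t)) in
  let w t p := Num.sqrt (2 / beta) * pairing (w1 t) (w2 t) p in
  driven lambda singular (cross_field G) T w z /\ forall p, continuous (z ^~ p).
Proof.
move=> cu cv upos equ eqv z w.
have zE t p : 0 <= t -> z t p = pairing (u t) (v t) p.
  by move=> t0; rewrite /z max_r.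
have cz p : continuous (z ^~ p).
  case: p => -[] i t; rewrite /z /pairing /=.
    apply: (@continuous_comp _ _ _ (v \o Num.max 0) (fun y : 'rV[R]_d => y 0 i)).
      exact: continuous_clamp.
    exact: coord_continuous.
  apply: (@continuous_comp _ _ _ (u \o Num.max 0) (fun y : 'rV[R]_d => y 0 i)).
    exact: continuous_clamp.
  exact: coord_continuous.
have zpos t i : 0 < z t (false, i).
  by rewrite /z /pairing /=; apply: upos; rewrite le_max lexx.
pose f p t := relax lambda singular p (z t p) - cross_field G p (z t).
have cf p : continuous (f p).
  move=> t; rewrite /f /relax; apply: cvgB; last exact: continuous_cross_field.
  apply: cvgB; last by apply: cvgM; [exact: cvg_cst|exact: cz].
  case: p => -[] i; rewrite /singular /=.
    rewrite (_ : (fun _ => _) = cst 0); first by rewrite mul0r; exact: cvg_cst.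
    by apply/funext => s; rewrite mul0r.
  apply: cvgM; first exact: cvg_cst.
  by apply: cvgV; [rewrite gt_eqF|exact: cz].
have intf p s t : lebesgue_measure.-integrable `[s, t] (EFin \o f p).
  apply: continuous_compact_integrable; first exact: segment_compact.
  exact/continuous_subspaceT/cf.
have zeq p t : 0 <= t ->
    z t p = z 0 p + \int[lebesgue_measure]_(s in `[0, t]) f p s + w t p.
  move=> t0; rewrite !zE//.
  case: p => -[] i; rewrite /pairing /w /pairing /=.
    rewrite (eqv t t0 i); congr (_ + _ + _); apply: eq_Rintegral => s.
    rewrite inE /= in_itv /= => /andP[s0 _].
    rewrite /f /relax /z max_r// cross_field_pairing /pairing /singular /= !mxE; ring.
  rewrite (equ t t0 i); congr (_ + _ + _); apply: eq_Rintegral => s.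
  rewrite inE /= in_itv /= => /andP[s0 _].
  by rewrite /f /relax /z max_r// cross_field_pairing /pairing /singular /= !mxE; ring.
have zB p s t : 0 <= s -> s <= t -> z t p - z s p =
    \int[lebesgue_measure]_(r in `]s, t]) f p r + (w t p - w s p).
  move=> s0 st; have t0 := le_trans s0 st.
  rewrite (zeq p t t0) (zeq p s s0).
  have := @Rintegral_itvB R (f p) (BLeft 0) (BRight t) s (intf p 0 t).
  rewrite !bnd_simp => /(_ s0 st) <-; ring.
have int_cst (c s t : R) : s <= t ->
    \int[lebesgue_measure]_(r in `]s, t]) (fun=> c) r = c * (t - s).
  move=> st; rewrite Rintegral_cst//= lebesgue_measure_itv /= lte_fin.
  have [lt|] := ltP s t; first by rewrite -EFinD.
  move=> ts; have -> : t = s by apply/eqP; rewrite eq_le ts st.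
  by rewrite subrr mulr0.
have icst (c s t : R) : lebesgue_measure.-integrable `]s, t] (EFin \o fun=> c).
  apply: (@integrableS _ _ R lebesgue_measure `[s, t]%classic) => //.
    by apply: subset_itvr; rewrite bnd_simp.
  apply: continuous_compact_integrable; first exact: segment_compact.
  by apply: continuous_subspaceT => x; exact: cvg_cst.
have intf' p s t : lebesgue_measure.-integrable `]s, t] (EFin \o f p).
  apply: (@integrableS _ _ R lebesgue_measure `[s, t]%classic) => //.
  by apply: subset_itvr; rewrite bnd_simp.
split=> //; split.
- by move=> [[] i] t; rewrite /singular /= ?ltxx// => _ _; exact: zpos.
- move=> p s t c s0 st _ fc; rewrite zB// lerD2r -int_cst//.
  apply: le_Rintegral => // r; rewrite /= in_itv /= => /andP[sr rt].
  by apply: fc; rewrite (ltW sr).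
- move=> p s t c s0 st _ fc; rewrite zB// lerD2r -int_cst//.
  apply: le_Rintegral => // r; rewrite /= in_itv /= => /andP[sr rt].
  by apply: fc; rewrite (ltW sr).
Qed.

End sde_paths.

(** * Gaussian tails and the Brownian maximum *)

Section tails.
Context {R : realType}.

Lemma measurable_abs_gt (disp : measure_display) (T : measurableType disp) (f : T -> R) x :
  measurable_fun setT f -> measurable [set w | x < `|f w|].
Proof.
move=> mf; rewrite (_ : [set w | _] = (fun w => `|f w|) @^-1` `]x, +oo[%classic).
  by rewrite -[X in measurable X]setTI; apply: measurableT_comp.
by apply/seteqP; split => w /=; rewrite in_itv /= andbT.
Qed.

Lemma measurable_abs_le (disp : measure_display) (T : measurableType disp) (f : T -> R) x :
  measurable_fun setT f -> measurable [set w | `|f w| <= x].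
Proof.
move=> mf; rewrite (_ : [set w | _] = ~` [set w | x < `|f w|]).
  exact/measurableC/measurable_abs_gt.
by apply/seteqP; split => w /=; rewrite ltNge; [move=> ->|move=> /negP; rewrite negbK].
Qed.

(** Comparison with the normal density of twice the variance: the quotient of the densities is
    [sqrt 2 * exp (- y^2 / (4 h))], decreasing in [|y|], and [sqrt 2 <= 3 / 2]. *)
Lemma normal_tail (h x : R) : 0 < h -> 0 <= x ->
  (normal_prob 0 (Num.sqrt h) [set y | (x < `|y|)%R] <= (3 / 2 * expR (- (x ^+ 2 / (4 * h))))%:E)%E.
Proof.
move=> h0 x0.
have s0 : Num.sqrt h != 0 by rewrite gt_eqF// sqrtr_gt0.
have h20 : 0 < 2 * h by rewrite mulr_gt0.
have s1 : Num.sqrt (2 * h) != 0 by rewrite gt_eqF// sqrtr_gt0.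
have mA : measurable [set y : R | x < `|y|] by exact: (@measurable_abs_gt _ _ id).
rewrite /normal_prob.
pose c := 3 / 2 * expR (- (x ^+ 2 / (4 * h))).
have c0 : 0 <= c by rewrite mulr_ge0 ?expR_ge0//.
have mpdf s : measurable_fun [set: R] (EFin \o normal_pdf 0 s).
  by apply/measurable_EFinP; exact: measurable_normal_pdf.
apply: (@le_trans _ _ (\int[lebesgue_measure]_(y in [set y : R | (x < `|y|)%R])
    (c%:E * (normal_pdf 0 (Num.sqrt (2 * h)) y)%:E)%E)%E).
  apply: ge0_le_integral => //.
  - by move=> y _; rewrite lee_fin normal_pdf_ge0.
  - exact: (@measurable_funTS _ _ _ _ _ _ (mpdf _)).
  - by apply: measurable_funTS; apply: measurable_funeM; exact: mpdf.
  move=> y /= xy; rewrite -EFinM lee_fin !normal_pdfE//.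
  rewrite /normal_peak /normal_fun !sqr_sqrtr ?(ltW h0) ?(ltW h20)// subr0.
  have -> : Num.sqrt (2 * h * pi *+ 2) = Num.sqrt 2 * Num.sqrt (h * pi *+ 2).
    by rewrite -sqrtrM//; congr Num.sqrt; ring.
  have p0 : 0 < Num.sqrt (h * pi *+ 2) by rewrite sqrtr_gt0 mulrn_wgt0// mulr_gt0// pi_gt0.
  have q0 : 0 < Num.sqrt (2 : R) by rewrite sqrtr_gt0.
  have q32 : Num.sqrt (2 : R) <= 3 / 2.
    rewrite -[leRHS]ger0_norm// -sqrtr_sqr ler_wsqrtr//; lra.
  rewrite invfM /c.
  have -> : 3 / 2 * expR (- (x ^+ 2 / (4 * h))) * ((Num.sqrt 2)^-1 * (Num.sqrt (h * pi *+ 2))^-1 * expR (- y ^+ 2 / (2 * h *+ 2))) =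
    (Num.sqrt (h * pi *+ 2))^-1 * ((3 / 2) / Num.sqrt 2 * (expR (- (x ^+ 2 / (4 * h))) * expR (- y ^+ 2 / (2 * h *+ 2)))) by ring.
    rewrite ler_pM2l ?invr_gt0// -[leLHS]mul1r; apply: ler_pM; rewrite ?expR_ge0//.
    by rewrite ler_pdivlMr// mul1r.
  rewrite -expRD ler_expR.
  have xy2 : x ^+ 2 <= y ^+ 2 by rewrite -(real_normK (num_real y)) lerXn2r// ?nnegrE// ltW.
  have : x ^+ 2 / (4 * h) <= y ^+ 2 / (4 * h) by rewrite ler_pM2r// invr_gt0 mulr_gt0.
  have -> : - y ^+ 2 / (2 * h *+ 2) = - (y ^+ 2 / (4 * h)).
    by rewrite -mulr_natl; field; rewrite gt_eqF.
  have -> : - y ^+ 2 / (h *+ 2) = - 2 * (y ^+ 2 / (4 * h)).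
    by rewrite -mulr_natl; field; rewrite gt_eqF.
  lra.
rewrite ge0_integralZl//; last first.
- by move=> y _; rewrite lee_fin normal_pdf_ge0.
- exact: (@measurable_funTS _ _ _ _ _ _ (mpdf _)).
rewrite -[leRHS]mule1; apply: lee_wpmul2l; first by rewrite lee_fin.
rewrite -(integral_normal_pdf 0 (Num.sqrt (2 * h))).
apply: ge0_subset_integral => //; first exact: mpdf.
by move=> y _; rewrite lee_fin normal_pdf_ge0.
Qed.

Context {disp : measure_display} {Omega : measurableType disp}.
Variable P : probability Omega R.

(** [seqDU E j] is the event that the level [2 * x] is first exceeded at index [j]; if afterwards
    [S] moves by at most [x], then [|S N| > x] at the end, and these events are disjoint. The
    premise is the inequality that independence of increments provides. *)
Lemma ottaviani (S : nat -> Omega -> R) (N : nat) (x : R) :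
  (forall j, measurable_fun setT (S j)) ->
  let E j := [set w | 2 * x < `|S j w|] in
  (forall j, (j <= N)%N -> P (seqDU E j) <= 2%:E * P (seqDU E j `&` [set w | (`|S N w - S j w| <= x)%R]))%E ->
  (P (\big[setU/set0]_(j < N.+1) E j) <= 2%:E * P [set w | (x < `|S N w|)%R])%E.
Proof.
move=> mS E H.
have mE j : measurable (E j) by exact: measurable_abs_gt.
have mD j : measurable (seqDU E j).
  by apply: measurableD => //; exact: bigsetU_measurable.
have mB j : measurable [set w | `|S N w - S j w| <= x].
  by apply: measurable_abs_le; apply: measurable_funB.
have mT : measurable [set w | x < `|S N w|] by exact: measurable_abs_gt.
rewrite bigsetU_seqDU measure_bigsetU; [|exact: mD|exact: trivIset_seqDU].
pose F j := seqDU E j `&` [set w | `|S N w - S j w| <= x].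
apply: (@le_trans _ _ (\sum_(j < N.+1) 2%:E * P (F j))%E).
  by apply: lee_sum => j _; apply: H; rewrite -ltnS.
rewrite -ge0_sume_distrr; last by move=> j _; exact: measure_ge0.
apply: lee_wpmul2l => //.
rewrite -(@measure_bigsetU _ _ _ P F); last 2 first.
- by move=> j; exact: measurableI.
- by apply: trivIset_setIr; exact: trivIset_seqDU.
apply: le_measure; rewrite ?inE//.
  by apply: bigsetU_measurable => j _; exact: measurableI.
rewrite -bigcup_mkord => w [j /= _ [[Ej _] /= Bj]].
have := ler_normB (S N w) (S N w - S j w); rewrite opprB addrC subrK.
move: Ej Bj; rewrite /E /=; lra.
Qed.

End tails.

Section brownian_maximum.
Context {R : realType} {disp : measure_display} {Omega : measurableType disp}.
Variable P : probability Omega R.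
Variable B : R -> Omega -> R.
Hypothesis HB : standard_brownian P B.

Lemma brownian_increment_tail s t h x : 0 <= s -> s < t -> t - s <= h -> 0 <= x ->
  (P [set w | (x < `|B t w - B s w|)%R] <= (3 / 2 * expR (- (x ^+ 2 / (4 * h))))%:E)%E.
Proof.
move=> s0 st tsh x0; have ts : 0 < t - s by rewrite subr_gt0.
have mA : measurable ([set y : R | x < `|y|] : set (measurableTypeR R)).
  exact: (@measurable_abs_gt _ _ _ id).
rewrite (bm_gaussian HB s0 st mA); apply: le_trans (normal_tail ts x0) _.
rewrite lee_fin ler_pM2l// ler_expR lerN2 ler_wpM2l ?sqr_ge0// lef_pV2 ?posrE ?mulr_gt0//.
  by rewrite ler_pM2l.
exact: lt_le_trans tsh.
Qed.

(** Membership in the sigma-algebra of the past is phrased as measurability over a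
    [g_sigma_algebraType], so that the usual closure lemmas apply to first-exceedance events. *)
Lemma measurable_past s r : 0 <= r <= s ->
  measurable_fun [set: g_sigma_algebraType [set A | exists j, [set r | 0 <= r <= s] j /\
    exists Y : set (measurableTypeR R), measurable Y /\ A = B j @^-1` Y]] (B r).
Proof.
move=> rs _ Y mY; rewrite setTI; apply: sub_sigma_algebra.
by exists r; split => //; exists Y.
Qed.

Variables (a h : R).
Hypotheses (a_ge0 : 0 <= a) (h_gt0 : 0 < h).

Lemma brownian_grid_maximum N x : (0 < N)%N -> 0 <= x ->
  (P (\big[setU/set0]_(j < N.+1)
       [set w | (2 * x < `|B (a + h * (j%:R / N%:R)) w - B a w|)%R])
    <= (3 * expR (- (x ^+ 2 / (4 * h))))%:E)%E.
Proof.
move=> N0 x0; set q := expR _.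
have NR : 0 < N%:R :> R by rewrite ltr0n.
pose t j := a + h * (j%:R / N%:R).
have t0 j : 0 <= t j by rewrite addr_ge0// mulr_ge0 ?(ltW h_gt0)// divr_ge0.
have ta j : a <= t j by rewrite lerDl mulr_ge0 ?(ltW h_gt0)// divr_ge0.
have tj i j : (i <= j)%N -> t i <= t j.
  by move=> ij; rewrite lerD2l ler_pM2l// ler_pM2r ?invr_gt0// ler_nat.
have mB s : 0 <= s -> measurable_fun setT (B s) by exact: bm_measurable HB _.
have mS j : measurable_fun setT (fun w => B (t j) w - B a w).
  by apply: measurable_funB; exact: mB.
(* If the one-increment tail bound exceeds [1 / 2], the claimed bound [3 * q] exceeds [1]. Otherwise
   every later increment stays below [x] with probability at least [1 / 2], as Ottaviani's
   inequality needs. *)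
have [q13|q13] := leP (3 / 2 * q) (1 / 2); last first.
  apply: (@le_trans _ _ 1%E); last by rewrite lee_fin; lra.
  by apply: probability_le1; apply: bigsetU_measurable => j _; exact/measurable_abs_gt/mS.
apply: le_trans (@ottaviani _ _ _ P (fun j w => B (t j) w - B a w) N x mS _) _; last first.
  have -> : (3 * q)%:E = (2%:E * (3 / 2 * q)%:E)%E by rewrite -EFinM; congr EFin; lra.
  apply: lee_wpmul2l => //.
  apply: (@brownian_increment_tail a (t N) h x) => //.
    by rewrite ltrDl mulr_gt0// divr_gt0.
  by rewrite /t divff ?gt_eqF// mulr1 addrC addKr.
move=> j jN; set E := fun _ => _.
have mE i : measurable (seqDU E i).
  apply: measurableD; first exact/measurable_abs_gt/mS.
  by apply: bigsetU_measurable => k _; exact/measurable_abs_gt/mS.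
(* The last index is separate: no increment remains, and independence is stated for [s < t] only. *)
have [->|jneN] := eqVneq j N.
  rewrite (_ : _ `&` _ = seqDU E N).
    by rewrite -[leLHS]mul1e; apply: lee_wpmul2r => //; rewrite lee_fin ler1n.
  by apply/setIidl => w _ /=; rewrite subrr normr0.
have jN' : (j < N)%N by rewrite ltn_neqAle jneN.
have tjN : t j < t N by rewrite ltrD2l ltr_pM2l// ltr_pM2r ?invr_gt0// ltr_nat.
set F := [set w | _].
have mF : measurable F by apply: measurable_abs_le; apply: measurable_funB; exact: mS.
have -> : P (seqDU E j `&` F) = (P (seqDU E j) * P F)%E.
  apply: (bm_independent HB (t0 j) tjN).
    have mE' i : (i <= j)%N -> (measurable : set (set (g_sigma_algebraType [set A | exists r, [set r | 0 <= r <= t j] r /\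
        exists Y : set (measurableTypeR R), measurable Y /\ A = B r @^-1` Y]))) (E i).
      move=> ij; apply: measurable_abs_gt; apply: measurable_funB; apply: measurable_past.
        by rewrite t0 tj.
      by rewrite a_ge0 ta.
    change ((measurable : set (set (g_sigma_algebraType [set A | exists r, [set r | 0 <= r <= t j] r /\
        exists Y : set (measurableTypeR R), measurable Y /\ A = B r @^-1` Y]))) (seqDU E j)).
    apply: measurableD; first exact: mE'.
    by apply: bigsetU_measurable => k _; apply: mE'; exact/ltnW.
  apply: sub_sigma_algebra; exists tt; split => //.
  exists [set y : R | `|y| <= x]; split.
    exact: (@measurable_abs_le _ _ _ id).
  by apply/seteqP; split => w; rewrite /F /=; rewrite opprB addrA subrK.
have PF : (1 <= 2%:E * P F)%E.
  have mFc : measurable [set w | x < `|B (t N) w - B (t j) w|].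
    by apply: measurable_abs_gt; apply: measurable_funB; exact: mB.
  have -> : F = ~` [set w | x < `|B (t N) w - B (t j) w|].
    apply/seteqP; split => w; rewrite /F /= opprB addrA subrK leNgt; by move/negP.
  rewrite probability_setC//.
  have := @brownian_increment_tail (t j) (t N) h x (t0 j) tjN _ x0.
  have -> : t N - t j <= h.
    rewrite /t opprD addrACA subrr add0r divff ?gt_eqF// mulr1 gerBl.
    by rewrite mulr_ge0 ?(ltW h_gt0)// divr_ge0.
  move=> /(_ isT); rewrite -/q.
  have fn : P [set w | x < `|B (t N) w - B (t j) w|] \is a fin_num by exact: fin_num_measure.
  rewrite -(fineK fn); set y := fine _; rewrite lee_fin => yq.
  by change (1%:E <= (2 * (1 - y))%:E)%E; rewrite lee_fin; lra.
rewrite muleCA -[leLHS]mule1; exact: lee_wpmul2l.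
Qed.

End brownian_maximum.

Lemma measurable_bigmaxr (R : realType) (disp : measure_display) (T : measurableType disp)
    (f : nat -> T -> R) n : (forall j, measurable_fun setT (f j)) ->
  measurable_fun setT (fun w => \big[Num.max/0]_(j < n) f j w).
Proof.
move=> mf; have H (s : seq nat) : measurable_fun setT (fun w => \big[Num.max/0]_(j <- s) f j w).
  elim: s => [|j s IH].
    by rewrite (_ : (fun w => _) = cst 0)//; apply/funext => w; rewrite big_nil.
  rewrite (_ : (fun w => _) = (f j \max (fun w => \big[Num.max/0]_(j <- s) f j w))).
    exact: measurable_maxr.
  by apply/funext => w; rewrite big_cons.
rewrite (_ : (fun w => _) = (fun w => \big[Num.max/0]_(j <- index_iota 0 n) f j w)) //.
by apply/funext => w; rewrite big_mkord.
Qed.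

(** * Exponential moments of Brownian oscillations *)

Section exponential_moments.
Context {R : realType} {disp : measure_display} {Omega : measurableType disp}.
Variable P : probability Omega R.

(** The bound of [exp_moment_tail] for [K = 3], the constant in the tail of the Brownian maximum. *)
Definition exp_moment : R := expR 1 + 3 * (expR 2 / (1 - expR (- 1))).

Lemma exp_moment_ge0 : 0 <= exp_moment.
Proof.
by rewrite /exp_moment addr_ge0 ?expR_ge0// mulr_ge0// divr_ge0 ?expR_ge0// subr_ge0.
Qed.

(** Slicing by integer levels, [exp Y <= e + \sum_n exp (n + 2) 1_{Y > n}]; the tail of rate [2]
    leaves a geometric series of ratio [exp (- 1)]. *)
Lemma exp_moment_tail (Y : Omega -> R) (K : R) : 0 <= K -> measurable_fun setT Y ->
  (forall w, 0 <= Y w) ->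
  (forall n : nat, (P [set w | (n%:R < Y w)%R] <= (K * expR (- (2 * n%:R)))%:E)%E) ->
  (\int[P]_w (expR (Y w))%:E <= (expR 1 + K * (expR 2 / (1 - expR (- 1))))%:E)%E.
Proof.
move=> K0 mY Y0 tail.
pose E (n : nat) := [set w | n%:R < Y w].
have mE n : measurable (E n).
  rewrite (_ : E n = Y @^-1` `]n%:R, +oo[%classic).
    by rewrite -[X in measurable X]setTI; exact: mY.
  by apply/seteqP; split => w /=; rewrite in_itv /= andbT.
pose f (n : nat) w : \bar R := (expR (n%:R + 2) * \1_(E n) w)%:E.
have f0 n w : (0 <= f n w)%E by rewrite lee_fin mulr_ge0 ?expR_ge0.
have mf n : measurable_fun setT (f n).
  apply/measurable_EFinP; apply: measurable_funM => //.
have mexp : measurable_fun setT (fun w => (expR (Y w))%:E).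
  by apply/measurable_EFinP; exact: measurableT_comp.
apply: (@le_trans _ _ (\int[P]_w ((expR 1)%:E + \sum_(n <oo) f n w))%E).
  apply: ge0_le_integral => //.
    apply: emeasurable_funD; first exact: measurable_cst.
    exact: ge0_emeasurable_sum.
  move=> w _; have [Y1|Y1] := ltP (Y w) 1.
    rewrite -[leLHS]adde0; apply: leeD; first by rewrite lee_fin ler_expR ltW.
    by apply: nneseries_ge0.
  (* The predecessor, because the slice needs [n < Y w] strictly even when [Y w] is an integer; then
     [Y w < n + 2], whence the [2] in the weight. *)
  pose n := (Num.truncn (Y w)).-1.
  have nE : n.+1 = Num.truncn (Y w) by rewrite prednK// truncn_gt0.
  have En : E n w.
    apply: (@lt_le_trans _ _ n.+1%:R); first by rewrite ltr_nat.
    by rewrite nE truncn_le// (le_trans _ Y1).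
  have fn : ((expR (Y w))%:E <= f n w)%E.
    rewrite lee_fin indicE mem_set// mulr1 ler_expR.
    have := truncnS_gt (Y w); rewrite -nE -!natr1; lra.
  apply: le_trans fn _; rewrite -[leLHS]add0e; apply: leeD.
    by rewrite lee_fin expR_ge0.
  rewrite (@nneseriesD1 _ (fun n => f n w) n)// leeDl//; exact: nneseries_ge0.
rewrite ge0_integralD//; last 2 first.
  by move=> w _; apply: nneseries_ge0.
  exact: ge0_emeasurable_sum.
have -> : (\int[P]_w (expR 1)%:E = (expR 1)%:E)%E.
  rewrite (@integral_cst _ _ _ P setT measurableT (expR 1)%:E).
  by rewrite (_ : _ setT = 1%E) ?mule1//; exact: probability_setT.
rewrite EFinD; apply: leeD => //.
rewrite integral_nneseries//.
apply: lime_le.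
  by apply: is_cvg_nneseries => n _ _; apply: integral_ge0 => w _.
apply: nearW => N.
have z1 : expR (- 1) < 1 :> R by rewrite -[ltRHS]expR0 ltr_expR; lra.
apply: (@le_trans _ _ (\sum_(0 <= i < N) (geometric (K * expR 2) (expR (- 1)) i)%:E)%E).
  apply: lee_sum => n _.
  under eq_integral do rewrite /f EFinM.
  rewrite ge0_integralZl_EFin ?expR_ge0//; last exact/measurable_EFinP.
  rewrite integral_indic// setIT.
  apply: le_trans (lee_wpmul2l _ (tail n)) _; first by rewrite lee_fin expR_ge0.
  rewrite -EFinM lee_fin /geometric /= -expRM_natl.
  rewrite mulrCA -!mulrA -!expRD ler_wpM2l// ler_expR; lra.
rewrite sumEFin lee_fin.
have -> : \sum_(0 <= i < N) geometric (K * expR 2) (expR (- 1)) i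
  = series (geometric (K * expR 2) (expR (- 1))) N by [].
rewrite geometric_seriesE ?lt_eqF// mulrA ler_pM2r ?invr_gt0 ?subr_gt0//.
by rewrite ler_piMr ?mulr_ge0 ?expR_ge0// gerBl exprn_ge0// expR_ge0.
Qed.

Variable B : R -> Omega -> R.
Hypothesis HB : standard_brownian P B.

Definition dyadic_maximum (a h : R) (n : nat) (w : Omega) : R :=
  \big[Num.max/0]_(j < (2 ^ n).+1) `|B (a + h * (j%:R / (2 ^ n)%:R)) w - B a w|.

(* The supremum over dyadic times, which is measurable; [fine] only matters on
   the null set of discontinuous paths. *)
Definition increment_sup (a h : R) (w : Omega) : R :=
  fine (esups (fun n => (dyadic_maximum a h n w)%:E) 0%N).

Lemma dyadic_maximum_ge0 a h n w : 0 <= dyadic_maximum a h n w.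
Proof. by rewrite /dyadic_maximum; apply/bigmax_geP; left. Qed.

Lemma increment_sup_ge0 a h w : 0 <= increment_sup a h w.
Proof.
apply: fine_ge0; apply: (@le_trans _ _ (dyadic_maximum a h 0 w)%:E).
  by rewrite lee_fin dyadic_maximum_ge0.
by apply: ereal_sup_ubound; exists 0%N.
Qed.

Lemma measurable_increment_sup a h : 0 <= a -> 0 <= h -> measurable_fun setT (increment_sup a h).
Proof.
move=> a0 h0; apply: (@measurableT_comp _ _ _ _ _ _ fine) => //.
apply: (@measurable_fun_esups _ _ _ setT (fun n w => (dyadic_maximum a h n w)%:E)) => n.
apply/measurable_EFinP; rewrite /dyadic_maximum.
apply: (@measurable_bigmaxr _ _ _ (fun j w => `|B (a + h * (j%:R / (2 ^ n)%:R)) w - B a w|)) => j.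
apply: measurableT_comp => //; apply: measurable_funB; apply: bm_measurable HB _ _ => //.
by rewrite addr_ge0// mulr_ge0// divr_ge0.
Qed.

(** Dyadic grids are nested, so the exceedance events increase with [n]; the grid bound being
    uniform in [n], it passes to their union. Where the supremum is infinite [fine] returns [0],
    which does not exceed [2 * x]. *)
Lemma increment_sup_tail a h x : 0 <= a -> 0 < h -> 0 <= x ->
  (P [set w | (2 * x < increment_sup a h w)%R] <= (3 * expR (- (x ^+ 2 / (4 * h))))%:E)%E.
Proof.
move=> a0 h0 x0.
have mB t : 0 <= t -> measurable_fun setT (B t) by exact: bm_measurable HB _.
pose F n j := [set w | 2 * x < `|B (a + h * (j%:R / (2 ^ n)%:R)) w - B a w|].
have mF n j : measurable (F n j).
  apply: measurable_abs_gt; apply: measurable_funB; apply: mB => //.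
  by rewrite addr_ge0// mulr_ge0 ?(ltW h0)// divr_ge0.
pose E n := \big[setU/set0]_(j < (2 ^ n).+1) F n j.
have mE n : measurable (E n) by exact: bigsetU_measurable.
have ndE : nondecreasing_seq E.
  apply/nondecreasing_seqP => n; rewrite subsetEset /E -!bigcup_mkord => w [j /= jn Fj].
  exists j.*2; first by rewrite /= ltnS expnS mul2n leq_double -ltnS.
  move: Fj; rewrite /F /=; congr (_ < `|B (_ + _ * _) _ - _|).
  by rewrite -mul2n expnS !natrM invfM mulrACA divff ?mul1r// pnatr_eq0.
have mUE : measurable (\bigcup_n E n) by exact: bigcupT_measurable.
apply: (@le_trans _ _ (P (\bigcup_n E n))).
  apply: le_measure; rewrite ?inE//.
    rewrite (_ : [set w | _] = increment_sup a h @^-1` `]2 * x, +oo[%classic).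
      by rewrite -[X in measurable X]setTI; apply: measurable_increment_sup => //; exact: ltW.
    by apply/seteqP; split => w /=; rewrite in_itv /= andbT.
  move=> w /= xw.
  have : ((2 * x)%:E < esups (fun n => (dyadic_maximum a h n w)%:E) 0%N)%E.
    move: xw; rewrite /increment_sup; case: (esups _ _) => [r| |] /=; first by rewrite lte_fin.
      by rewrite ltry.
    by rewrite ltNge mulr_ge0.
  move=> /ereal_sup_gt[_ [n _ <-]]; rewrite lte_fin => xn.
  exists n => //; rewrite /E -bigcup_mkord.
  have /bigmax_gtP[|[j _ xj]] := xn; first by rewrite ltNge mulr_ge0.
  by exists j => //=.
have cvE := @nondecreasing_cvg_mu _ _ _ P E mE mUE ndE.
rewrite -(cvg_lim (@ereal_hausdorff R) cvE); apply: lime_le; first by apply/cvg_ex; eexists; exact: cvE.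
by apply: nearW => n /=; apply: brownian_grid_maximum => //; rewrite expn_gt0.
Qed.

Lemma increment_sup_exp_moment a h : 0 <= a -> 0 < h ->
  (\int[P]_w (expR (increment_sup a h w ^+ 2 / (32 * h)))%:E <= exp_moment%:E)%E.
Proof.
move=> a0 h0; apply: exp_moment_tail => //.
- apply: measurable_funM => //; apply: measurable_funX.
  exact/measurable_increment_sup/ltW.
- by move=> w; rewrite divr_ge0 ?sqr_ge0// mulr_ge0// ltW.
(* Solves [x^2 / (4 h) = 2 n]; the level [2 * x] then has square [32 h n], the origin of the
   constant [32]. *)
move=> n; pose x := Num.sqrt (8 * h * n%:R).
have x2 : x ^+ 2 = 8 * h * n%:R by rewrite sqr_sqrtr// !mulr_ge0// ltW.
have -> : [set w | n%:R < increment_sup a h w ^+ 2 / (32 * h)] =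
    [set w | 2 * x < increment_sup a h w].
  apply/seteqP; split => w /=; rewrite ltr_pdivlMr ?mulr_gt0//.
    have -> : n%:R * (32 * h) = (2 * x) ^+ 2 by rewrite exprMn x2; ring.
    by rewrite ltr_pXn2r// ?nnegrE ?increment_sup_ge0// mulr_ge0// sqrtr_ge0.
  have -> : n%:R * (32 * h) = (2 * x) ^+ 2 by rewrite exprMn x2; ring.
  by rewrite ltr_pXn2r// ?nnegrE ?increment_sup_ge0// mulr_ge0// sqrtr_ge0.
have := @increment_sup_tail a h x a0 h0 (sqrtr_ge0 _).
rewrite x2; have -> // : 8 * h * n%:R / (4 * h) = 2 * n%:R by field; rewrite gt_eqF.
Qed.

(** Continuity makes the dyadic supremum finite, so [fine] is harmless; a value above it at [s]
    would persist near [s], where there is a dyadic time. *)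
Lemma increment_sup_bound a h w s : 0 <= a -> 0 < h ->
  {within `[0, +oo[%classic, continuous (fun t => B t w)} ->
  a <= s <= a + h -> `|B s w - B a w| <= increment_sup a h w.
Proof.
move=> a0 h0 cB /andP[as_ sah].
pose f t := `|B (Num.max 0 t) w - B a w|.
have cf : continuous f.
  move=> t; apply: cvg_norm; apply: cvgB; last exact: cvg_cst.
  exact: (@continuous_clamp R R (fun t => B t w) cB).
have fE t : a <= t -> f t = `|B t w - B a w|.
  by move=> at_; rewrite /f max_r// (le_trans a0).
have ah : a <= a + h by rewrite lerDl ltW.
have [c _ fc] := EVT_max ah (continuous_subspaceT cf).
have dy n j : (j <= 2 ^ n)%N -> a <= a + h * (j%:R / (2 ^ n)%:R) <= a + h.
  move=> jn; rewrite lerDl mulr_ge0 ?(ltW h0) ?divr_ge0//= lerD2l ger_pMr//.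
  by rewrite ler_pdivrMr ?mul1r ?ler_nat// ltr0n expn_gt0.
have Dn n : dyadic_maximum a h n w <= f c.
  apply/bigmax_leP; split; first exact: normr_ge0.
  move=> [j jn] _ /=; rewrite -fE; last by case/andP: (dy n j jn).
  by apply: fc; rewrite in_itv /=; exact: dy.
have [D SD] : exists D, esups (fun n => (dyadic_maximum a h n w)%:E) 0%N = D%:E.
  have : (esups (fun n => (dyadic_maximum a h n w)%:E) 0%N <= (f c)%:E)%E.
    by apply: ge_ereal_sup => _ [n _ <-]; rewrite lee_fin.
  have : (0%:E <= esups (fun n => (dyadic_maximum a h n w)%:E) 0%N)%E.
    apply: (@le_trans _ _ (dyadic_maximum a h 0 w)%:E).
      by rewrite lee_fin dyadic_maximum_ge0.
    by apply: ereal_sup_ubound; exists 0%N.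
  by case: (esups _ _) => [r _ _| |]//; exists r.
rewrite /increment_sup SD /= leNgt -fE//; apply/negP => Ds.
have fD n j : (j <= 2 ^ n)%N -> f (a + h * (j%:R / (2 ^ n)%:R)) <= D.
  move=> jn; rewrite -lee_fin -SD.
  apply: (@le_trans _ _ (dyadic_maximum a h n w)%:E); last first.
    by apply: ereal_sup_ubound; exists n.
  rewrite lee_fin fE; last by case/andP: (dy n j jn).
  exact: (@le_bigmax _ _ _ 0 (fun j : 'I_(2 ^ n).+1 =>
    `|B (a + h * (j%:R / (2 ^ n)%:R)) w - B a w|) (Ordinal (jn : (j < (2 ^ n).+1)%N))).
have := @cvgr_gt _ _ _ (nbhs_filter s) f (f s) (cf s) D Ds.
move=> /nbhs_ballP[e /= e0 He].
have [n hn] : exists n : nat, h / (2 ^ n)%:R < e.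
  exists (Num.truncn (h / e)).+1; rewrite ltr_pdivrMr ?ltr0n ?expn_gt0// mulrC -ltr_pdivrMr//.
  apply: lt_le_trans (truncnS_gt _) _; rewrite ler_nat.
  by apply: ltnW; exact: ltn_expl.
have n0 : 0 < (2 ^ n)%:R :> R by rewrite ltr0n expn_gt0.
pose j := Num.truncn ((s - a) / h * (2 ^ n)%:R).
have sh0 : 0 <= (s - a) / h * (2 ^ n)%:R by rewrite mulr_ge0 ?(ltW n0)// divr_ge0 ?subr_ge0// ltW.
have j1 : j%:R <= (s - a) / h * (2 ^ n)%:R by rewrite truncn_le.
have j2 : (s - a) / h * (2 ^ n)%:R < j%:R + 1 by rewrite natr1 truncnS_gt.
have jn : (j <= 2 ^ n)%N.
  rewrite -(ler_nat R); apply: le_trans j1 _; rewrite ger_pMl// ler_pdivrMr// mul1r; lra.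
have := fD n j jn; rewrite leNgt => /negP; apply; apply: He.
rewrite /ball /=.
have -> : s - (a + h * (j%:R / (2 ^ n)%:R)) =
  h / (2 ^ n)%:R * ((s - a) / h * (2 ^ n)%:R - j%:R).
  by field; rewrite !gt_eqF.
rewrite ger0_norm; last by rewrite mulr_ge0 ?subr_ge0// divr_ge0// ltW.
apply: le_lt_trans hn; rewrite ger_pMr ?divr_gt0//; lra.
Qed.

End exponential_moments.

(** * The initial law *)

(** Compares the simple functions below the integrands, so it applies to [target_weight], whose
    measurability is not established. *)
Lemma ge0_le_integralT (disp : measure_display) (T : measurableType disp) (R : realType)
    (mu : {measure set T -> \bar R}) (f g : T -> \bar R) :
  (forall x, 0 <= f x)%E -> (forall x, f x <= g x)%E ->
  (\int[mu]_x f x <= \int[mu]_x g x)%E.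
Proof.
move=> f0 fg; have g0 x : (0 <= g x)%E := le_trans (f0 x) (fg x).
rewrite !ge0_integralTE//; apply: ge_ereal_sup => _ [h hf <-].
by apply: ereal_sup_ubound; exists h => // x; exact: le_trans (hf x) (fg x).
Qed.

Section gaussian.
Context {R : realType}.
Local Notation T := (measurableTypeR R).

Lemma gaussian_integral_finite (c : R) : 0 < c ->
  exists K : R, 0 <= K /\ (\int[@lebesgue_measure R]_x (expR (- (c * x ^+ 2)))%:E = K%:E)%E.
Proof.
move=> c0; pose s := Num.sqrt (2 * c)^-1.
have s2 : s ^+ 2 = (2 * c)^-1 by rewrite sqr_sqrtr// invr_ge0 mulr_ge0// ltW.
have s0 : s != 0 by rewrite gt_eqF// sqrtr_gt0 invr_gt0 mulr_gt0.
exists (normal_peak s)^-1; split; first by rewrite invr_ge0 normal_peak_ge0.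
have E x : (expR (- (c * x ^+ 2)))%:E = ((normal_peak s)^-1%:E * (normal_pdf 0 s x)%:E)%E.
  rewrite normal_pdfE// -EFinM mulKf ?gt_eqF ?normal_peak_gt0//.
  rewrite /normal_fun subr0 s2 -[_ *+ 2]mulr_natl; congr (expR _)%:E.
  by field; rewrite gt_eqF.
under eq_integral do rewrite E.
rewrite ge0_integralZl//.
- by rewrite integral_normal_pdf mule1.
- exact: (measurable_EFinP _ _).2 (measurable_normal_pdf 0 s).
- by move=> x _; rewrite lee_fin normal_pdf_ge0.
- by rewrite lee_fin invr_ge0 normal_peak_ge0.
Qed.

Definition sqnorm_tuple n (t : n.-tuple T) : R := \sum_(i < n) (tnth t i : R) ^+ 2.

Lemma measurable_sqnorm_tuple n : measurable_fun setT (@sqnorm_tuple n).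
Proof.
apply: measurable_sum => i.
apply: measurable_funX; exact: measurable_tnth.
Qed.

Lemma measurable_gaussian_tuple n c :
  measurable_fun setT (fun t : n.-tuple T => (expR (- (c * sqnorm_tuple t)))%:E).
Proof.
apply/measurable_EFinP; apply: measurableT_comp => //; apply: measurableT_comp => //.
by apply: measurable_funM => //; exact: measurable_sqnorm_tuple.
Qed.

Lemma gaussian_tuple_finite (c : R) n : 0 < c ->
  exists K : R, 0 <= K /\ (\int[@leb_tuple R n]_t (expR (- (c * sqnorm_tuple t)))%:E = K%:E)%E.
Proof.
move=> c0; elim: n => [|n [K [K0 IH]]].
  exists (expR (- (c * sqnorm_tuple [tuple]))); split; first exact: expR_ge0.
  rewrite /= integral_dirac//; last exact: measurable_gaussian_tuple.
  by rewrite diracE in_setT mul1e.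
have [K1 [K10 E1]] := gaussian_integral_finite c0.
exists (K1 * K); split; first exact: mulr_ge0.
have mt := @measurable_tcons R n.
have m1 : measurable_fun [set: R] (fun x : R => (expR (- (c * x ^+ 2)))%:E).
  apply/measurable_EFinP; apply: measurableT_comp => //; apply: measurableT_comp => //.
  by apply: measurable_funM => //; exact: measurable_funX.
rewrite /= (@eq_measure_integral _ _ _ setT
  (pushforward (@lebesgue_measure R \x @leb_tuple R n)%E (@tcons R n)))//.
rewrite ge0_integral_pushforward//=; last exact: measurable_gaussian_tuple.
rewrite preimage_setT.
have E z : ((expR (- (c * sqnorm_tuple (@tcons R n z))))%:E
   = (expR (- (c * z.1 ^+ 2)))%:E * (expR (- (c * sqnorm_tuple z.2)))%:E)%E.
  rewrite /= -EFinM -expRD; congr (expR _)%:E.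
  rewrite /sqnorm_tuple big_ord_recl mulrDr opprD; congr (- (_ * _ ^+ 2) - _ * _).
  by apply: eq_bigr => i _; rewrite !(tnth_nth 0).
under eq_integral do rewrite E.
rewrite fubini_tonelli1; last 2 first.
- apply: emeasurable_funM.
    apply: (@measurableT_comp _ _ _ _ _ _ (fun x : T => (expR (- (c * x ^+ 2)))%:E) _ fst).
      exact: m1.
    exact: measurable_fst.
  apply: (@measurableT_comp _ _ _ _ _ _
    (fun t : n.-tuple T => (expR (- (c * sqnorm_tuple t)))%:E) _ snd).
    exact: measurable_gaussian_tuple.
  exact: measurable_snd.
- by move=> z; rewrite mule_ge0// lee_fin expR_ge0.
rewrite /fubini_F /=.
under eq_integral => x _.
  rewrite (@ge0_integralZl_EFin _ _ _ _ _ measurableT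
    (fun t : n.-tuple T => (expR (- (c * sqnorm_tuple t)))%:E)) ?expR_ge0//; last first.
    exact: measurable_gaussian_tuple.
  rewrite IH muleC; over.
rewrite ge0_integralZl_EFin//.
by rewrite E1 -EFinM mulrC.
Qed.

End gaussian.

Section initial_law.
Context {R : realType} (d : nat).
Variables (beta lambda : R) (G : 'rV[R]_d -> R).
Hypotheses (beta_gt0 : 0 < beta) (lambda_gt0 : 0 < lambda).

Definition sqnorm_phase (z : phase_point R d) : R :=
  sqnorm_tuple z.1 + sqnorm_tuple z.2.

Lemma measurable_sqnorm_phase : measurable_fun setT sqnorm_phase.
Proof.
apply: measurable_funD; apply: measurableT_comp; try exact: measurable_sqnorm_tuple.
- exact: measurable_fst.
- exact: measurable_snd.
Qed.

Lemma gaussian_phase_finite (c : R) : 0 < c -> exists K : R, 0 <= K /\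
  (\int[@leb_tuple R d \x @leb_tuple R d]_z (expR (- (c * sqnorm_phase z)))%:E = K%:E)%E.
Proof.
move=> c0; have [K [K0 E]] := @gaussian_tuple_finite R c d c0.
exists (K * K); split; first exact: mulr_ge0.
have F z : ((expR (- (c * sqnorm_phase z)))%:E = (expR (- (c * sqnorm_tuple z.1)))%:E *
    (expR (- (c * sqnorm_tuple z.2)))%:E)%E.
  by rewrite -EFinM -expRD; congr (expR _)%:E; rewrite /sqnorm_phase; ring.
under eq_integral do rewrite F.
have mg := @measurable_gaussian_tuple R d c.
rewrite fubini_tonelli1; last 2 first.
- apply: emeasurable_funM.
    apply: (@measurableT_comp _ _ _ _ _ _
      (fun t : d.-tuple (measurableTypeR R) => (expR (- (c * sqnorm_tuple t)))%:E) _ fst mg).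
    exact: measurable_fst.
  apply: (@measurableT_comp _ _ _ _ _ _
    (fun t : d.-tuple (measurableTypeR R) => (expR (- (c * sqnorm_tuple t)))%:E) _ snd mg).
  exact: measurable_snd.
- by move=> z; rewrite mule_ge0// lee_fin expR_ge0.
rewrite /fubini_F /=.
under eq_integral => x _.
  rewrite (@ge0_integralZl_EFin _ _ _ _ _ measurableT
    (fun t : d.-tuple (measurableTypeR R) => (expR (- (c * sqnorm_tuple t)))%:E)) ?expR_ge0//.
  rewrite E muleC; over.
by rewrite ge0_integralZl_EFin// E.
Qed.

(** The Gaussian exponent is [2 * g] with [g = beta * lambda / 4]. One [g] absorbs the product of
    the [u_i], through [x <= g x^2 + 1 / (4 g) <= exp (g x^2 + 1 / (4 g))]; the other one
    remains. *)
Lemma target_weight_le m : (forall x, m <= G x) -> exists C : R, 0 < C /\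
  forall z, phase_space z -> target_weight beta lambda G z
    <= C * expR (- (beta * lambda / 4 * sqnorm_phase z)).
Proof.
move=> Gm; pose g := beta * lambda / 4.
have g0 : 0 < g by rewrite divr_gt0// mulr_gt0.
exists (expR (d%:R / (4 * g) - beta * m)); split; first exact: expR_gt0.
move=> z pz; rewrite /target_weight -/g.
set u := vec_of_tuple z.1; set v := vec_of_tuple z.2.
have qE : enorm (row_mx u v) ^+ 2 = sqnorm_phase z.
  rewrite sqr_sqrtr ?sumr_ge0// => [|i _]; last exact: sqr_ge0.
  rewrite big_split_ord /sqnorm_phase /sqnorm_tuple; congr (_ + _); apply: eq_bigr => i _.
    by rewrite row_mxEl mxE.
  by rewrite row_mxEr mxE.
rewrite qE.
have prod_le : \prod_(i < d) u 0 i <= expR (g * sqnorm_tuple z.1 + d%:R / (4 * g)).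
  have -> : g * sqnorm_tuple z.1 + d%:R / (4 * g) =
      \sum_(i < d) (g * (tnth z.1 i : R) ^+ 2 + (4 * g)^-1).
    by rewrite big_split /= -mulr_sumr sumr_const card_ord -[(4 * g)^-1 *+ d]mulr_natl.
  rewrite expR_sum; apply: ler_prod => i _; rewrite ltW ?(pz i)//= mxE.
  set x := tnth z.1 i : R.
  have : x <= g * x ^+ 2 + (4 * g)^-1.
    rewrite -subr_ge0.
    have -> : g * x ^+ 2 + (4 * g)^-1 - x = (2 * g * x - 1) ^+ 2 / (4 * g).
      by field; rewrite gt_eqF.
    by rewrite divr_ge0 ?sqr_ge0// mulr_ge0// ltW.
  move=> xg; apply: le_trans (expR_ge1Dx _); lra.
apply: le_trans (ler_wpM2r (expR_ge0 _) prod_le) _.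
rewrite -!expRD ler_expR.
have := ler_wpM2l (ltW beta_gt0) (Gm (odot u v)).
have q2 : 0 <= g * sqnorm_tuple z.2.
  by rewrite mulr_ge0 ?(ltW g0)// sumr_ge0// => i _; exact: sqr_ge0.
move: q2; rewrite /g /sqnorm_phase; lra.
Qed.

Variables (target rho0 : probability (phase_point R d) R).

Lemma dominated_by_target :
  rho0 `<< target ->
  (exists M : R,
    {ae target, forall z, ('d (charge_of_finite_measure rho0) '/d target z <= M%:E)%E}) ->
  exists M : R, 0 <= M /\ forall A, measurable A -> (rho0 A <= M%:E * target A)%E.
Proof.
move=> ac [M HM]; exists `|M|; split=> // A mA.
have := @Radon_Nikodym_integral _ _ R (charge_of_finite_measure rho0) target A ac mA.
move=> RN; change (charge_of_finite_measure rho0 A <= `|M|%:E * target A)%E; rewrite RN.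
set f := Radon_Nikodym _ _ in HM *.
have mf : measurable_fun setT f.
  by apply: (@measurable_int _ _ _ target); exact: Radon_Nikodym_integrable.
rewrite integralE; apply: (@le_trans _ _ (\int[target]_(x in A) f^\+ x)%E).
  by rewrite -[leRHS]sube0; apply: leeB => //; apply: integral_ge0.
rewrite -integral_cst//; apply: ae_ge0_le_integral => //.
  apply: measurable_funTS; exact: measurable_funepos.
  by move=> z _; rewrite lee_fin.
move: HM; apply: filterS => z fz _; rewrite funeposE /= ge_max lee_fin normr_ge0 andbT.
by apply: le_trans fz _; rewrite lee_fin ler_norm.
Qed.

(** Chernoff bound: half of the exponent [g] keeps the weight integrable, and the other half is at
    most [exp (- 2 n)] where [g / 4 * |z|^2 > n]. Normalisation and density bound only contribute
    constants. *)
Lemma initial_tail (HG : exists m : R, forall x, m <= G x) :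
  is_target beta lambda G target -> rho0 `<< target ->
  (exists M : R,
    {ae target, forall z, ('d (charge_of_finite_measure rho0) '/d target z <= M%:E)%E}) ->
  exists c K : R, [/\ 0 < c, 0 <= K & forall n : nat,
    (rho0 [set z | (n%:R < c * sqnorm_phase z)%R] <= (K * expR (- (2 * n%:R)))%:E)%E].
Proof.
move=> [Z [Z0 HZ]] ac bd.
have [m Gm] := HG.
have [M [M0 HM]] := dominated_by_target ac bd.
have [C [C0 HC]] := target_weight_le Gm.
pose g := beta * lambda / 4.
have g0 : 0 < g by rewrite divr_gt0// mulr_gt0.
have [K [K0 EK]] := @gaussian_phase_finite (g / 2) (divr_gt0 g0 (ltr0n _ 2)).
exists (g / 4), (M * (Z^-1 * (C * K))); split.
- by rewrite divr_gt0.
- by rewrite !mulr_ge0 ?invr_ge0 ?(ltW Z0) ?(ltW C0).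
have g40 : 0 < g / 4 by rewrite divr_gt0.
move=> n; set A := [set z | _].
have mA : measurable A.
  rewrite (_ : A = sqnorm_phase @^-1` `](n%:R / (g / 4)), +oo[%classic).
    by rewrite -[X in measurable X]setTI; exact: measurable_sqnorm_phase.
  by apply/seteqP; split => z; rewrite /A /= in_itv /= andbT ltr_pdivrMr// (mulrC (sqnorm_phase z)).
apply: le_trans (HM A mA) _; rewrite -mulrA EFinM; apply: lee_wpmul2l.
  by rewrite lee_fin.
rewrite HZ// -mulrA EFinM; apply: lee_wpmul2l; first by rewrite lee_fin invr_ge0 ltW.
rewrite integral_mkcond.
pose D := C * expR (- (2 * n%:R)).
have D0 : 0 <= D by rewrite mulr_ge0 ?(ltW C0)// expR_ge0.
have mq : measurable_fun setT (fun z => (expR (- (g / 2 * sqnorm_phase z)))%:E).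
  apply/measurable_EFinP; apply: measurableT_comp => //.
  apply: measurableT_comp => //.
  by apply: measurable_funM; [exact: measurable_cst|exact: measurable_sqnorm_phase].
have -> : (C * K * expR (- (2 * n%:R)))%:E =
  (\int[@leb_tuple R d \x @leb_tuple R d]_z (D%:E * (expR (- (g / 2 * sqnorm_phase z)))%:E))%E.
  rewrite ge0_integralZl_EFin//.
  by rewrite EK -EFinM; congr EFin; rewrite /D; ring.
apply: ge0_le_integralT => z.
  apply: erestrict_ge0 => {}z [_ pz]; rewrite lee_fin mulr_ge0 ?expR_ge0// prodr_ge0//.
  by move=> i _; apply/ltW/pz.
rewrite /patch; case: ifPn => [|_]; last by rewrite -EFinM lee_fin mulr_ge0// expR_ge0.
rewrite inE => -[Az pz]; rewrite -EFinM lee_fin; apply: le_trans (HC z pz) _.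
rewrite /D -[leRHS]mulrA ler_pM2l// -expRD ler_expR -/g.
move: Az; rewrite /A /=; lra.
Qed.

End initial_law.

(** * Strong error bounds *)

Section elementary.
Context {R : realType}.
Implicit Types (T dt C q s y r Q E : R).

(** In this lemma and the next two, [h] is [Num.sqrt dt], [q] the rate, [y] the root of the path
    size [s], [r] that of [1 + Q] with [Q] the oscillation functional. Here [E] is the random
    exponential factor: the product is split so that [E ^+ 2] stands alone and only its mean is
    needed. *)
Lemma rate_am_gm C q dt h s y r Q E : 0 <= C -> 0 <= q -> h <= q -> dt <= q ->
  0 <= y -> y ^+ 2 = s -> 0 <= r -> r ^+ 2 = 1 + Q -> 0 <= E ->
  C * (h + q * r + dt * y) * E <= C * q * (3 + 2 * (Q + s) + E ^+ 2).
Proof.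
move=> C0 q0 hq dq y0 ys r0 rQ E0; rewrite -!mulrA ler_wpM2l//.
have dy : dt * y <= q * y by rewrite ler_wpM2r.
apply: (@le_trans _ _ (q * (1 + r + y) * E)).
  by rewrite ler_wpM2r//; lra.
rewrite -mulrA ler_wpM2l//.
have : 0 <= (1 + r + y - E) ^+ 2 by exact: sqr_ge0.
have : 0 <= (r - 1) ^+ 2 by exact: sqr_ge0.
have : 0 <= (y - 1) ^+ 2 by exact: sqr_ge0.
have : 0 <= (r - y) ^+ 2 by exact: sqr_ge0.
have : 0 <= E ^+ 2 by exact: sqr_ge0.
nra.
Qed.

Lemma rate_fixed C q dt h s y r Q E : 0 <= C -> 0 <= q -> h <= q -> dt <= q ->
  0 <= y -> y ^+ 2 = s -> 1 <= s -> 0 <= r -> r ^+ 2 = 1 + Q -> 0 <= Q -> 0 <= E ->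
  C * (h + q * r + dt * y) * E <= C * q * E * (2 + Q + s).
Proof.
move=> C0 q0 hq dq y0 ys s1 r0 rQ Q0 E0.
have -> : C * q * E * (2 + Q + s) = C * (q * (2 + Q + s)) * E by ring.
rewrite ler_wpM2r// ler_wpM2l//.
have dy : dt * y <= q * y by rewrite ler_wpM2r.
have : y <= s by nra.
have : r <= 1 + Q by nra.
nra.
Qed.

Lemma rate_coarse C T q dt h s y r Q : 0 <= C -> 0 <= T -> 0 <= q -> h <= 1 + T ->
  q <= 1 + T -> 0 <= dt -> dt <= T ->
  0 <= y -> y ^+ 2 = s -> 1 <= s -> 0 <= r -> r ^+ 2 = 1 + Q -> 0 <= Q ->
  C * (y + (h + q * r + dt * y)) <= C * (1 + T) * (2 + Q + s).
Proof.
move=> C0 T0 q0 hT qT dt0 dT y0 ys s1 r0 rQ Q0; rewrite -mulrA ler_wpM2l//.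
have dy : dt * y <= T * y by rewrite ler_wpM2r.
have ys' : (1 + T) * y <= (1 + T) * s by rewrite ler_wpM2l ?addr_ge0//; nra.
have rq : q * r <= (1 + T) * (1 + Q) by apply: ler_pM => //; nra.
lra.
Qed.

Lemma sqrt_le_exp (x : R) : 0 <= x -> Num.sqrt x <= expR x.
Proof.
move=> x0; have y0 := sqrtr_ge0 x.
have : 1 + x <= expR x by exact: expR_ge1Dx.
have := sqr_sqrtr x0; nra.
Qed.

Lemma affine_mul_le a k l T : 0 <= a -> k <= l -> 0 <= l -> 0 <= T ->
  a + k * T <= (a + l) * (1 + T).
Proof. by move=> a0 kl l0 T0; have := ler_wpM2r T0 kl; have := mulr_ge0 a0 T0; lra. Qed.

Lemma weight_le_small A e s x Q mw : 0 <= A -> 0 <= e -> s <= A * 2 * mw -> x <= e * mw ->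
  0 <= Q -> 1 <= mw -> 3 + 2 * (Q + s) + x <= (5 + 4 * A + e) * (mw + Q).
Proof.
by move=> A0 e0 sA xe Q0 mw1; have := mulr_ge0 A0 Q0; have := mulr_ge0 e0 Q0; lra.
Qed.

Lemma weight_le A T s Q mw : 0 <= A -> 0 <= T -> s <= A * (1 + T) * mw -> 0 <= Q -> 1 <= mw ->
  2 + Q + s <= (2 + A) * (1 + T) * (mw + Q).
Proof.
move=> A0 T0 sA Q0 mw1; have mw0 : 0 <= mw by lra.
have := mulr_ge0 T0 mw0; have := mulr_ge0 T0 Q0; have := mulr_ge0 A0 Q0.
have := mulr_ge0 A0 (mulr_ge0 T0 Q0); lra.
Qed.

Lemma sqrt_le_affine dt T : 0 <= dt -> dt <= T -> Num.sqrt dt <= 1 + T.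
Proof. by move=> dt0 dtT; have := sqr_sqrtr dt0; have := sqrtr_ge0 dt; nra. Qed.

Lemma exponent_le C D rho : 0 <= C -> C + 3 <= D -> 0 <= rho ->
  [/\ 1 <= D * (1 + rho), C * rho + 2 <= D * (1 + rho) & C + 3 <= D * (1 + rho)].
Proof.
move=> C0 CD r0; have CD' : C <= D by lra.
have D0 : 0 <= D by lra.
by have := ler_wpM2r r0 CD'; have := mulr_ge0 D0 r0; split; lra.
Qed.

Lemma double_shift (x r : R) : r <= x -> x <= - r + 2 * x.
Proof. lra. Qed.

Lemma theta_scale (m th c a b : R) : th * (2 * m) <= c * a -> c * a <= c * b -> m * (2 * th) <= c * b.
Proof. lra. Qed.

Lemma powern_le_exp n (x : R) : (0 < n)%N -> 0 <= x -> x ^+ n <= n%:R ^+ n * expR x.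
Proof.
move=> n0 x0; have nR : 0 < n%:R :> R by rewrite ltr0n.
have -> : expR x = expR (x / n%:R) ^+ n by rewrite -expRM_natl mulrC divfK ?gt_eqF.
rewrite -exprMn; apply: lerXn2r; rewrite ?nnegrE ?mulr_ge0 ?expR_ge0//.
rewrite -ler_pdivrMl// mulrC; apply: le_trans (expR_ge1Dx _); lra.
Qed.

(** Each of the [#|J|.+1] summands is at most [ln L / m], so together they are at most [ln L]. The
    bound is pointwise: moments of the sum reduce to marginal ones. *)
Lemma exp_sum_le (J : finType) (a : R) (b : J -> R) : 
  expR (a + \sum_j b j) <= expR (#|J|.+1%:R * a) + \sum_j expR (#|J|.+1%:R * b j).
Proof.
set m := #|J|.+1%:R; set L := (X in _ <= X).
have sum0 (A : pred J) : 0 <= \sum_(j | A j) expR (m * b j).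
  by apply: sumr_ge0 => j _; exact: expR_ge0.
have L0 : 0 < L by rewrite ltr_wpDr ?expR_gt0.
have m0 : 0 < m by rewrite ltr0n.
have aL : a <= ln L / m.
  rewrite ler_pdivlMr// mulrC -[leLHS]expRK ler_ln ?posrE ?expR_gt0//.
  by rewrite lerDl.
have bL j : b j <= ln L / m.
  rewrite ler_pdivlMr// mulrC -[leLHS]expRK ler_ln ?posrE ?expR_gt0//.
  rewrite /L (bigD1 j)//= addrCA lerDl addr_ge0 ?expR_ge0//.
rewrite -[leRHS](@lnK R) ?posrE// ler_expR.
have -> : ln L = ln L / m + \sum_(j : J) ln L / m.
  rewrite sumr_const -[X in _ + X]mulr_natl -{1}[ln L / m]mul1r -mulrDl nat1r -/m.
  by rewrite mulrC divfK// gt_eqF.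
by apply: lerD => //; apply: ler_sum.
Qed.

(** Applied to a squared oscillation [x] and a squared rate [q]: a single term of weight [dt] in a
    sum of [n]-th powers yields [(x / q) ^+ n <= Q]. *)
Lemma power_step_le n (x q Q dt : R) : (0 < n)%N -> 0 < dt -> 0 < q -> 0 <= x ->
  q ^+ n * dt = dt ^+ n -> dt * (x / dt) ^+ n <= Q -> x <= q * (1 + Q).
Proof.
move=> n0 dt0 q0 x0 qE xQ.
have y0 : 0 <= x / q by rewrite divr_ge0// ltW.
have yn : (x / q) ^+ n <= Q.
  apply: le_trans xQ; rewrite !expr_div_n -qE invfM !mulrA mulrAC.
  by rewrite (mulrC dt) mulfK// gt_eqF.
rewrite -ler_pdivrMl// mulrC.
have [y1|y1] := leP (x / q) 1.
  by apply: le_trans y1 _; rewrite lerDl; apply: le_trans yn; exact: exprn_ge0.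
have : x / q <= (x / q) ^+ n by rewrite -[leLHS]expr1 ler_weXn2l// ltW.
lra.
Qed.

End elementary.

(** * Bounds on expectations *)

Section mean.
Context {R : realType} {disp : measure_display} {Omega : measurableType disp}.
Variable P : probability Omega R.
Implicit Types (f g : Omega -> R) (b c k : R).

Record mean_le (f : Omega -> R) (b : R) : Prop := {
  mean_le_measurable : measurable_fun setT f ;
  mean_le_ge0 : forall w, 0 <= f w ;
  mean_le_integral : (\int[P]_w (f w)%:E <= b%:E)%E }.

Lemma mean_le_cst b : 0 <= b -> mean_le (fun=> b) b.
Proof.
move=> b0; split=> //.
rewrite (@integral_cst _ _ _ P setT measurableT b%:E).
by rewrite (_ : _ setT = 1%E) ?mule1//; exact: probability_setT.
Qed.

Lemma mean_le_bound_ge0 f b : mean_le f b -> 0 <= b.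
Proof.
move=> [_ f0 fb]; rewrite -lee_fin; apply: le_trans fb.
by apply: integral_ge0 => w _; rewrite lee_fin.
Qed.

Lemma mean_leD f g b c : mean_le f b -> mean_le g c -> mean_le (fun w => f w + g w) (b + c).
Proof.
move=> [mf f0 fb] [mg g0 gc]; split; first exact: measurable_funD.
  by move=> w; exact: addr_ge0.
under eq_integral do rewrite EFinD.
rewrite ge0_integralD//.
- by rewrite EFinD; exact: leeD.
- by move=> w _; rewrite lee_fin.
- exact/measurable_EFinP.
- by move=> w _; rewrite lee_fin.
- exact/measurable_EFinP.
Qed.

Lemma mean_leZ k f b : 0 <= k -> mean_le f b -> mean_le (fun w => k * f w) (k * b).
Proof.
move=> k0 [mf f0 fb]; split; first exact: measurable_funM.
  by move=> w; exact: mulr_ge0.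
under eq_integral do rewrite EFinM.
rewrite (@ge0_integralZl_EFin _ _ _ P setT measurableT (fun w => (f w)%:E))//; last 2 first.
  by move=> w _; rewrite lee_fin.
  exact/measurable_EFinP.
by rewrite EFinM; exact: lee_wpmul2l.
Qed.

Lemma mean_le_sum (J : finType) (f : J -> Omega -> R) b :
  (forall j, mean_le (f j) b) -> mean_le (fun w => \sum_j f j w) (#|J|%:R * b).
Proof.
move=> fb; rewrite mulr_natl -sumr_const.
have H (s : seq J) : mean_le (fun w => \sum_(j <- s) f j w) (\sum_(j <- s) b).
  elim: s => [|j s IH].
    rewrite big_nil (_ : (fun w => _) = fun=> 0); first exact: mean_le_cst.
    by apply/funext => w; rewrite big_nil.
  rewrite big_cons (_ : (fun w => _) = fun w => f j w + \sum_(j <- s) f j w).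
    exact: mean_leD.
  by apply/funext => w; rewrite big_cons.
exact: H.
Qed.

Lemma mean_le_weaken f b c : b <= c -> mean_le f b -> mean_le f c.
Proof. by move=> bc [mf f0 fb]; split=> //; apply: le_trans fb _; rewrite lee_fin. Qed.

Lemma mean_le_dominated f g b : measurable_fun setT f -> (forall w, 0 <= f w <= g w) ->
  mean_le g b -> mean_le f b.
Proof.
move=> mf fg [mg g0 gb]; split=> //; first by move=> w; case/andP: (fg w).
apply: le_trans gb; apply: ge0_le_integralT => w; rewrite lee_fin; by case/andP: (fg w).
Qed.

End mean.

Lemma ae_mono (R : realType) (disp : measure_display) (T : measurableType disp)
    (mu : {measure set T -> \bar R}) (A B : T -> Prop) :
  {ae mu, forall w, A w} -> (forall w, A w -> B w) -> {ae mu, forall w, B w}.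
Proof. by move=> mA AB; move: mA; apply: filterS. Qed.

Lemma ae_and (R : realType) (disp : measure_display) (T : measurableType disp)
    (mu : {measure set T -> \bar R}) (A B : T -> Prop) :
  {ae mu, forall w, A w} -> {ae mu, forall w, B w} -> {ae mu, forall w, A w /\ B w}.
Proof. by move=> mA mB; apply: filterI. Qed.

(** * The three regimes of the mean error *)

Section strong_error.
Context {R : realType} (d : nat) (beta lambda : R).
Hypotheses (beta_gt0 : 0 < beta) (lambda_gt0 : 0 < lambda).
Variables (G : 'rV[R]_d -> R) (HG : potential_assumptions G).
Context {disp : measure_display} {Omega : measurableType disp}.
Variables (P : probability Omega R) (W1 W2 : R -> Omega -> 'rV[R]_d).
Hypotheses (HW1 : standard_brownian_vec P W1) (HW2 : standard_brownian_vec P W2).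
Variables (u v : R -> Omega -> 'rV[R]_d).
Hypothesis Huv : sde_solution P beta lambda G W1 W2 u v.
Variables (U V : R -> nat -> Omega -> 'rV[R]_d).
Hypothesis HUV : forall dt, 0 < dt ->
  scheme_solution P beta lambda G W1 W2 dt (U dt) (V dt).
Hypothesis Hinit : forall dt, 0 < dt ->
  {ae P, forall w, U dt 0%N w = u 0 w /\ V dt 0%N w = v 0 w}.

Definition noise (p : bool * 'I_d) (t : R) (w : Omega) : R :=
  pairing (W1 t w) (W2 t w) p.

Lemma noise_brownian p : standard_brownian P (noise p).
Proof. by case: p => -[] i; [exact: (HW2.1 i)|exact: (HW1.1 i)]. Qed.

Definition start_sq (w : Omega) : R := \sum_p pairing (u 0 w) (v 0 w) p ^+ 2.

Definition noise_sup (T : R) (p : bool * 'I_d) (w : Omega) : R :=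
  increment_sup (noise p) 0 T w.

Definition path_size (T : R) (w : Omega) : R :=
  1 + start_sq w + \sum_p noise_sup T p w ^+ 2.

Lemma start_sq_ge0 w : 0 <= start_sq w.
Proof. by apply: sumr_ge0 => p _; exact: sqr_ge0. Qed.

Lemma noise_sup_sum_ge0 T w : 0 <= \sum_p noise_sup T p w ^+ 2.
Proof. by apply: sumr_ge0 => p _; exact: sqr_ge0. Qed.

Lemma path_size_ge1 T w : 1 <= path_size T w.
Proof.
by have := start_sq_ge0 w; have := noise_sup_sum_ge0 T w; rewrite /path_size; lra.
Qed.

Lemma enorm_row_mx_le (x y : 'rV[R]_d) e : (forall p, `|pairing x y p| <= e) ->
  enorm (row_mx x y) <= (d + d)%:R * e.
Proof.
move=> xye; apply: enorm_le => i; case: (split_ordP i) => j ->.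
  by rewrite row_mxEl; exact: (xye (false, j)).
by rewrite row_mxEr; exact: (xye (true, j)).
Qed.

Definition error_le (T dt e : R) (w : Omega) : Prop :=
  forall k : nat, k%:R * dt <= T -> enorm (scheme_error u v dt (U dt) (V dt) k w) <= e.

(** Collects the null sets. The a priori bound of the path needs the schemes of all steps
    [T / n.+1], which are countably many, so a common null set exists. *)
Lemma scheme_error_le : exists C dt0, [/\ 1 <= C, 0 < dt0, dt0 <= 1 &
  forall T dt, 0 < T -> 0 < dt -> {ae P, forall w,
    let s := path_size T w in
    (dt <= dt0 -> error_le T dt (C * Num.sqrt s) w) /\
    (forall o, 0 <= o ->
      (forall k p, k.+1%:R * dt <= T -> increment_sup (noise p) (k%:R * dt) dt w <= o) ->
      error_le T dt (C * (Num.sqrt dt + o + dt * Num.sqrt s) * expR (C * s * T)) w /\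
      error_le T dt (C * (Num.sqrt s + (Num.sqrt dt + o + dt * Num.sqrt s)) * expR (C * T)) w)}].
Proof.
have [B [K [L [B0 L0 diss grow [lin lip]]]]] := cross_field_properties HG.
have a0 (p : bool * 'I_d) : 0 <= singular beta p.
  by rewrite /singular; case: ifP => // _; rewrite invr_ge0 ltW.
have [C [dt0 [C1 dt00 dt01 HC]]] := path_error lambda_gt0 a0 B0 L0 diss grow lin lip.
pose sg := Num.sqrt (2 / beta).
have sg0 : 0 <= sg by exact: sqrtr_ge0.
(* Absorbs the noise intensity, which enters linearly through oscillations and quadratically through
   the path size. *)
pose al := 1 + sg + sg ^+ 2.
have al1 : 1 <= al by rewrite /al -addrA lerDl addr_ge0// exprn_ge0.
have sgal : sg <= al by rewrite /al addrAC lerDr addr_ge0// exprn_ge0.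
have sg2al : sg ^+ 2 <= al by rewrite /al lerDr addr_ge0.
have al0 : 0 <= al := le_trans ler01 al1.
have C0 : 0 <= C := le_trans ler01 C1.
pose D := 1 + (d + d)%:R : R.
have D1 : 1 <= D by rewrite lerDl.
have D0 : 0 <= D := le_trans ler01 D1.
have ACa : C * al <= D * (C * al) by rewrite ler_peMl// mulr_ge0.
have AC : C <= D * (C * al) by apply: le_trans ACa; rewrite ler_peMr.
have A1 : 1 <= D * (C * al) := le_trans C1 AC.
have A0 := le_trans ler01 A1.
exists (D * (C * al)), dt0; split=> // T dt T0 dtgt0.
have h1 := sde_continuous Huv.
have h2 := sde_positive Huv.
have h3 := sde_u Huv.
have h4 := sde_v Huv.
have h5 : {ae P, forall w, forall p, noise p 0 w = 0}.
  apply: (@filter_forall _ _ (fun p w => noise p 0 w = 0) (almost_everywhere P)) => p.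
  exact: bm_start (noise_brownian p).
have h6 : {ae P, forall w, forall p, {within `[0, +oo[%classic, continuous (fun t => noise p t w)}}.
  apply: (@filter_forall _ _ (fun p w => {within `[0, +oo[%classic, continuous (fun t => noise p t w)})
    (almost_everywhere P)) => p.
  exact: bm_continuous (noise_brownian p).
(* Positivity of the scheme is given from index [1] on; index [0] inherits it from [u 0], hence the
   premise on [u]. *)
have h7 (h : R) : 0 < h -> {ae P, forall w, (forall t, 0 <= t -> positive_vec (u t w)) ->
    scheme_path lambda (singular beta) (cross_field G) h
      (fun t p => sg * pairing (W1 t w) (W2 t w) p)
      (fun k => pairing (U h k w) (V h k w)) /\
    (U h 0%N w = u 0 w /\ V h 0%N w = v 0 w)}.
  move=> h0; have HS := HUV h0.
  apply: (ae_mono (ae_and (ae_and (scheme_positive HS) (Hinit h0))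
    (ae_and (scheme_u HS) (scheme_v HS)))) => w [[Upos [U0 V0]] [eU eV]] upos; split=> //; split.
    case=> -[] i k; rewrite /singular /= ?ltxx// => _; rewrite /pairing /=.
    by case: k => [|k]; [rewrite U0; exact: upos|exact: Upos].
  case=> -[] i k; rewrite /relax cross_field_pairing /singular /pairing /=.
    have := congr1 (fun X : 'rV_d => X 0 i) (eV k); rewrite !mxE => ->.
    by rewrite /sg; ring.
  have := congr1 (fun X : 'rV_d => X 0 i) (eU k); rewrite !mxE => ->.
  by rewrite /sg; ring.
have h8 : {ae P, forall w, forall n : nat, (forall t, 0 <= t -> positive_vec (u t w)) ->
    scheme_path lambda (singular beta) (cross_field G) (T / n.+1%:R)
      (fun t p => sg * pairing (W1 t w) (W2 t w) p)
      (fun k => pairing (U (T / n.+1%:R) k w) (V (T / n.+1%:R) k w)) /\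
    (U (T / n.+1%:R) 0%N w = u 0 w /\ V (T / n.+1%:R) 0%N w = v 0 w)}.
  by apply/ae_foralln => n; apply: h7; rewrite divr_gt0.
apply: (ae_mono (ae_and (ae_and (ae_and h1 h2) (ae_and h3 h4))
  (ae_and (ae_and h5 h6) (ae_and (h7 dt dtgt0) h8)))) => w
  [[[[cu cv] upos] [eu ev]] [[W0 cW] [/(_ upos)[sdt [U0 V0]] sn]]].
set s := path_size T w.
have s1 : 1 <= s by exact: path_size_ge1.
have s0 : 0 <= s := le_trans ler01 s1.
pose wn t p := sg * pairing (W1 t w) (W2 t w) p.
pose z t := pairing (u (Num.max 0 t) w) (v (Num.max 0 t) w).
pose Z k := pairing (U dt k w) (V dt k w).
have [dz cz] : driven lambda (singular beta) (cross_field G) T wn z /\ forall p, continuous (z ^~ p).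
  exact: (@driven_of_sde R d beta lambda G HG (u ^~ w) (v ^~ w) (W1 ^~ w) (W2 ^~ w) T).
pose NS := \sum_p noise_sup T p w ^+ 2.
have NS0 : 0 <= NS by exact: noise_sup_sum_ge0.
pose M := sg * Num.sqrt NS.
have wM t p : 0 <= t <= T -> `|wn t p| <= M.
  move=> tT; rewrite /wn normrM (ger0_norm sg0) ler_wpM2l//.
  apply: (@le_trans _ _ (noise_sup T p w)).
    have := @increment_sup_bound _ _ _ (noise p) 0 T w t (lexx _) T0 (cW p).
    by rewrite add0r W0 subr0; exact.
  rewrite -[leLHS]ger0_norm ?increment_sup_ge0// -sqrtr_sqr ler_wsqrtr//.
  by rewrite /NS (bigD1 p)//= lerDl sumr_ge0// => q _; exact: sqr_ge0.
have z0 p : z 0 p = pairing (u 0 w) (v 0 w) p by rewrite /z max_l.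
have zZ0 : z 0 =1 Z 0%N by move=> p; rewrite z0 /Z U0 V0.
have zn n : z 0 =1 pairing (U (T / n.+1%:R) 0%N w) (V (T / n.+1%:R) 0%N w).
  by move=> q; have [_ [-> ->]] := sn n upos; rewrite z0.
have size : 1 + \sum_p z 0 p ^+ 2 + M ^+ 2 <= al * s.
  have -> : \sum_p z 0 p ^+ 2 = start_sq w by apply: eq_bigr => p _; rewrite z0.
  rewrite exprMn (sqr_sqrtr NS0) /s /path_size -/NS mulrDr.
  apply: lerD; last exact: ler_wpM2r.
  by rewrite ler_peMl// addr_ge0// start_sq_ge0.
have [e1 e2] := HC T dt wn z Z (fun n k => pairing (U (T / n.+1%:R) k w) (V (T / n.+1%:R) k w))
  M (al * s) T0 dtgt0 dz cz wM sdt zZ0 (fun n => (sn n upos).1) zn size.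
have ss : Num.sqrt (al * s) <= al * Num.sqrt s by exact: sqrt_mul_le.
have norm_le e e' : D * e <= e' -> 0 <= e ->
    (forall k p, k%:R * dt <= T -> `|z (k%:R * dt) p - Z k p| <= e) -> error_le T dt e' w.
  move=> ee' e0 ze k kT; apply: le_trans ee'.
  apply: (@le_trans _ _ ((d + d)%:R * e)); last by rewrite ler_wpM2r// lerDr.
  apply: enorm_row_mx_le => p; apply: le_trans (ze k p kT).
  have kdt : 0 <= k%:R * dt by rewrite mulr_ge0// ltW.
  by rewrite /z max_r// /Z /pairing; case: p => -[] i /=; rewrite !mxE.
split.
  move=> dtB; apply: (norm_le _ _ _ _ (e1 dtB)); last by rewrite mulr_ge0 ?sqrtr_ge0.
  by rewrite -!mulrA; do 2 apply: ler_wpM2l => //.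
move=> o o0 inc.
have wo k r p : k.+1%:R * dt <= T -> k%:R * dt <= r <= k.+1%:R * dt ->
    `|wn r p - wn (k%:R * dt) p| <= sg * o.
  move=> kT rk; rewrite /wn -mulrBr normrM (ger0_norm sg0) ler_wpM2l//.
  apply: le_trans (inc k p kT).
  apply: (@increment_sup_bound _ _ _ (noise p) (k%:R * dt) dt w r) => //.
    by rewrite mulr_ge0// ltW.
  by move: rk; rewrite -natr1 mulrDl mul1r.
have sgo : 0 <= sg * o by rewrite mulr_ge0.
have {e2}H := e2 (sg * o) sgo wo.
have q0 : 0 <= Num.sqrt dt by exact: sqrtr_ge0.
have y0 : 0 <= Num.sqrt s by exact: sqrtr_ge0.
have Y0 : 0 <= Num.sqrt (al * s) by exact: sqrtr_ge0.
have dt0' := ltW dtgt0.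
have F : Num.sqrt dt + sg * o + dt * Num.sqrt (al * s)
    <= al * (Num.sqrt dt + o + dt * Num.sqrt s).
  rewrite [leRHS]mulrDr [X in _ <= X + _]mulrDr; apply: lerD; first by apply: lerD; [rewrite ler_peMl|exact: ler_wpM2r].
  by rewrite mulrCA; exact: ler_wpM2l.
have F0 : 0 <= Num.sqrt dt + sg * o + dt * Num.sqrt (al * s).
  by rewrite !addr_ge0// mulr_ge0.
split.
  apply: (norm_le _ _ _ _ (fun k p kT => (H k p kT).1)); last first.
    by rewrite !mulr_ge0// expR_ge0.
  rewrite [leLHS]mulrA; apply: ler_pM; rewrite ?expR_ge0 ?(mulr_ge0 D0 (mulr_ge0 C0 F0))//.
    by rewrite -!mulrA; do 2 apply: ler_wpM2l => //.
  by rewrite ler_expR ler_wpM2r ?(ltW T0)// mulrA ler_wpM2r.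
apply: (norm_le _ _ _ _ (fun k p kT => (H k p kT).2)); last first.
  by rewrite !mulr_ge0 ?expR_ge0// addr_ge0.
rewrite [leLHS]mulrA; apply: ler_pM;
  rewrite ?expR_ge0 ?(mulr_ge0 D0 (mulr_ge0 C0 (addr_ge0 Y0 F0)))//.
  rewrite -!mulrA; do 2 apply: ler_wpM2l => //.
  by rewrite [leRHS]mulrDr; exact: lerD.
by rewrite ler_expR ler_wpM2r ?(ltW T0).
Qed.

Lemma noise_moment a h p : 0 <= a -> 0 < h ->
  mean_le P (fun w => expR (increment_sup (noise p) a h w ^+ 2 / (32 * h))) exp_moment.
Proof.
move=> a0 h0; split.
- apply: measurableT_comp => //; apply: measurable_funM => //; apply: measurable_funX.
  by apply: measurable_increment_sup (ltW h0) => //; exact: noise_brownian.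
- by move=> w; exact: expR_ge0.
- by apply: increment_sup_exp_moment => //; exact: noise_brownian.
Qed.

(** Stands in for the largest oscillation over a cell. Each normalised term has a mean bounded
    independently of [dt], so the weight [dt] against about [T / dt] cells leaves [O(T)]. *)
Definition grid_power (T dt : R) (n : nat) (w : Omega) : R :=
  dt * \sum_(j < (Num.truncn (T / dt)).+1) \sum_p
    (increment_sup (noise p) (j%:R * dt) dt w ^+ 2 / dt) ^+ n.

Lemma grid_power_moment n : (0 < n)%N -> exists K, forall T dt, 0 < dt -> dt <= T ->
  mean_le P (grid_power T dt n) (K * T).
Proof.
move=> n0; pose c := 32 ^+ n * n%:R ^+ n * exp_moment : R.
have c00 : 0 <= c by rewrite !mulr_ge0// exp_moment_ge0.
(* The factor [2] pays for the additional cell: [dt * (T / dt + 1) <= 2 * T] as [dt <= T]. *)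
exists (2 * (#|{: bool * 'I_d}|%:R * c)) => T dt dt0 dtT.
have cell (j : 'I_(Num.truncn (T / dt)).+1) p :
    mean_le P (fun w => (increment_sup (noise p) (j%:R * dt) dt w ^+ 2 / dt) ^+ n) c.
  have jdt : 0 <= j%:R * dt by rewrite mulr_ge0// ltW.
  apply: mean_le_dominated (mean_leZ _ (noise_moment p jdt dt0)).
  - apply: measurable_funX; apply: measurable_funM => //; apply: measurable_funX.
    by apply: measurable_increment_sup (ltW dt0) => //; exact: noise_brownian.
  - move=> w; set x := increment_sup _ _ _ _ ^+ 2.
    have x0 : 0 <= x by exact: sqr_ge0.
    rewrite exprn_ge0 ?divr_ge0 ?(ltW dt0)//=.
    have -> : x / dt = 32 * (x / (32 * dt)) by field; rewrite gt_eqF.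
    rewrite exprMn -mulrA ler_wpM2l ?exprn_ge0//; apply: powern_le_exp => //.
    by rewrite divr_ge0// mulr_ge0// ltW.
  - by rewrite mulr_ge0.
have := mean_leZ (ltW dt0) (mean_le_sum (fun j => mean_le_sum (cell j))).
apply: mean_le_weaken; rewrite card_ord [leLHS]mulrA [leRHS]mulrAC.
apply: ler_wpM2r; first by rewrite mulr_ge0.
have : (Num.truncn (T / dt))%:R <= T / dt.
  by rewrite truncn_le// divr_ge0// ltW// (lt_le_trans dt0).
rewrite ler_pdivlMr// -natr1; lra.
Qed.

Variables (c0 K0 : R).
Hypotheses (c0_gt0 : 0 < c0) (start_moment : mean_le P (fun w => expR (c0 * start_sq w)) K0).
Local Notation card := (#|{: bool * 'I_d}|).

(** Dominates [path_size] up to a factor, and also its exponentials of small order; being a sum of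
    exponentials, it has a mean controlled by marginal moments. *)
Definition moment_weight (T : R) (w : Omega) : R :=
  1 + expR (c0 * start_sq w) + \sum_p expR (noise_sup T p w ^+ 2 / (32 * T)).

Lemma moment_weight_mean T : 0 < T ->
  mean_le P (moment_weight T) (1 + K0 + card%:R * exp_moment).
Proof.
move=> T0; apply: mean_leD.
  by apply: mean_leD => //; exact: mean_le_cst.
by apply: mean_le_sum => p; exact: noise_moment.
Qed.

Lemma moment_weight_ge1 T w : 1 <= moment_weight T w.
Proof.
rewrite /moment_weight -addrA lerDl addr_ge0 ?expR_ge0// sumr_ge0// => p _.
Qed.

Lemma path_size_le T w : 0 < T ->
  path_size T w <= (1 + c0^-1 + 32) * (1 + T) * moment_weight T w.
Proof.
move=> T0; rewrite /path_size /moment_weight.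
have h1 : start_sq w <= c0^-1 * expR (c0 * start_sq w).
  rewrite ler_pdivlMl//; apply: le_trans (expR_ge1Dx _); lra.
have h2 : \sum_p noise_sup T p w ^+ 2 <=
    32 * T * \sum_p expR (noise_sup T p w ^+ 2 / (32 * T)).
  rewrite mulr_sumr; apply: ler_sum => p _; rewrite -ler_pdivrMl ?mulr_gt0// mulrC.
  apply: le_trans (expR_ge1Dx _); lra.
have a0 := expR_ge0 (c0 * start_sq w).
have b0 : 0 <= \sum_p expR (noise_sup T p w ^+ 2 / (32 * T)).
  by apply: sumr_ge0 => p _; exact: expR_ge0.
have ci : 0 <= c0^-1 by rewrite invr_ge0 ltW.
set a := expR _ in h1 a0 *; set b := \sum_p expR _ in h2 b0 *.
have Ta : 0 <= T * a by rewrite mulr_ge0// ltW.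
have Tb : 0 <= T * b by rewrite mulr_ge0// ltW.
set W := (1 + T) * (1 + a + b).
have Wone : 1 <= W by rewrite /W; lra.
have Wa : a <= W by rewrite /W; lra.
have Wb : T * b <= W by rewrite /W; lra.
have := ler_wpM2l ci Wa; rewrite -mulrA -/W; lra.
Qed.

Lemma exp_path_size_le T x w : 0 < T -> 0 <= x ->
  card.+1%:R * x <= c0 -> card.+1%:R * x <= (32 * T)^-1 ->
  expR (x * path_size T w) <= expR x * moment_weight T w.
Proof.
move=> T0 x0 xc xT; rewrite /path_size -addrA mulrDr mulr1 expRD ler_wpM2l ?expR_ge0//.
have -> : x * (start_sq w + \sum_p noise_sup T p w ^+ 2) =
    x * start_sq w + \sum_p x * noise_sup T p w ^+ 2.
  by rewrite mulrDr; congr (_ + _); exact: mulr_sumr.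
have := exp_sum_le (x * start_sq w) (fun p => x * noise_sup T p w ^+ 2).
move=> /le_trans; apply.
rewrite /moment_weight -addrA; apply: ler_wpDl => //; apply: lerD.
  by rewrite ler_expR mulrA ler_wpM2r// start_sq_ge0.
by apply: ler_sum => p _; rewrite ler_expR mulrA [leRHS]mulrC ler_wpM2r ?sqr_ge0.
Qed.

Definition rate (n : nat) : R := 2^-1 - (2 * n%:R)^-1.

Lemma rate_power n dt : (0 < n)%N -> 0 < dt ->
  ((dt `^ rate n) ^+ 2) ^+ n * dt = dt ^+ n.
Proof.
move=> n0 dt0; have nR : n%:R != 0 :> R by rewrite pnatr_eq0 -lt0n.
rewrite -exprM -powR_mulrn ?powR_ge0// -powRrM.
rewrite -{2}(powRr1 (ltW dt0)) -powRD; last by rewrite (gt_eqF dt0) implybT.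
rewrite -powR_mulrn ?ltW//; congr (_ `^ _); rewrite natrM /rate.
by field.
Qed.

Lemma increment_le_rate T dt n k p w : (0 < n)%N -> 0 < dt -> k.+1%:R * dt <= T ->
  increment_sup (noise p) (k%:R * dt) dt w <=
    dt `^ rate n * Num.sqrt (1 + grid_power T dt n w).
Proof.
move=> n0 dt0 kT; set x := increment_sup _ _ _ _.
have q0 : 0 < dt `^ rate n by exact: powR_gt0.
have cell0 (j : nat) r : 0 <= (increment_sup (noise r) (j%:R * dt) dt w ^+ 2 / dt) ^+ n.
  by rewrite exprn_ge0// divr_ge0 ?sqr_ge0// ltW.
have kJ : (k < (Num.truncn (T / dt)).+1)%N.
  have kT' : k%:R <= T / dt.
    rewrite ler_pdivlMr//; apply: le_trans kT; rewrite ler_wpM2r ?ler_nat//; exact: ltW.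
  have x0 : 0 <= T / dt by apply: le_trans kT'.
  by rewrite ltnS truncn_ge_nat.
have cell : dt * (x ^+ 2 / dt) ^+ n <= grid_power T dt n w.
  rewrite /grid_power ler_wpM2l ?(ltW dt0)//.
  rewrite (bigD1 (Ordinal kJ))//= (bigD1 p)//= -/x -addrA lerDl addr_ge0//.
    by apply: sumr_ge0.
  by apply: sumr_ge0 => j _; apply: sumr_ge0.
have Q0 : 0 <= grid_power T dt n w.
  by apply: le_trans cell; rewrite mulr_ge0 ?exprn_ge0 ?divr_ge0 ?sqr_ge0// ltW.
have := power_step_le n0 dt0 (exprn_gt0 2 q0) (sqr_ge0 x) (rate_power n0 dt0) cell.
rewrite -[X in _ -> X <= _]ger0_norm ?increment_sup_ge0// -sqrtr_sqr => h.
rewrite -[X in _ <= X * _]ger0_norm ?(ltW q0)// -sqrtr_sqr -sqrtrM ?sqr_ge0//.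
exact: ler_wsqrtr.
Qed.

Lemma rate_ge0 n : (1 < n)%N -> 0 <= rate n.
Proof.
move=> n1; rewrite subr_ge0 lef_pV2 ?posrE ?mulr_gt0 ?ltr0n//; last exact: ltnW.
by rewrite ler_peMr// ler1n ltnW.
Qed.

Lemma rate_le n : rate n <= 2^-1.
Proof. by rewrite gerBl invr_ge0 mulr_ge0. Qed.

Lemma mean_error : exists D theta, [/\ 1 <= D, 0 < theta &
  forall n, (1 < n)%N -> exists K, 1 <= K /\ forall rho T dt, 0 <= rho -> 0 < T -> 0 < dt -> dt <= T ->
   exists f, mean_le P f (K * expR (D * (1 + rho) * T) * dt `^ rate n
       + D * Num.sqrt T * expR (- (theta * (rho / T)))) /\
     {ae P, forall w, error_le T dt (f w) w}].
Proof.
have [C [dt0 [C1 dt00 dt01 err]]] := scheme_error_le.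
have C0 : 0 < C := lt_le_trans ltr01 C1.
have C0' := ltW C0.
pose m := card.+1%:R : R.
have m0 : 0 < m by rewrite ltr0n.
pose KH := 1 + K0 + card%:R * exp_moment.
have K00 : 0 <= K0 := mean_le_bound_ge0 start_moment.
have KH1 : 1 <= KH.
  by rewrite /KH -addrA lerDl addr_ge0// mulr_ge0// exp_moment_ge0.
have KH0 : 0 <= KH := le_trans ler01 KH1.
pose A1 := 1 + c0^-1 + 32.
have A10 : 0 <= A1 by rewrite !addr_ge0// invr_ge0 ltW.
(* For [T <= T1], the order [2 * C * T] of the squared exponential factor, times [m], is within the
   available orders [c0] for the start and [(32 * T)^-1] for the noise. *)
pose T1 := Num.min 1 (Num.min (c0 / (2 * C * m)) (64 * C * m)^-1).
have Cm0 : 0 < C * m by rewrite mulr_gt0.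
have T10 : 0 < T1.
  by rewrite !lt_min ltr01 divr_gt0 ?invr_gt0 -?mulrA ?mulr_gt0.
(* The same two constraints for the order [2 * theta / T], now for [T >= T1]. *)
pose theta := Num.min (c0 * T1 / (2 * m)) (64 * m)^-1.
have theta0 : 0 < theta.
  by rewrite lt_min divr_gt0 ?invr_gt0 ?mulr_gt0.
pose D2 := C / Num.sqrt theta * expR (2 * theta / T1) * KH.
have D20 : 0 <= D2 by rewrite !mulr_ge0 ?expR_ge0// invr_ge0 sqrtr_ge0.
pose D := C + 4 + D2.
have DC : C + 3 <= D by rewrite /D; lra.
have D1 : 1 <= D by lra.
exists D, theta; split=> // n n1.
have n0 : (0 < n)%N := ltnW n1.
have [Kg HKg] := grid_power_moment n0.
pose KQ := KH + `|Kg|.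
have KQ0 : 0 <= KQ by rewrite addr_ge0.
pose B1 := 5 + 4 * A1 + expR (2 * C).
have B10 : 0 <= B1 by rewrite !addr_ge0 ?expR_ge0// mulr_ge0.
pose q0 := dt0 `^ rate n.
have q00 : 0 < q0 by exact: powR_gt0.
pose KA := C * B1 * KQ; pose KB := C * (2 + A1) * KQ.
have KA0 : 0 <= KA by rewrite !mulr_ge0.
have KB0 : 0 <= KB by rewrite !mulr_ge0// addr_ge0.
have KB0q : 0 <= KB / q0 by rewrite divr_ge0// ltW.
exists (1 + KA + KB + KB / q0); split; first by rewrite -!addrA lerDl !addr_ge0.
set K := 1 + KA + KB + KB / q0.
have KAK : KA <= K by rewrite /K; lra.
have KBK : KB <= K by rewrite /K; lra.
have KqK : KB / q0 <= K by rewrite /K; lra.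
move=> rho T dt rho0 T0 dtgt0 dtT.
have T0' := ltW T0.
pose q := dt `^ rate n.
have q_gt0 : 0 < q by exact: powR_gt0.
have q_ge0 := ltW q_gt0.
have eT : 1 + T <= expR T by exact: expR_ge1Dx.
have T1p : 0 <= 1 + T by rewrite addr_ge0.
pose Q w := grid_power T dt n w.
have HQ w : 0 <= Q w.
  rewrite /Q /grid_power mulr_ge0 ?(ltW dtgt0)//; apply: sumr_ge0 => j _; apply: sumr_ge0 => p _.
  by rewrite exprn_ge0// divr_ge0 ?sqr_ge0// ltW.
pose mw w := moment_weight T w.
have mw1 w : 1 <= mw w by exact: moment_weight_ge1.
pose H w := mw w + Q w.
have HH : mean_le P H (KQ * (1 + T)).
  apply: mean_le_weaken (mean_leD (moment_weight_mean T0) (HKg T dt dtgt0 dtT)).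
  exact: affine_mul_le KH0 (ler_norm _) (normr_ge0 _) T0'.
have s_le w : path_size T w <= A1 * (1 + T) * mw w by exact: path_size_le.
have tail0 : 0 <= D * Num.sqrt T * expR (- (theta * (rho / T))).
  by rewrite !mulr_ge0 ?sqrtr_ge0 ?expR_ge0// (le_trans ler01).
have target_le k c e : 0 <= k -> k <= K -> c <= e * T -> e <= D * (1 + rho) ->
    k * expR c * q <= K * expR (D * (1 + rho) * T) * q.
  move=> k0 kK ce eD; apply: ler_wpM2r => //; apply: ler_pM; rewrite ?expR_ge0//.
  by rewrite ler_expR; apply: le_trans ce _; exact: ler_wpM2r.
have [De1 De2 De3] := exponent_le C0' DC rho0.
have inc w k p : k.+1%:R * dt <= T ->
    increment_sup (noise p) (k%:R * dt) dt w <= q * Num.sqrt (1 + Q w).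
  by move=> kT; exact: increment_le_rate.
have o0 w : 0 <= q * Num.sqrt (1 + Q w) by rewrite mulr_ge0 ?sqrtr_ge0.
have r2 w : Num.sqrt (1 + Q w) ^+ 2 = 1 + Q w by rewrite sqr_sqrtr// addr_ge0.
have s1 w : 1 <= path_size T w by exact: path_size_ge1.
have y2 w : Num.sqrt (path_size T w) ^+ 2 = path_size T w.
  by rewrite sqr_sqrtr// (le_trans ler01).
have small_dt : dt <= 1 -> Num.sqrt dt <= q /\ dt <= q.
  move=> dt1; rewrite -powR12_sqrt ?(ltW dtgt0)//; split.
    by apply: ger_powR; rewrite ?dtgt0// rate_le.
  by apply: ger1_powR; rewrite ?dtgt0// (le_trans (rate_le n))// invf_le1// ler1n.
have [TT1|TT1] := leP T T1.
  have T1' : T <= 1 by apply: le_trans TT1 _; rewrite ge_min lexx.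
  have [sq dq] := small_dt (le_trans dtT T1').
  exists (fun w => C * q * B1 * H w); split.
    apply: mean_le_weaken (mean_leZ _ HH); last by rewrite !mulr_ge0.
    apply: (@le_trans _ _ (KA * expR T * q)).
      have -> : C * q * B1 * (KQ * (1 + T)) = KA * (1 + T) * q by rewrite /KA; ring.
      by rewrite ler_wpM2r// ler_wpM2l.
    by rewrite -[leLHS]addr0 lerD//; apply: (target_le _ _ 1) => //; rewrite mul1r.
  apply: (ae_mono (err T dt T0 dtgt0)) => w /= [_ /(_ _ (o0 w) (inc w))[e1 _]] k kT.
  apply: le_trans (e1 k kT) _.
  apply: le_trans (rate_am_gm C0' q_ge0 sq dq (sqrtr_ge0 _) (y2 w) (sqrtr_ge0 _) (r2 w) (expR_ge0 _)) _.
  rewrite -[leRHS]mulrA ler_wpM2l ?mulr_ge0//.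
  have E2 : expR (C * path_size T w * T) ^+ 2 <= expR (2 * C) * mw w.
    rewrite -expRM_natl.
    have -> : 2%:R * (C * path_size T w * T) = 2 * C * T * path_size T w by ring.
    apply: (@le_trans _ _ (expR (2 * C * T) * mw w)).
      apply: exp_path_size_le => //.
      - by rewrite !mulr_ge0.
      - have : T <= c0 / (2 * C * m) by apply: le_trans TT1 _; rewrite !ge_min lexx orbT.
        rewrite ler_pdivlMr; last by rewrite -mulrA mulr_gt0.
        by rewrite -/m => h; apply: le_trans h; rewrite le_eqVlt; apply/orP; left; apply/eqP; ring.
      - have : T <= (64 * C * m)^-1 by apply: le_trans TT1 _; rewrite !ge_min lexx !orbT.
        have Cm64 : 0 < 64 * C * m by rewrite -mulrA mulr_gt0.
        rewrite -/m -(ler_pM2r Cm64) mulVf ?gt_eqF// => h.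
        rewrite -(@ler_pM2r _ (32 * T)) ?mulr_gt0// mulVf ?gt_eqF ?mulr_gt0//.
        have -> : m * (2 * C * T) * (32 * T) = T * (64 * C * m) * T by ring.
        by apply: le_trans T1'; rewrite ler_piMl.
    rewrite ler_wpM2r ?(le_trans ler01)// ler_expR.
    by rewrite ler_piMr// mulr_ge0.
  have sm : path_size T w <= A1 * 2 * mw w.
    apply: le_trans (s_le w) _; rewrite ler_wpM2r ?(le_trans ler01)// ler_wpM2l//.
    by rewrite lerD2l.
  exact: weight_le_small A10 (expR_ge0 _) sm E2 (HQ w) (mw1 w).
have [dtle|dtgt] := leP dt dt0.
  have [sq dq] := small_dt (le_trans dtle dt01).
  pose E := expR (C * rho * T).
  pose F := C / Num.sqrt theta * Num.sqrt T * expR (- (theta * (rho / T))) * expR (2 * theta / T1).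
  have F0 : 0 <= F by rewrite !mulr_ge0 ?expR_ge0 ?sqrtr_ge0// invr_ge0 sqrtr_ge0.
  have G0 : 0 <= C * q * E * ((2 + A1) * (1 + T)).
    by rewrite !mulr_ge0 ?expR_ge0// addr_ge0.
  exists (fun w => C * q * E * ((2 + A1) * (1 + T)) * H w + F * mw w); split.
    apply: mean_le_weaken (mean_leD (mean_leZ G0 HH) (mean_leZ F0 (moment_weight_mean T0))).
    rewrite -/KH; apply: lerD.
      (* Each polynomial factor [1 + T] is traded for [expR T] and goes into the exponent. *)
      apply: (@le_trans _ _ (KB * expR (C * rho * T + T + T) * q)).
        rewrite !expRD.
        have -> : C * q * E * ((2 + A1) * (1 + T)) * (KQ * (1 + T)) =
            KB * (E * (1 + T) * (1 + T)) * q by rewrite /KB; ring.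
        rewrite ler_wpM2r// ler_wpM2l//; apply: ler_pM => //; first by rewrite mulr_ge0 ?expR_ge0.
        by rewrite ler_wpM2l// expR_ge0.
      apply: (target_le _ _ (C * rho + 2)) => //.
      by rewrite mulrDl mulr_natl mulr2n addrA.
    have -> : F * KH = D2 * Num.sqrt T * expR (- (theta * (rho / T))) by rewrite /F /D2; ring.
    by rewrite ler_wpM2r ?expR_ge0// ler_wpM2r ?sqrtr_ge0// /D lerDr addr_ge0.
  apply: (ae_mono (err T dt T0 dtgt0)) => w /= [/(_ dtle) e0 /(_ _ (o0 w) (inc w))[e1 _]] k kT.
  have mwp : 0 <= mw w := le_trans ler01 (mw1 w).
  have [srho|srho] := leP (path_size T w) rho.
    rewrite -[leLHS]addr0; apply: lerD; last by rewrite mulr_ge0.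
    apply: le_trans (e1 k kT) _.
    apply: le_trans (rate_fixed C0' q_ge0 sq dq (sqrtr_ge0 _) (y2 w) (s1 w) (sqrtr_ge0 _) (r2 w) (HQ w) (expR_ge0 _)) _.
    rewrite -[leRHS]mulrA; apply: ler_pM.
    - by rewrite !mulr_ge0 ?expR_ge0.
    - by apply: addr_ge0; [exact: addr_ge0|exact: le_trans ler01 (s1 w)].
    - by rewrite ler_wpM2l ?mulr_ge0// ler_expR ler_wpM2r// ler_wpM2l.
    exact: weight_le A10 T0' (s_le w) (HQ w) (mw1 w).
  rewrite -[leLHS]add0r; apply: lerD.
    by rewrite mulr_ge0// addr_ge0.
  apply: le_trans (e0 k kT) _.
  set s := path_size T w in srho *.
  have sp : 0 <= s by apply: le_trans ler01 (s1 w).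
  have x0 : 0 <= theta * (s / T) by rewrite mulr_ge0 ?(ltW theta0)// divr_ge0.
  (* Measuring [s] in units of [T / theta] brings out the factor [Num.sqrt T] of the claim. *)
  have ysE : Num.sqrt s = (Num.sqrt theta)^-1 * Num.sqrt T * Num.sqrt (theta * (s / T)).
    have tT : 0 < T / theta by rewrite divr_gt0.
    rewrite -sqrtrV ?(ltW theta0)// -!sqrtrM ?mulr_ge0 ?invr_ge0 ?(ltW theta0)//.
    by congr Num.sqrt; field; rewrite !gt_eqF.
  rewrite ysE /F.
  (* On [s > rho] the exponent is doubled: one copy of [theta * (s / T)] is spent on the decay in
     [rho], the remainder has a finite mean. *)
  have e2 : expR (theta * (s / T)) <= expR (- (theta * (rho / T))) * expR (2 * theta / T * s).
    rewrite -expRD ler_expR.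
    have : theta * (rho / T) <= theta * (s / T).
      by rewrite ler_pM2l// ler_pM2r ?invr_gt0// ltW.
    have -> : 2 * theta / T * s = 2 * (theta * (s / T)) by ring.
    exact: double_shift.
  have e3 : expR (2 * theta / T * s) <= expR (2 * theta / T1) * mw w.
    have TT1' := ltW TT1.
    have t2 : 0 <= 2 * theta by rewrite mulr_ge0// ltW.
    apply: (@le_trans _ _ (expR (2 * theta / T) * mw w)).
      apply: exp_path_size_le => //.
      - by rewrite divr_ge0.
      - rewrite -/m mulrA ler_pdivrMr//.
        have : theta <= c0 * T1 / (2 * m) by rewrite ge_min lexx.
        rewrite ler_pdivlMr ?mulr_gt0// => h.
        have : c0 * T1 <= c0 * T by rewrite ler_pM2l.
        exact: theta_scale.
      - have h : theta * (64 * m) <= 1.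
          by rewrite -ler_pdivlMr ?mulr_gt0// mul1r ge_min lexx orbT.
        rewrite -/m -(@ler_pM2r _ (32 * T)) ?mulr_gt0// mulVf ?gt_eqF ?mulr_gt0//.
        have -> // : m * (2 * theta / T) * (32 * T) = theta * (64 * m).
        by field; rewrite gt_eqF.
    rewrite ler_wpM2r// ler_expR ler_wpM2l// lef_pV2 ?posrE//.
  have e4 : Num.sqrt (theta * (s / T)) <= expR (theta * (s / T)) by exact: sqrt_le_exp.
  have -> : C / Num.sqrt theta * Num.sqrt T * expR (- (theta * (rho / T))) * expR (2 * theta / T1) * mw w
    = C * ((Num.sqrt theta)^-1 * Num.sqrt T * (expR (- (theta * (rho / T))) * (expR (2 * theta / T1) * mw w))).
    by ring.
  rewrite ler_wpM2l//; apply: ler_wpM2l; first by rewrite mulr_ge0 ?invr_ge0 ?sqrtr_ge0.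
  by apply: (le_trans e4); apply: (le_trans e2); rewrite ler_wpM2l ?expR_ge0.
have q0q : q0 <= q.
  by apply: ge0_ler_powR; rewrite ?nnegrE ?rate_ge0 ?ltW.
pose E := expR (C * T).
have G0 : 0 <= C * E * ((2 + A1) * (1 + T) ^+ 2) * (q / q0).
  by rewrite !mulr_ge0 ?expR_ge0 ?exprn_ge0 ?addr_ge0 ?invr_ge0// ltW.
exists (fun w => C * E * ((2 + A1) * (1 + T) ^+ 2) * (q / q0) * H w); split.
  apply: mean_le_weaken (mean_leZ G0 HH).
  rewrite -[leLHS]addr0 lerD//.
  apply: (@le_trans _ _ (KB / q0 * expR (C * T + T + T + T) * q)).
    rewrite !expRD.
    have -> : C * E * ((2 + A1) * (1 + T) ^+ 2) * (q / q0) * (KQ * (1 + T)) =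
        KB / q0 * (E * (1 + T) * (1 + T) * (1 + T)) * q by rewrite /KB; ring.
    rewrite ler_wpM2r// ler_wpM2l//.
    have h1 : E * (1 + T) <= E * expR T by rewrite ler_wpM2l// expR_ge0.
    have E0 : 0 <= E by exact: expR_ge0.
    apply: ler_pM => //; first by rewrite !mulr_ge0.
    by apply: ler_pM => //; rewrite !mulr_ge0.
  apply: (target_le _ _ (C + 3)) => //.
  by have -> : (C + 3) * T = C * T + T + T + T by ring.
apply: (ae_mono (err T dt T0 dtgt0)) => w /= [_ /(_ _ (o0 w) (inc w))[_ e1]] k kT.
apply: le_trans (e1 k kT) _.
have sqT := sqrt_le_affine (ltW dtgt0) dtT.
have qT : q <= 1 + T.
  apply: (@le_trans _ _ ((1 + T) `^ rate n)).
    apply: ge0_ler_powR; rewrite ?nnegrE ?rate_ge0 ?ltW//.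
      by rewrite addrC ltr_wpDr// ltW.
    by apply: le_lt_trans dtT _; rewrite ltrDr.
  apply: ler1_powR; first by rewrite lerDl.
  by rewrite (le_trans (rate_le n))// invf_le1// ler1n.
have := rate_coarse C0' T0' q_ge0 sqT qT (ltW dtgt0) dtT (sqrtr_ge0 _) (y2 w) (s1 w) (sqrtr_ge0 _) (r2 w) (HQ w).
move=> /(ler_wpM2r (expR_ge0 (C * T))) /le_trans; apply.
have -> : C * E * ((2 + A1) * (1 + T) ^+ 2) * (q / q0) * H w
   = C * (1 + T) * ((2 + A1) * (1 + T) * H w) * E * (q / q0) by ring.
have mwp : 0 <= mw w := le_trans ler01 (mw1 w).
apply: (@le_trans _ _ (C * (1 + T) * ((2 + A1) * (1 + T) * H w) * E)).
  rewrite ler_wpM2r ?expR_ge0// ler_wpM2l ?mulr_ge0//.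
  exact: weight_le A10 T0' (s_le w) (HQ w) (mw1 w).
have H0 : 0 <= H w by exact: addr_ge0.
have A20 : 0 <= 2 + A1 by exact: addr_ge0.
apply: ler_peMr; last by rewrite ler_pdivlMr// mul1r.
by rewrite !mulr_ge0// expR_ge0.
Qed.

End strong_error.

(** The premise on [p] sits under the existential so that [choice] can make the constant a function
    of every [p]. *)
Lemma powR_le_exp (R : realType) (p : R) : exists c, 0 < c /\
  (0 <= p -> forall T, 0 < T -> T `^ p <= c * expR T).
Proof.
have [p0|p0] := leP 0 p; last by exists 1; split=> // /(lt_le_trans p0); rewrite ltxx.
have q0 : 0 < p + 1 by rewrite ltr_wpDl.
(* From [p ln T = p ln (T / (p + 1)) + p ln (p + 1)] and [ln x <= x], the first term is at most
   [T]. *)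
exists (expR (p * ln (p + 1))); split; first exact: expR_gt0.
move=> _ T T0; rewrite /powR gt_eqF// -expRD ler_expR.
have x0 : 0 < T / (p + 1) by rewrite divr_gt0.
have -> : T = T / (p + 1) * (p + 1) by rewrite divfK ?gt_eqF.
set x := T / (p + 1) in x0 *.
rewrite lnM ?posrE//.
have : ln x <= x.
  by rewrite -ler_expR lnK ?posrE//; apply: le_trans (expR_ge1Dx _); rewrite lerDr.
move=> /(ler_wpM2l p0); nra.
Qed.

(** * From pathwise bounds to the expected supremum *)

Section sup_error.
Context {R : realType} {disp : measure_display} {Omega : measurableType disp} (d : nat).
Variables (P : probability Omega R) (u v : R -> Omega -> 'rV[R]_d) (dt T : R).
Variables (U V : nat -> Omega -> 'rV[R]_d).
Hypotheses (dt0 : 0 < dt) (T0 : 0 <= T)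
  (mu : forall t, 0 <= t -> measurable_vec (u t) /\ measurable_vec (v t))
  (mU : forall k, measurable_vec (U k) /\ measurable_vec (V k)).

Lemma measurable_scheme_error k :
  measurable_fun setT (fun w => enorm (scheme_error u v dt U V k w)).
Proof.
have kdt : 0 <= k%:R * dt by rewrite mulr_ge0// ltW.
apply: (@measurableT_comp _ _ _ _ _ _ (@Num.sqrt R)).
  by apply: continuous_measurable_fun; exact: sqrt_continuous.
rewrite (_ : (fun w => _) = (fun w =>
   \sum_(i < d) (u (k%:R * dt) w 0 i - U k w 0 i) ^+ 2 +
   \sum_(i < d) (v (k%:R * dt) w 0 i - V k w 0 i) ^+ 2)).
  apply: measurable_funD; apply: measurable_sum => i; apply: measurable_funX;
    apply: measurable_funB.
  - exact: (mu kdt).1.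
  - exact: (mU k).1.
  - exact: (mu kdt).2.
  - exact: (mU k).2.
apply/funext => w; rewrite big_split_ord; congr (_ + _); apply: eq_bigr => i _.
  by rewrite row_mxEl !mxE.
by rewrite row_mxEr !mxE.
Qed.

Lemma sup_error_ge0 w : (0 <= sup_error u v dt U V T w)%E.
Proof.
apply: (@le_trans _ _ (enorm (scheme_error u v dt U V 0 w))%:E).
  by rewrite lee_fin sqrtr_ge0.
by apply: ereal_sup_ubound; exists 0%N => //=; rewrite mul0r.
Qed.

Lemma measurable_sup_error : measurable_fun setT (sup_error u v dt U V T).
Proof.
(* Inadmissible indices are sent to [0], admissible as [T >= 0]; the supremum then runs over all
   integers. *)
pose g k w := (enorm (scheme_error u v dt U V (if k%:R * dt <= T then k else 0%N) w))%:E.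
rewrite (_ : sup_error u v dt U V T = fun w => esups (g ^~ w) 0%N).
  apply: measurable_fun_esups => k; apply/measurable_EFinP.
  exact: measurable_scheme_error.
apply/funext => w; rewrite /sup_error /esups; congr ereal_sup.
apply/seteqP; split => x /=.
  by move=> [k /= kT <-]; exists k => //; rewrite /g kT.
move=> [k _ <-]; rewrite /g; case: ifPn => [kT|_]; first by exists k.
by exists 0%N => //=; rewrite mul0r.
Qed.

Lemma expected_sup_error_ge0 : (0 <= expected_sup_error P u v dt U V T)%E.
Proof. by apply: integral_ge0 => w _; exact: sup_error_ge0. Qed.

Lemma expected_sup_error_le f b : mean_le P f b ->
  {ae P, forall w, forall k : nat, k%:R * dt <= T -> enorm (scheme_error u v dt U V k w) <= f w} ->
  (expected_sup_error P u v dt U V T <= b%:E)%E.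
Proof.
move=> [mf f0 fb] err; apply: le_trans fb; apply: ae_ge0_le_integral => //.
- by move=> w _; exact: sup_error_ge0.
- exact: measurable_sup_error.
- by move=> w _; rewrite lee_fin.
- exact/measurable_EFinP.
apply: (ae_mono err) => w ew _; apply: ge_ereal_sup => _ [k /= kT <-].
by rewrite lee_fin; exact: ew.
Qed.

End sup_error.

Section start.
Context {R : realType} {disp : measure_display} {Omega : measurableType disp} (d : nat).
Variables (beta lambda : R) (G : 'rV[R]_d -> R) (P : probability Omega R).
Variables (u v : R -> Omega -> 'rV[R]_d).
Variables (target rho0 : probability (phase_point R d) R).
Hypotheses (beta_gt0 : 0 < beta) (lambda_gt0 : 0 < lambda) (HG : potential_assumptions G)
  (mu : measurable_vec (u 0) /\ measurable_vec (v 0))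
  (Hpi : is_target beta lambda G target)
  (Hlaw : forall A : set (phase_point R d), measurable A ->
     P [set w | A (tuple_of_vec (u 0 w), tuple_of_vec (v 0 w))] = rho0 A)
  (Hac : rho0 `<< target)
  (Hbdd : exists M : R,
     {ae target, forall z, ('d (charge_of_finite_measure rho0) '/d target z <= M%:E)%E}).

Lemma start_exp_moment : exists c K, 0 < c /\ mean_le P (fun w => expR (c * start_sq u v w)) K.
Proof.
have [c [K [c0 K0 tail]]] := initial_tail beta_gt0 lambda_gt0 (pot_bounded_below HG) Hpi Hac Hbdd.
exists c, (expR 1 + K * (expR 2 / (1 - expR (- 1)))); split=> //.
have startE w : start_sq u v w = sqnorm_phase (tuple_of_vec (u 0 w), tuple_of_vec (v 0 w)).
  rewrite /start_sq sum_pairs big_split /= /sqnorm_phase /sqnorm_tuple.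
  by congr (_ + _); apply: eq_bigr => i _; rewrite tnth_mktuple.
have ms : measurable_fun setT (start_sq u v).
  apply: measurable_sum => -[[] i]; apply: measurable_funX.
    exact: mu.2.
  exact: mu.1.
have mcs : measurable_fun setT (fun w => c * start_sq u v w) by exact: measurable_funM.
split; first exact: measurableT_comp.
  by move=> w; exact: expR_ge0.
apply: exp_moment_tail => //.
  by move=> w; rewrite mulr_ge0 ?start_sq_ge0// ltW.
move=> n; pose A := [set z : phase_point R d | n%:R < c * sqnorm_phase z].
have mA : measurable A.
  rewrite (_ : A = (fun z => c * sqnorm_phase z) @^-1` `]n%:R, +oo[%classic).
    rewrite -[X in measurable X]setTI; apply: measurable_funM => //.
    exact: measurable_sqnorm_phase.
  by apply/seteqP; split => z /=; rewrite in_itv /= andbT.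
apply: le_trans (tail n); rewrite -(Hlaw mA) le_eqVlt; apply/orP; left; apply/eqP.
by congr (P _); apply/funext => w; rewrite /A /= startE.
Qed.

End start.

(** * Choice of the constants and convergence *)

Theorem theorem3p7 (R : realType) (d : nat) (beta lambda : R)
    (beta_gt0 : 0 < beta) (lambda_gt0 : 0 < lambda)
    (G : 'rV[R]_d -> R) (HG : potential_assumptions G)
    (disp : measure_display) (Omega : measurableType disp)
    (P : probability Omega R)
    (W1 W2 : R -> Omega -> 'rV[R]_d)
    (HW1 : standard_brownian_vec P W1) (HW2 : standard_brownian_vec P W2)
    (u v : R -> Omega -> 'rV[R]_d)
    (Huv : sde_solution P beta lambda G W1 W2 u v)
    (Hindep : mutually_independent P
       (fun j : 'I_3 => nth set0
          [:: sigma_vec (fun w => row_mx (u 0 w) (v 0 w));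
              sigma_process W1; sigma_process W2] j))
    (U V : R -> nat -> Omega -> 'rV[R]_d)
    (HUV : forall dt, 0 < dt ->
       scheme_solution P beta lambda G W1 W2 dt (U dt) (V dt))
    (Hinit : forall dt, 0 < dt ->
       {ae P, forall w, U dt 0%N w = u 0 w /\ V dt 0%N w = v 0 w})
    (target rho0 : probability (phase_point R d) R)
    (Hpi : is_target beta lambda G target)
    (Hlaw : forall A : set (phase_point R d), measurable A ->
       P [set w | A (tuple_of_vec (u 0 w), tuple_of_vec (v 0 w))] = rho0 A)
    (Hac : rho0 `<< target)
    (Hbdd : exists M : R,
       {ae target, forall z, ('d (charge_of_finite_measure rho0) '/d target z <= M%:E)%E}) :
  exists C : R, 0 < C /\
  exists C_ : R -> R, exists c_ : R -> R -> R,
    [/\ forall r, 0 < r -> 0 < C_ r,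
        forall eps r, 0 < eps -> 0 < r -> 0 < c_ eps r,
        forall eps r T dt, 0 < eps -> 0 < r -> 0 < T -> 0 < dt ->
          (expected_sup_error P u v dt (U dt) (V dt) T
           <= (error_bound d T (c_ eps r) (C_ r) C dt eps r)%:E)%E,
        forall eps T eta, 0 < eps -> eps < 2^-1 -> 0 < T -> 0 < eta ->
          exists r, 0 < r /\
            \forall dt \near 0^'+,
              error_bound d T (c_ eps r) (C_ r) C dt eps r < eta
      & forall T, 0 < T ->
          expected_sup_error P u v dt (U dt) (V dt) T @[dt --> 0^'+] --> 0%E].
Proof.
have mu := sde_measurable Huv.
have mU dt : 0 < dt -> forall k, measurable_vec (U dt k) /\ measurable_vec (V dt k).
  by move=> dt0 k; exact: scheme_measurable (HUV dt dt0) k.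
have [c0 [K0 [c00 start]]] :=
  start_exp_moment beta_gt0 lambda_gt0 HG (mu 0 (lexx _)) Hpi Hlaw Hac Hbdd.
have [D [theta [D1 theta0 HD]]] :=
  mean_error beta_gt0 lambda_gt0 HG HW1 HW2 Huv HUV Hinit c00 start.
have D0 : 0 < D := lt_le_trans ltr01 D1.
(* Large enough that the loss [1 / (2 n)] is at most [eps]; the offset [2] also ensures [n > 1]. *)
pose level (eps : R) : nat := (Num.truncn eps^-1).+2.
have [K HK] := choice (fun eps : R => HD (level eps) isT).
have gap eps : 0 < eps -> 0 <= eps - (2 * (level eps)%:R)^-1.
  move=> e0; rewrite subr_ge0 invf_ple ?posrE ?mulr_gt0// /level -!natr1.
  have := truncnS_gt eps^-1; rewrite -natr1.
  have : 0 <= (Num.truncn eps^-1)%:R :> R by [].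
  lra.
have [cp Hcp] := choice (fun p : R => powR_le_exp p).
(* Turns [theta * (rho / T)] into [D * (r ^+ 2 / T)], so that the same constant stands before and
   inside the exponential. *)
pose rho r := D * r ^+ 2 / theta.
have rho0' r : 0 <= rho r.
  by apply: divr_ge0; [apply: mulr_ge0; [exact: ltW|exact: sqr_ge0]|exact: ltW].
(* The additional [1] pays for the factor [expR T] that bounds the surplus power of [dt]. *)
pose C_ r := D * (1 + rho r) + 1.
have C_0 r : 0 < C_ r.
  by apply: ltr_wpDl => //; apply: mulr_ge0; [exact: ltW|exact: addr_ge0].
pose slack eps := eps - (2 * (level eps)%:R)^-1.
pose c_ (eps r : R) := K eps * cp (slack eps).
have K1 eps : 1 <= K eps := (HK eps).1.
have c_0 eps r : 0 < c_ eps r.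
  by apply: mulr_gt0; [exact: lt_le_trans ltr01 (K1 eps)|exact: (Hcp _).1].
have bound_ge0 eps r T dt : 0 <= error_bound d T (c_ eps r) (C_ r) D dt eps r.
  rewrite /error_bound; apply: addr_ge0.
    by do 3 (apply: mulr_ge0; rewrite ?expR_ge0 ?powR_ge0//); exact: ltW (c_0 _ _).
  by do 2 (apply: mulr_ge0; rewrite ?expR_ge0 ?sqrtr_ge0//); exact: ltW.
have main eps r T dt : 0 < eps -> 0 < r -> 0 < T -> 0 < dt ->
    (expected_sup_error P u v dt (U dt) (V dt) T
      <= (error_bound d T (c_ eps r) (C_ r) D dt eps r)%:E)%E.
  move=> eps0 r0 T0 dt0.
  have from_mean := @expected_sup_error_le R disp Omega d P u v dt T (U dt) (V dt) dt0 (ltW T0) mu (mU dt dt0).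
  have trivial_case : {ae P, forall w, forall k : nat, k%:R * dt <= T ->
        enorm (scheme_error u v dt (U dt) (V dt) k w) <= 0} ->
      (expected_sup_error P u v dt (U dt) (V dt) T
        <= (error_bound d T (c_ eps r) (C_ r) D dt eps r)%:E)%E.
    by move=> H; apply: from_mean (mean_le_weaken _ (mean_le_cst P (lexx 0))) H.
  (* In dimension [0] the factor [d] cancels the first term of the bound, but the error is an empty
     vector. *)
  have [d0|d1] := posnP d.
    apply: trivial_case; apply: nearW => w k _; rewrite /scheme_error.
    apply: le_trans (@enorm_le _ _ _ 0 _) _; last by rewrite mulr0.
    by move=> [i i0]; exfalso; have : (i < d + d)%N := i0; rewrite d0.
  (* If [dt > T], only [k = 0] enters the supremum, where scheme and solution agree. *)
  have [Tdt|dtT] := ltP T dt.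
    apply: trivial_case; apply: (ae_mono (Hinit dt dt0)) => w [U0 V0] [_|k kT].
      rewrite /scheme_error mul0r U0 V0 !subrr row_mx0 /enorm.
      by rewrite big1 ?sqrtr0// => i _; rewrite mxE expr0n.
    have : dt <= k.+1%:R * dt by rewrite ler_peMl ?(ltW dt0)// ler1n.
    by move=> /le_trans /(_ kT); rewrite leNgt Tdt.
  have [f [mf ef]] := (HK eps).2 (rho r) T dt (rho0' r) T0 dt0 dtT.
  apply: le_trans (from_mean _ _ mf ef) _; rewrite lee_fin /error_bound.
  apply: lerD; last first.
    have -> // : theta * (rho r / T) = D * (r ^+ 2 / T).
    by rewrite /rho; field; rewrite !gt_eqF.
  have dn0 : dt != 0 by rewrite gt_eqF.
  have -> : dt `^ rate (level eps) = dt `^ (2^-1 - eps) * dt `^ slack eps.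
    rewrite -powRD ?dn0 ?implybT//; congr (_ `^ _); rewrite /rate /slack; ring.
  have pw : dt `^ slack eps <= cp (slack eps) * expR T.
    apply: le_trans ((Hcp _).2 (gap _ eps0) _ T0).
    by apply: ge0_ler_powR; rewrite ?nnegrE ?(gap _ eps0)// ltW.
  have K0' : 0 <= K eps := le_trans ler01 (K1 eps).
  have cp0 := ltW (Hcp (slack eps)).1.
  rewrite mulrCA [leRHS]mulrC; apply: ler_wpM2l; first exact: powR_ge0.
  apply: (@le_trans _ _ (K eps * expR (D * (1 + rho r) * T) * (cp (slack eps) * expR T))).
    by apply: ler_wpM2l => //; rewrite mulr_ge0// expR_ge0.
  have -> : K eps * expR (D * (1 + rho r) * T) * (cp (slack eps) * expR T)
     = c_ eps r * (expR (D * (1 + rho r) * T) * expR T) by rewrite /c_; ring.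
  have c0' := ltW (c_0 eps r).
  apply: ler_pM; rewrite ?(mulr_ge0 (expR_ge0 _) (expR_ge0 _))//.
    by rewrite ler_peMr// ler1n.
  rewrite -expRD ler_expR.
  have -> : D * (1 + rho r) * T + T = C_ r * T by rewrite /C_; ring.
  have : 0 <= T * C_ r by rewrite mulr_ge0 ?(ltW T0)// ltW.
  lra.
have small eps T eta : 0 < eps -> eps < 2^-1 -> 0 < T -> 0 < eta ->
    exists r, 0 < r /\ \forall dt \near 0^'+,
      error_bound d T (c_ eps r) (C_ r) D dt eps r < eta.
  move=> eps0 eps1 T0 eta0.
  (* With [r^2 = T x / D] the second term becomes [eta / 2 * (x * exp (- x))], which is below
     [eta / 2]. Then [r] is fixed and [dt] tends to [0]. *)
  pose x := 2 * D * Num.sqrt T / eta.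
  have sT0 : 0 < Num.sqrt T by rewrite sqrtr_gt0.
  have x0 : 0 < x by rewrite divr_gt0// !mulr_gt0.
  pose r := Num.sqrt (T * x / D).
  have r0 : 0 < r by rewrite sqrtr_gt0 divr_gt0// mulr_gt0.
  exists r; split=> //.
  have tail : D * Num.sqrt T * expR (- (D * (r ^+ 2 / T))) < eta / 2.
    have -> : D * (r ^+ 2 / T) = x.
      rewrite sqr_sqrtr; first by field; rewrite !gt_eqF.
      exact: divr_ge0 (mulr_ge0 (ltW T0) (ltW x0)) (ltW D0).
    have -> : D * Num.sqrt T = eta / 2 * x by rewrite /x; field; rewrite gt_eqF.
    rewrite -mulrA gtr_pMr ?divr_gt0// expRN -ltr_pdivlMr ?invr_gt0 ?expR_gt0// invrK mul1r.
    by apply: lt_le_trans (expR_ge1Dx _); rewrite ltrDr.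
  pose A := c_ eps r * d%:R * expR (2 * T * C_ r) + 1.
  have A0 : 0 < A.
    apply: ltr_wpDl => //; apply: mulr_ge0; last exact: expR_ge0.
    by apply: mulr_ge0 => //; exact: ltW.
  have p0 : 0 < 2^-1 - eps by rewrite subr_gt0.
  have := @powR_cvg0 R (2^-1 - eps) p0.
  move=> /cvgr_lt /(_ (eta / 2 / A)); rewrite !divr_gt0// => /(_ isT).
  apply: filterS => dt Hdt; rewrite /error_bound (splitr eta); apply: ltrD => //.
  apply: (@le_lt_trans _ _ (A * dt `^ (2^-1 - eps))).
    by rewrite ler_wpM2r ?powR_ge0// lerDl.
  by rewrite mulrC -ltr_pdivlMr.
exists D; split=> //; exists C_, c_; split=> //.
move=> T T0 A /= nA.
have [e e0 eA] : exists2 e : R, 0 < e & forall x : R, `|x| < e -> A x%:E.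
  have /nbhs_ballP[e /= e0 eA] : nbhs (0 : R) (fun x => A x%:E) by exact: nA.
  by exists e => // x xe; apply: eA; rewrite /ball /= sub0r normrN.
have q0 : 0 < 4^-1 :> R by rewrite invr_gt0.
have q1 : 4^-1 < 2^-1 :> R by rewrite ltf_pV2 ?posrE// ltr_nat.
have [r [r0 near_small]] := small _ T e q0 q1 T0 e0.
change (\forall dt \near 0^'+, A (expected_sup_error P u v dt (U dt) (V dt) T)).
have dtpos : \forall dt \near 0^'+, 0 < dt :> R by exact: nbhs_right_gt.
move: near_small dtpos; apply: filterS2 => dt small_dt dt0.
have := main _ r T dt q0 r0 T0 dt0.
have := expected_sup_error_ge0 P u v dt (U dt) (V dt) (ltW T0).
case: (expected_sup_error _ _ _ _ _ _ _) => [x| |]//.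
rewrite !lee_fin => x0 xb; apply: eA; rewrite ger0_norm//.
exact: le_lt_trans small_dt.
Qed.
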